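(* (a) Up to linear changes of the indeterminates, the maximal graded solvable Lie subsuperalgebras $\mathfrak s=\mathfrak s_{-1}\oplus\mathfrak s_0\oplus\mathfrak s_1$ of $\mathfrak{vect}(0|2)$ are precisely the following two: - $\mathfrak{ms}V$: $\mathfrak s_{-1}=\mathrm{Span}(\partial_1)$; $\mathfrak s_0=\mathrm{Span}(\xi_1\partial_1,\ \xi_2\partial_1,\ \xi_2\partial_2)$; $\mathfrak s_1=\mathrm{Span}(\xi_1\xi_2\partial_1,\ \xi_1\xi_2\partial_2)$. - $\mathfrak{msc}$: $\mathfrak s_{-1}=\mathrm{Span}(\partial_1,\partial_2)$; $\mathfrak s_0=\mathrm{Span}(\xi_1\partial_1,\ \xi_2\partial_1,\ \xi_2\partial_2)$; $\mathfrak s_1=\mathrm{Span}(\xi_1\xi_2\partial_1)$. (b) Up to linear changes of the indeterminates preserving the Poisson bracket, the maximal graded solvable Lie subsuperalgebras $\mathfrak s=\mathfrak s_{-1}\oplus\mathfrak s_0\oplus\mathfrak s_1$ of $\mathfrak h'(0|4)$ are precisely the following three (elements $H_f$ being given by generating functions $f$). In all three, $\mathfrak s_0=\mathrm{Span}(\xi_1\eta_1,\ \xi_1\xi_2,\ \xi_1\eta_2,\ \xi_2\eta_2)$, and: - $\mathfrak{ms}V$: $\mathfrak s_{-1}=\mathrm{Span}(\xi_1)$; $\mathfrak s_1=\mathrm{Span}(\xi_1\eta_1\eta_2,\ \xi_1\xi_2\eta_1,\ \xi_1\xi_2\eta_2,\ \xi_2\eta_1\eta_2)$. - $\mathfrak{msc}$: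 $\mathfrak s_{-1}=\mathrm{Span}(\xi_1,\xi_2,\eta_1,\eta_2)$; $\mathfrak s_1=\mathrm{Span}(\xi_1\xi_2\eta_2)$. - $\mathfrak{ms}\widetilde V$: $\mathfrak s_{-1}=\mathrm{Span}(\xi_1,\xi_2,\eta_2)$; $\mathfrak s_1=\mathrm{Span}(\xi_1\eta_1\eta_2,\ \xi_1\xi_2\eta_1,\ \xi_1\xi_2\eta_2)$.
   Context: The ground field is $\mathbb C$. $\mathfrak{vect}(0|2)$ is the Lie superalgebra of superderivations $f_1\partial_1+f_2\partial_2$ of the Grassmann algebra $\Lambda(2)$ on $\xi_1,\xi_2$ (each of degree 1, parity equal to the degree modulo 2), where $\partial_i\xi_j=\delta_{ij}$, with $\mathbb Z$-grading $\deg(f\partial_i)=\deg f-1$. Let $\Lambda(4)$ be the Grassmann algebra on $\xi_1,\xi_2,\eta_1,\eta_2$ (each of degree 1, parity $p$ equal to the degree modulo 2), with the Poisson bracket $$\{f,g\}=(-1)^{p(f)}\sum_{i=1}^{2}\Bigl(\frac{\partial f}{\partial\xi_i}\frac{\partial g}{\partial\eta_i}+\frac{\partial f}{\partial\eta_i}\frac{\partial g}{\partial\xi_i}\Bigr).$$ $\mathfrak h(0|4)=\mathrm{Span}\{H_f\mid f\in\Lambda(4)\}$, where $H_f=(-1)^{p(f)}\sum_{i=1}^2\bigl(\frac{\partial f}{\partial\xi_i}\partial_{\eta_i}+\frac{\partial f}{\partial\eta_i}\partial_{\xi_i}\bigr)$, is isomorphic to $\Lambda(4)$ with the Poisson bracket,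 modulo constants. $\mathfrak h'(0|4)$ is its derived algebra, spanned by $H_f$ with $f$ homogeneous of degree 1, 2 or 3. It is $\mathbb Z$-graded by $\deg H_f=\deg f-2$. A Lie subsuperalgebra $\mathfrak s\subset\mathfrak g$ is graded if $\mathfrak s=\bigoplus_i\mathfrak s_i$ with $\mathfrak s_i=\mathfrak s\cap\mathfrak g_i$. A maximal graded solvable subsuperalgebra is a graded solvable Lie subsuperalgebra not properly contained in any other graded solvable Lie subsuperalgebra of $\mathfrak g$. *)

(* Defs.v *)
From HB Require Import structures.
From mathcomp Require Import all_boot all_order all_algebra.
From mathcomp Require Import reals complex.
Set Implicit Arguments.
Unset Strict Implicit.
Unset Printing Implicit Defensive.
Import GRing.Theory.
Local Open Scope ring_scope.

Section Grassmann.
Variables (F : fieldType) (n : nat).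

(* An element is the family of its coefficients on the monomials
   xi_A = xi_(i1) ** ... ** xi_(ik), A = {i1 < ... < ik}. *)
Definition grassmann := {ffun {set 'I_n} -> F^o}.

Definition mono (A : {set 'I_n}) : grassmann := [ffun B => (B == A)%:R].
Definition gen (i : 'I_n) : grassmann := mono [set i].
Definition gone : grassmann := mono set0.

(* Number of transpositions needed to sort the word xi_A xi_B. *)
Definition inversions (A B : {set 'I_n}) : nat :=
  #|[set p : 'I_n * 'I_n | [&& p.1 \in A, p.2 \in B & (p.2 < p.1)%N]]|.

Definition gmul (f g : grassmann) : grassmann :=
  [ffun C : {set 'I_n} => \sum_(A : {set 'I_n} | A \subset C)
     (-1) ^+ inversions A (C :\: A) * f A * g (C :\: A)].

Fact gmul_is_linear (f : grassmann) : linear (gmul f).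
Proof.
move=> a g h; apply/ffunP=> C; rewrite !ffunE scaler_sumr -big_split /=.
apply: eq_bigr => A _; rewrite !ffunE mulrDr; congr (_ + _).
by rewrite /GRing.scale /= mulrCA.
Qed.
HB.instance Definition _ f :=
  GRing.isLinear.Build F grassmann grassmann _ (gmul f) (gmul_is_linear f).

(* The left superderivation with value delta_ij on xi_j; the exponent counts
   the generators that xi_i passes in xi_(i |: B). *)
Definition gder (i : 'I_n) (f : grassmann) : grassmann :=
  [ffun B : {set 'I_n} => if i \in B then 0 else
     (-1) ^+ #|[set j in B | (j < i)%N]| * f (i |: B)].

Fact gder_is_linear (i : 'I_n) : linear (gder i).
Proof.
move=> a g h; apply/ffunP=> B; rewrite !ffunE.
case: ifP => _; first by rewrite scaler0 addr0.
by rewrite mulrDr /GRing.scale /= mulrCA.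
Qed.
HB.instance Definition _ i :=
  GRing.isLinear.Build F grassmann grassmann _ (gder i) (gder_is_linear i).

(* (-1)^p(f) f, extended linearly to non-homogeneous f *)
Definition gtwist (f : grassmann) : grassmann :=
  [ffun A : {set 'I_n} => (-1) ^+ #|A| * f A].

(* projection onto the even (b = false) or odd (b = true) part *)
Definition gproj (b : bool) (f : grassmann) : grassmann :=
  [ffun A : {set 'I_n} => if odd #|A| == b then f A else 0].

Fact gproj_is_linear (b : bool) : linear (gproj b).
Proof.
move=> a g h; apply/ffunP=> B; rewrite !ffunE.
by case: ifP => _ //; rewrite scaler0 addr0.
Qed.
HB.instance Definition _ b :=
  GRing.isLinear.Build F grassmann grassmann _ (gproj b) (gproj_is_linear b).

(* The Lie superalgebra gl(Lambda(n)): all the Lie superalgebras below are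
   subsuperalgebras of it. *)
Local Notation gl := 'End(grassmann).

Definition epart (b : bool) (X : gl) : gl :=
  \sum_(c : bool) (linfun (gproj (c (+) b)) \o X \o linfun (gproj c))%VF.

Definition sbracket (X Y : gl) : gl :=
  \sum_(a : bool) \sum_(b : bool)
    ((epart a X \o epart b Y)%VF
       - (-1) ^+ (a && b) *: (epart b Y \o epart a X)%VF).

Definition vfield (f : grassmann) (i : 'I_n) : gl :=
  (linfun (gmul f) \o linfun (gder i))%VF.

Definition vect : {vspace gl} :=
  <<[seq vfield (mono A) i | A <- enum {set 'I_n}, i <- enum 'I_n]>>%VS.

Definition vect_deg (k : int) : {vspace gl} :=
  <<[seq vfield (mono A) i |
      A <- [seq A : {set 'I_n} <- enum {set 'I_n} | #|A|%:Z - 1 == k],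
      i <- enum 'I_n]>>%VS.

Definition subsuperalgebra (g s : {vspace gl}) : Prop :=
  [/\ (s <= g)%VS,
      forall b X, X \in s -> epart b X \in s
    & forall X Y, X \in s -> Y \in s -> sbracket X Y \in s].

(* The brackets of basis vectors span [s, s] by bilinearity. *)
Definition derived (s : {vspace gl}) : {vspace gl} :=
  <<[seq sbracket X Y | X <- vbasis s, Y <- vbasis s]>>%VS.

Definition solvable (s : {vspace gl}) : Prop :=
  exists k, iter k derived s = 0%VS.

(* Only the degrees -1, 0, 1 occur in vect(0|2) and h'(0|4). *)
Definition degrees : seq int := [:: -1; 0; 1].

Definition graded (gr : int -> {vspace gl}) (s : {vspace gl}) : Prop :=
  s = (\sum_(k <- degrees) (s :&: gr k))%VS
  /\ directv (\sum_(k <- degrees) (s :&: gr k)).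

Definition graded_solvable (g : {vspace gl}) (gr : int -> {vspace gl})
    (s : {vspace gl}) : Prop :=
  [/\ subsuperalgebra g s, graded gr s & solvable s].

Definition max_graded_solvable (g : {vspace gl}) (gr : int -> {vspace gl})
    (s : {vspace gl}) : Prop :=
  graded_solvable g gr s
  /\ forall t, graded_solvable g gr t -> (s <= t)%VS -> t = s.

(* The algebra endomorphism of Lambda(n) given by an invertible linear
   substitution of the generators. *)
Definition linear_change (phi : gl) : Prop :=
  [/\ phi gone = gone,
      forall f g, phi (gmul f g) = gmul (phi f) (phi g)
    & exists2 M : 'M[F]_n, M \in unitmx
        & forall i, phi (gen i) = \sum_j M i j *: gen j].

(* s is carried onto t by the action X |-> phi X phi^-1 on vector fields. *)
Definition carries (phi : gl) (s t : {vspace gl}) : Prop :=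
  forall X : gl, (X \in s) = ((phi \o X \o phi^-1)%VF \in t).

Definition lin_equiv (s t : {vspace gl}) : Prop :=
  exists2 phi, linear_change phi & carries phi s t.

End Grassmann.

Declare Scope grassmann_scope.
Delimit Scope grassmann_scope with GR.
Notation "f ** g" := (gmul f g)
  (at level 40, left associativity) : grassmann_scope.
Local Open Scope grassmann_scope.

Section Poisson.
Variables (F : fieldType) (m : nat).
Local Notation L := (grassmann F (m + m)).

(* Lambda(2m): the first m generators are the xi_i, the last m the eta_i. *)
Definition ixi (i : 'I_m) : 'I_(m + m) := lshift m i.
Definition ieta (i : 'I_m) : 'I_(m + m) := rshift m i.

Definition poisson (f g : L) : L :=
  \sum_(i < m) (gder (ixi i) (gtwist f) ** gder (ieta i) g
              + gder (ieta i) (gtwist f) ** gder (ixi i) g).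

Definition hfield (f : L) : 'End(L) :=
  \sum_(i < m) (vfield (gder (ixi i) (gtwist f)) (ieta i)
              + vfield (gder (ieta i) (gtwist f)) (ixi i)).

Definition ham : {vspace 'End(L)} :=
  <<[seq hfield (mono F A) | A : {set 'I_(m + m)}]>>%VS.

Definition ham' : {vspace 'End(L)} := derived ham.

Definition ham'_deg (k : int) : {vspace 'End(L)} :=
  (ham' :&: <<[seq hfield (mono F A) |
      A <- [seq A : {set 'I_(m + m)} <- enum {set 'I_(m + m)}
            | #|A|%:Z - 2 == k]]>>)%VS.

Definition hspan (fs : seq L) : {vspace 'End(L)} := <<map hfield fs>>%VS.

Definition poisson_equiv (s t : {vspace 'End(L)}) : Prop :=
  exists phi : 'End(L),
    [/\ linear_change phi,
        forall f g, phi (poisson f g) = poisson (phi f) (phi g)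
      & carries phi s t].

End Poisson.

Section Vect02.
Variable F : fieldType.
Local Notation x1 := (gen F (ord0 : 'I_2)).
Local Notation x2 := (gen F (ord_max : 'I_2)).
Local Notation one := (gone F 2).
Local Notation "f '\d1'" := (vfield f (ord0 : 'I_2)) (at level 45).
Local Notation "f '\d2'" := (vfield f (ord_max : 'I_2)) (at level 45).

Definition vect_msV : {vspace 'End(grassmann F 2)} :=
  (<<[:: one \d1]>>
   + <<[:: x1 \d1; x2 \d1; x2 \d2]>>
   + <<[:: x1 ** x2 \d1; x1 ** x2 \d2]>>)%VS.

Definition vect_msc : {vspace 'End(grassmann F 2)} :=
  (<<[:: one \d1; one \d2]>>
   + <<[:: x1 \d1; x2 \d1; x2 \d2]>>
   + <<[:: x1 ** x2 \d1]>>)%VS.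

End Vect02.

Section Ham04.
Variable F : fieldType.
Local Notation xi1 := (gen F (ixi (ord0 : 'I_2))).
Local Notation xi2 := (gen F (ixi (ord_max : 'I_2))).
Local Notation eta1 := (gen F (ieta (ord0 : 'I_2))).
Local Notation eta2 := (gen F (ieta (ord_max : 'I_2))).

Definition ham_s0 : {vspace 'End(grassmann F (2 + 2))} :=
  hspan [:: xi1 ** eta1; xi1 ** xi2; xi1 ** eta2; xi2 ** eta2].

Definition ham_msV : {vspace 'End(grassmann F (2 + 2))} :=
  (hspan [:: xi1]
   + ham_s0
   + hspan [:: xi1 ** eta1 ** eta2; xi1 ** xi2 ** eta1;
               xi1 ** xi2 ** eta2; xi2 ** eta1 ** eta2])%VS.

Definition ham_msc : {vspace 'End(grassmann F (2 + 2))} :=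
  (hspan [:: xi1; xi2; eta1; eta2]
   + ham_s0
   + hspan [:: xi1 ** xi2 ** eta2])%VS.

Definition ham_msVtilde : {vspace 'End(grassmann F (2 + 2))} :=
  (hspan [:: xi1; xi2; eta2]
   + ham_s0
   + hspan [:: xi1 ** eta1 ** eta2; xi1 ** xi2 ** eta1;
               xi1 ** xi2 ** eta2])%VS.

End Ham04.

(* Main.v *)
Require Import Defs.
From HB Require Import structures.
From mathcomp Require Import all_boot all_order all_algebra.
From mathcomp Require Import reals complex ring zify.
From Stdlib Require Import Classical_Prop.

(** Both parts follow one scheme. After a suitable change of the indeterminates
    every graded solvable subsuperalgebra lies in one of the listed models
    ([vect_cover], [ham_cover]); the models are themselves graded solvable; and
    no model is dominated by another one as far as the dimensions in degrees
    -1, 0, 1 are concerned, these being (1,3,2), (2,3,1) in the first part and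
    (1,4,4), (4,4,1), (3,4,3) in the second. Since changes of the
    indeterminates preserve these dimensions, the models are maximal, pairwise
    inequivalent, and every maximal element is equivalent to one of them
    ([max_iff_model], [models_inequivalent]).

    That the models are graded solvable is a finite computation. Brackets of
    monomial fields are signed sums of monomial fields, so the models and their
    derived series are spanned by sets of monomials, and the closure and
    vanishing conditions are read off from the multiplication table
    ([graded_solvable_tableP]).

    For vect(0|2), the degree 0 part of [s] acts on the span of xi1 and xi2 as
    a solvable subalgebra of gl(2), so it fixes a line by Lie's theorem
    ([lie_theorem2]); a linear change moves this line to that of xi2. The
    degree 0 part is then triangular: xi1 d2 does not occur. If X has degree
    -1 and Y has degree 1, the coefficient of xi1 d2 in [X, Y] is, up to sign,
    the product of the coefficient of d2 in X with that of xi1 xi2 d2 in Y. As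
    this product vanishes for all X and Y in [s], either d2 never occurs in
    degree -1, and [s] lies in msV, or xi1 xi2 d2 never occurs in degree 1, and
    [s] lies in msc.

    For h'(0|4), the fields H_f multiply as their generating functions do under
    the Poisson bracket ([sbracket_hfield]). The span of the generators is
    identified with the 2 by 2 matrices, the determinant being the quadratic
    form; the degree 0 part so(4) = sl(2) + sl(2) then acts by multiplications
    on the left and on the right ([spin_action]). Lie's theorem for both factors
    gives two eigenvectors whose product is a rank one matrix, that is, a stable
    isotropic line ([ham_isotropic_line]). Matrices of determinant 1 on both
    sides are canonical changes and move this line to that of xi1
    ([isotropic_normalize]), so that the degree 0 part lies in the Borel
    subalgebra common to the three models. For f in the degree -1 part and t in
    the degree 1 part, the Poisson bracket of f and t is in that subalgebra,
    which gives

      f_(eta1) t_(xi1 xi2 eta1) + f_(xi2) t_(xi2 eta1 eta2) = 0,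
      f_(eta1) t_(xi1 eta1 eta2) + f_(eta2) t_(xi2 eta1 eta2) = 0.

    If all f_(eta1) and all t_(xi2 eta1 eta2) vanish, [s] lies in the third
    model. If only the t_(xi2 eta1 eta2) do, the two other coefficients of t
    vanish as well and [s] lies in msc; if only the f_(eta1) do, [s] lies in
    msV by the same argument. If neither, then f_(eta2) = rho f_(eta1) on [s]
    for a constant rho, and the isotropic line of xi2 - rho xi1 is stable too;
    moving it to that of xi1 instead leads back to the first of these cases
    ([second_line]). *)

Set Implicit Arguments.
Unset Strict Implicit.
Unset Printing Implicit Defensive.
Import GRing.Theory.
Local Open Scope ring_scope.
Local Open Scope grassmann_scope.

(** * Multiplication and derivations of the Grassmann algebra *)

Section GrassmannAlgebra.
Variables (F : fieldType) (n : nat).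
Implicit Types (A B C : {set 'I_n}) (f g h : grassmann F n) (i j : 'I_n).
Local Notation L := (grassmann F n).
Local Notation x := (gen F).
Local Notation one := (gone F n).

Definition before i A : nat := #|[set j in A | (j < i)%N]|.

Lemma grassmannE f : f = \sum_A f A *: mono F A.
Proof.
apply/ffunP => B; rewrite sum_ffunE (bigD1 B) //= big1 => [|A nAB].
  by rewrite !ffunE eqxx /GRing.scale /= mulr1 addr0.
by rewrite !ffunE eq_sym (negPf nAB) /GRing.scale /= mulr0.
Qed.

Lemma gmulDl f g h : (f + g) ** h = f ** h + g ** h.
Proof.
apply/ffunP => C; rewrite !ffunE -big_split /=.
by apply: eq_bigr => A _; rewrite !ffunE mulrDr mulrDl.
Qed.

Lemma gmulZl a f h : (a *: f) ** h = a *: (f ** h).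
Proof.
apply/ffunP => C; rewrite !ffunE scaler_sumr.
by apply: eq_bigr => A _; rewrite !ffunE /GRing.scale /=; ring.
Qed.

Lemma gmulDr f g h : f ** (g + h) = f ** g + f ** h.
Proof. exact: linearD. Qed.

Lemma gmulZr a f h : f ** (a *: h) = a *: (f ** h).
Proof. exact: linearZ. Qed.

Lemma gmul0r f : f ** 0 = 0. Proof. exact: linear0. Qed.

Lemma gmul0l f : 0 ** f = 0.
Proof. by rewrite -(scale0r (0 : L)) gmulZl !scale0r. Qed.

Lemma gmulNr f g : f ** (- g) = - (f ** g). Proof. exact: linearN. Qed.

Lemma gmulNl f g : (- f) ** g = - (f ** g).
Proof. by rewrite -scaleN1r gmulZl scaleN1r. Qed.

Lemma gmul_sumr I r (P : pred I) (G : I -> L) f :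
  f ** (\sum_(k <- r | P k) G k) = \sum_(k <- r | P k) f ** G k.
Proof. exact: linear_sum. Qed.

Lemma gmul_suml I r (P : pred I) (G : I -> L) f :
  (\sum_(k <- r | P k) G k) ** f = \sum_(k <- r | P k) G k ** f.
Proof.
apply: (big_ind2 (fun u v : L => u ** f = v)) => // [|? y1 ? y2 <- <-].
  exact: gmul0l.
exact: gmulDl.
Qed.

Lemma gmul_mono A B :
  mono F A ** mono F B =
    if [disjoint A & B] then (-1) ^+ inversions A B *: mono F (A :|: B) else 0.
Proof.
apply/ffunP => C; rewrite ffunE.
have zero A' : A' != A ->
    (-1) ^+ inversions A' (C :\: A') * mono F A A' * mono F B (C :\: A') = 0.
  by move=> nA; rewrite !ffunE (negPf nA) mulr0 mul0r.
have [dAB|ndAB] := boolP [disjoint A & B]; last first.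
  rewrite big1 ?ffunE // => A' sA'C.
  have [->|/zero//] := eqVneq A' A.
  rewrite !ffunE eqxx; case: eqP => [E|_]; last by rewrite mulr0.
  case/negP: ndAB; rewrite -E -setI_eq0; apply/eqP/setP => i.
  by rewrite !inE; case: (i \in A).
rewrite !ffunE; have [EC|nC] := eqVneq C (A :|: B).
  rewrite {C}EC in zero *; rewrite (bigD1 A) ?subsetUl //=.
  rewrite big1 => [|A' /andP[_ /zero//]].
  have -> : (A :|: B) :\: A = B.
    apply/setP => i; rewrite !inE.
    by case: (boolP (i \in A)) => //= /(disjointFr dAB) ->.
  by rewrite !ffunE !eqxx addr0 /GRing.scale /= !mulr1.
rewrite big1 ?scaler0 // => A' sA'C.
have [EA|/zero//] := eqVneq A' A; rewrite EA in sA'C *.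
rewrite !ffunE eqxx; case: eqP => [E|_]; last by rewrite mulr0.
case/eqP: nC; rewrite -E; apply/setP => i; rewrite !inE.
by case: (boolP (i \in A)) => // /(subsetP sA'C) ->.
Qed.

Lemma inversionsUl A B C : [disjoint A & B] ->
  inversions (A :|: B) C = (inversions A C + inversions B C)%N.
Proof.
move=> dAB; rewrite /inversions.
set X := [set p | _]; set Y := [set p | _]; set Z := [set p | _].
have -> : X = Y :|: Z.
  by apply/setP => p; rewrite !inE -andb_orl.
rewrite cardsU; have -> : Y :&: Z = set0; last by rewrite cards0 subn0.
apply/setP => p; rewrite !inE.
by case: (boolP (p.1 \in A)) => //= /(disjointFr dAB) ->; rewrite ?andbF.
Qed.

Lemma inversionsUr A B C : [disjoint B & C] ->
  inversions A (B :|: C) = (inversions A B + inversions A C)%N.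
Proof.
move=> dBC; rewrite /inversions.
set X := [set p | _]; set Y := [set p | _]; set Z := [set p | _].
have -> : X = Y :|: Z.
  by apply/setP => p; rewrite !inE -andb_orr andb_orl.
rewrite cardsU; have -> : Y :&: Z = set0; last by rewrite cards0 subn0.
apply/setP => p; rewrite !inE.
by case: (boolP (p.2 \in B)) => [/(disjointFr dBC) ->|_]; rewrite ?andbF.
Qed.

Lemma disjoint_setU A B C :
  [disjoint A :|: B & C] = [disjoint A & C] && [disjoint B & C].
Proof. by rewrite -disjointU; apply: eq_disjoint => i; rewrite !inE. Qed.

Lemma linear_ext (V : lmodType F) (u v : {linear L -> V}) :
  (forall A, u (mono F A) = v (mono F A)) -> u =1 v.
Proof.
move=> uv f; rewrite (grassmannE f) !linear_sum.
by apply: eq_bigr => A _; rewrite !linearZ /= uv.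
Qed.

(** On monomials both sides carry the sign of sorting three words, by
    additivity of the number of inversions in each argument. *)
Lemma gmulA f g h : f ** (g ** h) = f ** g ** h.
Proof.
have monoA A B C :
    mono F A ** (mono F B ** mono F C) = mono F A ** mono F B ** mono F C.
  rewrite !gmul_mono.
  have [dBC|ndBC] := boolP [disjoint B & C];
    have [dAB|ndAB] := boolP [disjoint A & B].
  - rewrite gmulZr gmulZl !gmul_mono.
    have -> : [disjoint A & B :|: C] = [disjoint A & C].
      by rewrite disjoint_sym disjoint_setU ![[disjoint _ & A]]disjoint_sym dAB.
    have -> : [disjoint A :|: B & C] = [disjoint A & C].
      by rewrite disjoint_setU dBC andbT.
    case: ifP => _; last by rewrite !scaler0.
    by rewrite !scalerA -!exprD inversionsUl // inversionsUr // setUA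
               addnC addnA.
  - rewrite gmul0l gmulZr gmul_mono ifF ?scaler0 //.
    apply: contraNF ndAB.
    by rewrite disjoint_sym disjoint_setU ![[disjoint _ & A]]disjoint_sym => /andP[].
  - rewrite gmul0r gmulZl gmul_mono ifF ?scaler0 //.
    by apply: contraNF ndBC; rewrite disjoint_setU => /andP[].
  by rewrite gmul0r gmul0l.
rewrite (grassmannE f) !gmul_suml; apply: eq_bigr => A _.
rewrite !gmulZl; congr (_ *: _).
rewrite (grassmannE g) gmul_suml !gmul_sumr gmul_suml; apply: eq_bigr => B _.
rewrite !(gmulZl, gmulZr); congr (_ *: _).
rewrite (grassmannE h) !gmul_sumr; apply: eq_bigr => C _.
by rewrite !gmulZr monoA.
Qed.
End GrassmannAlgebra.

Section GrassmannGenerators.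
Variables (F : fieldType) (n : nat).
Implicit Types (A B C : {set 'I_n}) (f g h : grassmann F n) (i j : 'I_n).
Local Notation L := (grassmann F n).
Local Notation x := (gen F).
Local Notation one := (gone F n).

Lemma gcoefD f g C : (f + g) C = f C + g C. Proof. by rewrite ffunE. Qed.
Lemma gcoefN f C : (- f) C = - f C. Proof. by rewrite ffunE. Qed.
Lemma gcoefZ a f C : (a *: f) C = a * f C. Proof. by rewrite ffunE. Qed.
Lemma gcoef0 C : (0 : L) C = 0. Proof. by rewrite ffunE. Qed.
Definition gcoefE := (gcoefD, gcoefN, gcoefZ, gcoef0).

Lemma inversions0l A : inversions set0 A = 0%N.
Proof. by apply/eqP; rewrite cards_eq0; apply/eqP/setP => p; rewrite !inE. Qed.

Lemma inversions0r A : inversions A set0 = 0%N.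
Proof. by apply/eqP; rewrite cards_eq0; apply/eqP/setP => p; rewrite !inE andbF. Qed.

Lemma inversions1l i A : inversions [set i] A = before i A.
Proof.
rewrite /inversions /before -[RHS](card_imset _ (f := pair i)); last by move=> ? ? [].
apply: eq_card => -[a b]; rewrite !inE /=; apply/idP/imsetP.
  by case/and3P=> /eqP -> bA ba; exists b; rewrite // inE bA.
by case=> c; rewrite inE => /andP[cA ci] [-> ->]; rewrite eqxx cA.
Qed.

Lemma gmul1l f : one ** f = f.
Proof.
rewrite (grassmannE f) gmul_sumr; apply: eq_bigr => A _.
rewrite gmulZr gmul_mono inversions0l -setI_eq0 set0I eqxx expr0 scale1r.
by rewrite set0U.
Qed.

Lemma gmul1r f : f ** one = f.
Proof.
rewrite (grassmannE f) gmul_suml; apply: eq_bigr => A _.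
rewrite gmulZl gmul_mono inversions0r -setI_eq0 setI0 eqxx expr0 scale1r.
by rewrite setU0.
Qed.

Lemma beforeU1 i j A : j \notin A -> before i (j |: A) = ((j < i) + before i A)%N.
Proof.
move=> jA; rewrite /before; have [ji|ji] := boolP (j < i)%N.
  rewrite -[RHS]/(1 + _)%N; have <- : (j \notin [set k in A | (k < i)%N]) = 1%N :> nat.
    by rewrite inE (negPf jA).
  rewrite -cardsU1; apply: eq_card => k; rewrite !inE.
  by have [->|] := eqVneq k j; rewrite ?ji.
apply: eq_card => k; rewrite !inE.
by have [->|] := eqVneq k j; rewrite ?(negPf ji) ?andbF.
Qed.

Lemma beforeD1 i j A : j \in A -> before i A = ((j < i) + before i (A :\ j))%N.
Proof. by move=> jA; rewrite -beforeU1 ?setD11 // setD1K. Qed.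

Lemma beforeU1id i A : before i (i |: A) = before i A.
Proof.
by apply: eq_card => k; rewrite !inE; have [->|] := eqVneq k i; rewrite ?ltnn ?andbF.
Qed.

Lemma beforeD1id i A : before i (A :\ i) = before i A.
Proof.
by apply: eq_card => k; rewrite !inE; have [->|] := eqVneq k i; rewrite ?ltnn ?andbF.
Qed.

Lemma gen_mul_mono i A :
  x i ** mono F A = if i \in A then 0 else (-1) ^+ before i A *: mono F (i |: A).
Proof.
rewrite gmul_mono inversions1l -setI_eq0 setI_eq0 disjoints1.
by case: (i \in A).
Qed.

Lemma gen_mulE i f C :
  (x i ** f) C = if i \in C then (-1) ^+ before i C * f (C :\ i) else 0.
Proof.
have -> : (x i ** f) C = \sum_A f A * (x i ** mono F A) C.
  rewrite {1}(grassmannE f) gmul_sumr sum_ffunE.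
  by apply: eq_bigr => A _; rewrite gmulZr ffunE.
have zero A : C != i |: A -> f A * (x i ** mono F A) C = 0.
  move=> nC; rewrite gen_mul_mono; case: ifP => _; rewrite !ffunE ?mulr0 //.
  by rewrite (negPf nC) scaler0 mulr0.
case: ifP => iC; last first.
  rewrite big1 // => A _; apply: zero; apply: contraFneq iC => ->.
  exact: setU11.
rewrite (bigD1 (C :\ i)) //= big1 ?addr0 => [|A nA].
  rewrite gen_mul_mono setD11 setD1K // beforeD1id !ffunE eqxx.
  by rewrite /GRing.scale /= mulr1 mulrC.
have [EC|/zero//] := eqVneq C (i |: A).
rewrite gen_mul_mono; case: ifP => iA; first by rewrite ffunE mulr0.
by rewrite EC setU1K ?iA ?eqxx in nA.
Qed.

Lemma gderE i f C :
  gder i f C = if i \in C then 0 else (-1) ^+ before i C * f (i |: C).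
Proof. by rewrite ffunE. Qed.

Lemma gder_mono i A :
  gder i (mono F A) = if i \in A then (-1) ^+ before i A *: mono F (A :\ i) else 0.
Proof.
apply/ffunP => C; rewrite gderE; case: ifP => iC.
  case: ifP => iA; rewrite !ffunE //.
  case: eqP => [E|_]; last by rewrite scaler0.
  by rewrite E setD11 in iC.
case: ifP => iA; rewrite !ffunE; last first.
  by case: eqP => [E|_]; rewrite ?mulr0 //; rewrite -E setU11 in iA.
have [E|nE] := eqVneq C (A :\ i).
  by rewrite E setD1K // eqxx beforeD1id.
case: eqP => [E|_]; last by rewrite mulr0 scaler0.
by rewrite -E setU1K ?iC ?eqxx in nE.
Qed.

(** The canonical anticommutation relation between multiplication by [x j]
    and [gder i]: all later sign rules come from it by induction. *)
Lemma gder_gen_mul i j f :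
  gder i (x j ** f) = (i == j)%:R *: f - x j ** gder i f.
Proof.
apply/ffunP => C; rewrite gderE !gcoefE !gen_mulE gderE.
have [<-{j}|ij] := eqVneq i j.
  case: ifP => iC; rewrite ?setD11 ?setU11.
    rewrite mul1r setD1K // beforeD1id mulrA -expr2 sqrr_sign mul1r.
    by rewrite subrr.
  by rewrite beforeU1id setU1K ?iC // mulrA -expr2 sqrr_sign !mul1r subr0.
rewrite mul0r !inE (negPf ij) eq_sym (negPf ij) /= sub0r.
case: (boolP (i \in C)) => iC; first by case: ifP; rewrite ?mulr0 oppr0.
case: (boolP (j \in C)) => jC; last by rewrite mulr0 oppr0.
have iCj : i \notin C :\ j by rewrite !inE (negPf iC) andbF.
have -> : i |: C :\ j = (i |: C) :\ j.
  apply/setP => k; rewrite !inE; have [->|//] := eqVneq k i.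
  by rewrite (negPf ij).
rewrite beforeU1 // (beforeD1 i jC) !exprD.
have [ltij|ltji|E] := ltngtP (nat_of_ord i) j; last by rewrite (ord_inj E) eqxx in ij.
- by rewrite expr0 expr1; ring.
- by rewrite expr0 expr1; ring.
Qed.

Lemma gen_mul_sq i f : x i ** (x i ** f) = 0.
Proof.
apply/ffunP => C; rewrite !gen_mulE gcoef0.
by case: ifP; rewrite ?setD11 ?mulr0.
Qed.

Lemma gen_mul_anti i j f : x i ** (x j ** f) = - (x j ** (x i ** f)).
Proof.
have [->|ij] := eqVneq i j; first by rewrite gen_mul_sq oppr0.
apply/ffunP => C; rewrite !(gcoefE, gen_mulE) !inE ij (eq_sym j) ij /=.
case: (boolP (i \in C)) => iC; last by case: ifP; rewrite ?mulr0 oppr0.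
case: (boolP (j \in C)) => jC; last by rewrite mulr0 oppr0.
have -> : C :\ j :\ i = C :\ i :\ j by rewrite setDDl setUC -setDDl.
rewrite (beforeD1 i jC) (beforeD1 j iC) !exprD.
have [ltij|ltji|E] := ltngtP (nat_of_ord i) j; last by rewrite (ord_inj E) eqxx in ij.
- by rewrite expr0 expr1; ring.
- by rewrite expr0 expr1; ring.
Qed.

Lemma gder_anti i j f : gder i (gder j f) = - gder j (gder i f).
Proof.
apply/ffunP => C; rewrite !(gcoefE, gderE) !inE.
have [->|ij] := eqVneq i j.
  by rewrite /= mulr0 if_same oppr0.
rewrite /=.
case: (boolP (i \in C)) => iC; first by case: ifP; rewrite ?mulr0 oppr0.
case: (boolP (j \in C)) => jC; first by rewrite mulr0 oppr0.
have -> : j |: (i |: C) = i |: (j |: C) by rewrite setUCA.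
rewrite -!/(before _ _) !beforeU1 // !exprD.
have [ltij|ltji|E] := ltngtP (nat_of_ord i) j; last by rewrite (ord_inj E) eqxx in ij.
- by rewrite expr0 expr1; ring.
- by rewrite expr0 expr1; ring.
Qed.

(** Splitting off the smallest generator, so that no sign appears. *)
Lemma mono_min_ind (P : {set 'I_n} -> Prop) :
  P set0 ->
  (forall i A, before i A = 0%N -> i \notin A -> P A -> P (i |: A)) ->
  forall A, P A.
Proof.
move=> P0 PU A; have [m] := ubnP #|A|; elim: m => // m IHm in A *.
have [->//|/set0Pn[i0 i0A]] := eqVneq A set0 => cA.
case: (arg_minnP (fun i : 'I_n => nat_of_ord i) i0A) => i iA imin.
rewrite -(setD1K iA); apply: PU; rewrite ?setD11 //.
  apply/eqP; rewrite cards_eq0; apply/eqP/setP => k; rewrite !inE.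
  case: (boolP (k \in A)) => [/imin|]; last by rewrite andbF.
  by rewrite leqNgt => /negPf ->; rewrite andbF.
by apply: IHm; rewrite (cardsD1 i) (iA : i \in A) in cA.
Qed.

Lemma mono_min i A : before i A = 0%N -> i \notin A ->
  mono F (i |: A) = x i ** mono F A.
Proof. by move=> b0 iA; rewrite gen_mul_mono (negPf iA) b0 expr0 scale1r. Qed.

(** Grassmann induction: a linear map is known from its value on [one] and its
    behaviour under left multiplication by the generators. *)
Lemma gen_ext (V : lmodType F) (u v : {linear L -> V}) :
  u one = v one ->
  (forall i f, u f = v f -> u (x i ** f) = v (x i ** f)) -> u =1 v.
Proof.
move=> uv1 uvM; apply: linear_ext; apply: mono_min_ind => // i A b0 iA uvA.
by rewrite mono_min //; apply: uvM.
Qed.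

End GrassmannGenerators.

(** * Parity, the Leibniz rule and supercommutativity *)

Section Parity.
Variables (F : fieldType) (n : nat).
Implicit Types (A B C : {set 'I_n}) (f g h : grassmann F n) (i j : 'I_n).
Implicit Types (a b c : bool).
Local Notation L := (grassmann F n).
Local Notation x := (gen F).
Local Notation one := (gone F n).

Lemma gen_ind (P : L -> Prop) :
  P one -> (forall u f g, P f -> P g -> P (u *: f + g)) ->
  (forall i f, P f -> P (x i ** f)) -> forall f, P f.
Proof.
move=> P1 PD PM f.
have P0 : P 0 by rewrite -(addNr one) -scaleN1r; apply: PD.
rewrite (grassmannE f); elim/big_rec: _ => // A g _ Pg; apply: (PD) => //.
by elim/mono_min_ind: A => // i A b0 iA PA; rewrite mono_min //; apply: PM.
Qed.

Fact gtwist_is_linear : linear (@gtwist F n).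
Proof.
move=> a f g; apply/ffunP => B; rewrite ffunE !gcoefE !(ffunE (fun _ => _ * _)).
by rewrite mulrDr mulrCA.
Qed.
HB.instance Definition _ :=
  GRing.isLinear.Build F L L _ (@gtwist F n) gtwist_is_linear.

Lemma gtwist_mono A : gtwist (mono F A) = (-1) ^+ #|A| *: mono F A.
Proof.
apply/ffunP => B; rewrite !gcoefE !ffunE.
by have [->//|_] := eqVneq B A; rewrite !mulr0.
Qed.

Lemma gtwist1 : gtwist one = one.
Proof. by rewrite gtwist_mono cards0 expr0 scale1r. Qed.

Lemma gtwist_gen_mul i f : gtwist (x i ** f) = - (x i ** gtwist f).
Proof.
apply/ffunP => C; rewrite gcoefE gen_mulE ffunE gen_mulE.
case: ifP => iC; last by rewrite mulr0 oppr0.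
by rewrite ffunE (cardsD1 i) iC exprD expr1; ring.
Qed.

(** The Leibniz rule, with the sign carried by [gtwist] so that it holds for
    inhomogeneous [f]. *)
Lemma gder_gmul i f g :
  gder i (f ** g) = gder i f ** g + gtwist f ** gder i g.
Proof.
elim/gen_ind: f => [|a f h IHf IHh|j f IHf].
- by rewrite gtwist1 !gmul1l gder_mono inE gmul0l add0r.
- by rewrite gmulDl gmulZl !linearP /= IHf IHh !gmulDl !gmulZl
       scalerDr addrACA.
rewrite -gmulA !gder_gen_mul IHf gtwist_gen_mul gmulDr gmulDl gmulNl gmulNl.
by rewrite gmulZl opprD !gmulA addrA.
Qed.

Lemma gmul_gen f i : f ** x i = x i ** gtwist f.
Proof.
elim/gen_ind: f => [|a f h IHf IHh|j f IHf].
- by rewrite gtwist1 gmul1l gmul1r.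
- by rewrite gmulDl gmulZl !linearP /= IHf IHh.
by rewrite -gmulA IHf gtwist_gen_mul gmulNr gen_mul_anti.
Qed.

Definition gpar b f := forall A, odd #|A| != b -> f A = 0.

Lemma gpar_mono A : gpar (odd #|A|) (mono F A).
Proof. by move=> B nB; rewrite ffunE; case: (B =P A) nB => // ->; rewrite eqxx. Qed.

Lemma gtwist_gpar b f : gpar b f -> gtwist f = (-1) ^+ b *: f.
Proof.
move=> fb; apply/ffunP => A; rewrite gcoefE ffunE -signr_odd.
by have [->//|/fb ->] := eqVneq (odd #|A|) b; rewrite !mulr0.
Qed.

Lemma gprojP b f : gpar b f <-> gproj b f = f.
Proof.
split=> [fb|<- A /negPf nA]; last by rewrite ffunE nA.
by apply/ffunP => A; rewrite ffunE; case: eqP => // /eqP /fb ->.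
Qed.

Lemma gproj_gproj b c f : gproj b (gproj c f) = if b == c then gproj c f else 0.
Proof.
apply/ffunP => A; rewrite (fun_if (fun u : L => u A)) !ffunE.
by case: b c (odd _) => -[] -[].
Qed.

Lemma gprojD f : f = gproj true f + gproj false f.
Proof.
apply/ffunP => A; rewrite !ffunE.
by case: (odd _); rewrite /= ?addr0 ?add0r.
Qed.

Lemma gproj_gder c i f : gproj c (gder i f) = gder i (gproj (~~ c) f).
Proof.
apply/ffunP => A; rewrite !ffunE; case: (boolP (i \in A)) => iA; first by rewrite if_same.
rewrite cardsU1 iA /=.
by case: (odd _) c => -[]; rewrite ?mulr0.
Qed.

Lemma gproj_gmul a c f g : gpar a f -> gproj c (f ** g) = f ** gproj (c (+) a) g.
Proof.
move=> fa; apply/ffunP => C; rewrite !ffunE.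
have -> (b : bool) (u : F) : (if b then u else 0) = b%:R * u.
  by case: b; rewrite ?mul1r ?mul0r.
rewrite mulr_sumr; apply: eq_bigr => A sAC.
have [EA|/fa ->] := eqVneq (odd #|A|) a; last by rewrite !(mulr0, mul0r).
rewrite ffunE -[#|C|](cardsID A C) (setIidPr sAC) oddD EA.
by case: a {fa EA} (odd _) c => -[] -[] /=; rewrite ?(mul1r, mul0r, mulr0).
Qed.

Lemma gpar_gder b i f : gpar b f -> gpar (~~ b) (gder i f).
Proof. by move=> /gprojP fb; apply/gprojP; rewrite gproj_gder negbK fb. Qed.

Lemma gparZ b u f : gpar b f -> gpar b (u *: f).
Proof. by move=> /gprojP fb; apply/gprojP; rewrite linearZ /= fb. Qed.

Lemma gmul_mono_gpar a f A : gpar a f ->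
  f ** mono F A = (-1) ^+ (a && odd #|A|) *: (mono F A ** f).
Proof.
move=> fa; elim/mono_min_ind: A => [|i A b0 iA IHA].
  by rewrite cards0 andbF gmul1r gmul1l scale1r.
rewrite mono_min // gmulA gmul_gen (gtwist_gpar fa) gmulZr gmulZl -gmulA IHA.
rewrite gmulZr scalerA gmulA cardsU1 iA /= -signr_addb; congr (_ ^+ _ *: _).
by case: (a) (odd _) => -[].
Qed.

(** Supercommutativity, by moving one generator at a time across [f]. *)
Lemma gmulC_gpar a b f g : gpar a f -> gpar b g ->
  f ** g = (-1) ^+ (a && b) *: (g ** f).
Proof.
move=> fa gb; rewrite (grassmannE g) gmul_sumr gmul_suml scaler_sumr.
apply: eq_bigr => A _; rewrite gmulZr gmulZl (gmul_mono_gpar _ fa).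
have [->|/gb ->] := eqVneq (odd #|A|) b; last by rewrite !scale0r scaler0.
by rewrite !scalerA mulrC.
Qed.

(** ** Homogeneous operators *)

Local Notation gl := 'End(L).
Implicit Types X Y : gl.

(** For homogeneous operators the sums over parities that define the super
    bracket reduce to one term, the usual supercommutator. *)
Definition opar a X := forall c f, gproj c (X f) = X (gproj (c (+) a) f).

Lemma epart_opar a X b : opar a X -> epart b X = if b == a then X else 0.
Proof.
move=> Xa; apply/lfunP => f; rewrite /epart sum_lfunE big_bool /= !comp_lfunE !lfunE /=.
rewrite !Xa !gproj_gproj.
have [->|nab] := eqVneq b a.
  by rewrite addNb addbb /= -linearD -gprojD.
by case: a b nab {Xa} => -[] //= _; rewrite !linear0 addr0 zero_lfunE.
Qed.

Lemma sbracket_opar a b X Y : opar a X -> opar b Y ->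
  sbracket X Y = (X \o Y)%VF - (-1) ^+ (a && b) *: (Y \o X)%VF.
Proof.
move=> Xa Yb; rewrite /sbracket !big_bool /= !(epart_opar _ Xa) !(epart_opar _ Yb).
by case: a b {Xa Yb} => -[] /=; rewrite ?comp_lfun0l ?comp_lfun0r ?scaler0 ?subr0 ?addr0 ?add0r.
Qed.

End Parity.

(** * Brackets of vector fields and Hamiltonian fields *)

Lemma commutator_lfunE (F : fieldType) (V : vectType F) (X Y : 'End(V)) u h :
  ((X \o Y)%VF - u *: (Y \o X)%VF) h = X (Y h) - u *: Y (X h).
Proof. by rewrite add_lfunE opp_lfunE scale_lfunE !comp_lfunE. Qed.

Section VectorFields.
Variables (F : fieldType) (n : nat).
Implicit Types (f g h : grassmann F n) (i j : 'I_n) (a b : bool).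

Lemma vfieldE f i g : vfield f i g = f ** gder i g.
Proof. by rewrite /vfield comp_lfunE !lfunE. Qed.

Lemma vfield_gen f i j : vfield f i (gen F j) = (j == i)%:R *: f.
Proof.
rewrite vfieldE gder_mono inE eq_sym; case: eqP => [->|_].
  rewrite /before setDv scale1r; have -> : [set j0 in [set i] | (j0 < i)%N] = set0.
    by apply/setP => k; rewrite !inE; case: eqP => // ->; rewrite ltnn.
  by rewrite cards0 expr0 scale1r gmul1r.
by rewrite gmul0r scale0r.
Qed.

Fact vfield_is_linear i : linear (fun f => vfield f i).
Proof.
move=> a f g; apply/lfunP => h.
by rewrite add_lfunE scale_lfunE !vfieldE gmulDl gmulZl.
Qed.

Lemma vfieldD f g i : vfield (f + g) i = vfield f i + vfield g i.
Proof. by have := vfield_is_linear i 1 f g; rewrite !scale1r. Qed.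

Lemma vfield0 i : vfield (0 : grassmann F n) i = 0.
Proof. by apply/lfunP => h; rewrite vfieldE gmul0l zero_lfunE. Qed.

Lemma vfieldZ u f i : vfield (u *: f) i = u *: vfield f i.
Proof. by have := vfield_is_linear i u f 0; rewrite vfield0 !addr0. Qed.

Lemma vfield_sum I r (P : pred I) (G : I -> grassmann F n) i :
  vfield (\sum_(k <- r | P k) G k) i = \sum_(k <- r | P k) vfield (G k) i.
Proof.
by apply: (big_ind2 (fun u v => vfield u i = v)) => [|? ? ? ? <- <-|//];
   rewrite ?vfield0 ?vfieldD.
Qed.

Lemma opar_vfield b f i : gpar b f -> opar (~~ b) (vfield f i).
Proof.
move=> fb c g; rewrite !vfieldE (gproj_gmul _ _ fb) gproj_gder.
by rewrite addbN.
Qed.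

(** The second order terms of the two composites cancel because partial
    derivatives anticommute. *)
Lemma sbracket_vfield a b f g i j : gpar a f -> gpar b g ->
  sbracket (vfield f i) (vfield g j) =
    vfield (f ** gder i g) j
      - (-1) ^+ (~~ a && ~~ b) *: vfield (g ** gder j f) i.
Proof.
move=> fa gb; rewrite (sbracket_opar (opar_vfield i fa) (opar_vfield j gb)).
apply/lfunP => h; rewrite !(vfieldE, add_lfunE, opp_lfunE, scale_lfunE, comp_lfunE).
rewrite !gder_gmul (gtwist_gpar fa) (gtwist_gpar gb) !gmulDr !gmulZl !gmulZr !gmulA.
rewrite (gmulC_gpar fa gb) (gder_anti j i) gmulNr !gmulZl !scalerN scalerA.
rewrite scalerBr scalerA opprB addrA; congr (_ - _).
rewrite -addrA -scalerDl [X in X *: _](_ : _ = 0) ?scale0r ?addr0 //.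
by case: (a) (b) => -[] /=; ring.
Qed.

End VectorFields.

Section HamiltonianFields.
Variables (F : fieldType) (m : nat).
Local Notation L := (grassmann F (m + m)).
Local Notation x := (gen F).
Implicit Types (f g h : L) (i j k : 'I_(m + m)) (a b : bool).

(** This involution exchanges each xi with its eta; it turns the Poisson bracket
    into a single sum over all the generators. *)
Definition dual i : 'I_(m + m) :=
  match split i with inl k => rshift m k | inr k => lshift m k end.

Lemma dual_lshift (k : 'I_m) : dual (lshift m k) = rshift m k.
Proof. by rewrite /dual (unsplitK (inl k)). Qed.

Lemma dual_rshift (k : 'I_m) : dual (rshift m k) = lshift m k.
Proof. by rewrite /dual (unsplitK (inr k)). Qed.

Lemma dualK : involutive dual.
Proof.
move=> i; rewrite -(splitK i); case: (split i) => k /=.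
  by rewrite dual_lshift dual_rshift.
by rewrite dual_rshift dual_lshift.
Qed.

Lemma poissonE f g :
  poisson f g = \sum_i gder i (gtwist f) ** gder (dual i) g.
Proof.
rewrite big_split_ord /= -big_split; apply: eq_bigr => k _.
by rewrite dual_lshift dual_rshift.
Qed.

Lemma hfieldE f g : hfield f g = poisson f g.
Proof.
rewrite /hfield sum_lfunE; apply: eq_bigr => k _.
by rewrite add_lfunE !vfieldE.
Qed.

Fact hfield_is_linear : linear (@hfield F m).
Proof.
move=> a f g; apply/lfunP => h; rewrite add_lfunE scale_lfunE !hfieldE !poissonE.
rewrite scaler_sumr -big_split; apply: eq_bigr => k _ /=.
by rewrite !linearP /= gmulDl gmulZl.
Qed.

Lemma hfield0 : hfield (0 : L) = 0.
Proof.
by have := hfield_is_linear (-1) (0 : L) 0; rewrite scaler0 addr0 scaleN1r addNr.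
Qed.

Lemma hfieldZ u (f : L) : hfield (u *: f) = u *: hfield f.
Proof. by have := hfield_is_linear u f 0; rewrite hfield0 !addr0. Qed.

Lemma hfield_sum I r (P : pred I) (G : I -> L) :
  hfield (\sum_(k <- r | P k) G k) = \sum_(k <- r | P k) hfield (G k).
Proof.
apply: (big_ind2 (fun u v => hfield u = v)) => [|u1 v1 u2 v2 <- <-|//].
  exact: hfield0.
by have := hfield_is_linear 1 u1 u2; rewrite !scale1r.
Qed.

Lemma hfield_gen f i : hfield f (x i) = gder (dual i) (gtwist f).
Proof.
rewrite hfieldE poissonE (bigD1 (dual i)) //= big1 => [|k ki].
  by rewrite addr0 dualK -[LHS]vfieldE vfield_gen eqxx scale1r.
rewrite -[LHS]vfieldE vfield_gen; case: eqP => [E|_]; last by rewrite scale0r.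
by rewrite E dualK eqxx in ki.
Qed.

Lemma hfield1 f : hfield f (gone F _) = 0.
Proof.
rewrite hfieldE poissonE big1 // => k _.
by rewrite gder_mono inE gmul0r.
Qed.

Lemma hfield_gone : hfield (gone F (m + m)) = 0.
Proof.
apply/lfunP => g; rewrite hfieldE poissonE zero_lfunE big1 // => i _.
by rewrite gtwist1 gder_mono inE gmul0l.
Qed.

Lemma opar_hfield a f : gpar a f -> opar a (hfield f).
Proof.
move=> fa c g; rewrite !hfieldE !poissonE linear_sum; apply: eq_bigr => k _ /=.
rewrite (gtwist_gpar fa) linearZ /= !gmulZl linearZ /=; congr (_ *: _).
by rewrite (gproj_gmul _ _ (gpar_gder _ fa)) gproj_gder addbN negbK.
Qed.

Lemma gpar_gen i : gpar true (x i).
Proof. by have := @gpar_mono F (m + m) [set i]; rewrite cards1. Qed.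

Lemma hfield_gmul a c f g h : gpar a f -> gpar c g ->
  hfield f (g ** h) = hfield f g ** h + (-1) ^+ (a && c) *: (g ** hfield f h).
Proof.
move=> fa gc; rewrite !hfieldE !poissonE gmul_sumr gmul_suml scaler_sumr.
rewrite -big_split; apply: eq_bigr => k _ /=.
rewrite gder_gmul gmulDr !gmulA; congr (_ + _).
have tfa : gpar a (gtwist f) by rewrite (gtwist_gpar fa); apply: gparZ.
rewrite (gtwist_gpar gc) gmulZr gmulZl (gmulC_gpar (gpar_gder _ tfa) gc).
rewrite gmulZl scalerA; congr (_ *: _).
by case: (a) (c) => -[] /=; ring.
Qed.

(** The correction to commuting [gder j] with the field of [f] involves second
    derivatives of [f]; these supply the terms of the Jacobi identity. *)
Lemma gder_hfield a f g j : gpar a f ->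
  gder j (hfield f g) =
    (-1) ^+ a *: (hfield f (gder j g)
                    + \sum_k gder j (gder k f) ** gder (dual k) g).
Proof.
move=> fa; rewrite !hfieldE !poissonE linear_sum -big_split scaler_sumr.
apply: eq_bigr => k _ /=; rewrite gder_gmul addrC scalerDr; congr (_ + _).
  by rewrite (gtwist_gpar fa) !linearZ /= ?gmulZl.
rewrite (gtwist_gpar fa) linearZ /= linearZ /= (gtwist_gpar (gpar_gder k fa)).
rewrite gder_anti gmulNr !gmulZl !scalerA -scaleNr; congr (_ *: _).
by case: (a); rewrite /=; ring.
Qed.

Lemma gpar_hfield a b f g : gpar a f -> gpar b g -> gpar (a (+) b) (hfield f g).
Proof.
move=> fa /gprojP gb; apply/gprojP.
by rewrite (opar_hfield fa) addbAC addbb gb.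
Qed.

(** Both sides are superderivations, so it suffices to compare them on the
    generators, where they involve only derivatives of [f] and [g]. *)
Lemma sbracket_hfield a b f g : gpar a f -> gpar b g ->
  sbracket (hfield f) (hfield g) = hfield (poisson f g).
Proof.
move=> fa gb; rewrite (sbracket_opar (opar_hfield fa) (opar_hfield gb)) -hfieldE.
apply/lfunP => h; elim/gen_ind: h => [|u h1 h2 IH1 IH2|i h IH].
- by rewrite commutator_lfunE !hfield1 !linear0 addr0.
- by rewrite linearP [RHS]linearP /= IH1 IH2.
have fgab := gpar_hfield fa gb.
have on_gen : hfield (hfield f g) (x i) =
    hfield f (hfield g (x i)) - (-1) ^+ (a && b) *: hfield g (hfield f (x i)).
  rewrite !hfield_gen (gtwist_gpar fgab) (gtwist_gpar fa) (gtwist_gpar gb).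
  set j := dual i; rewrite !linearZ /= (gder_hfield g j fa) scalerA.
  rewrite scalerA -signr_addb addbAC addbb scalerDr scalerN; congr (_ + _).
  rewrite hfieldE poissonE (reindex_inj (inv_inj dualK)) /=.
  rewrite !scaler_sumr -sumrN; apply: eq_bigr => k _.
  rewrite dualK (gtwist_gpar gb) [gder k (_ *: g)]linearZ /= gmulZl.
  rewrite (gmulC_gpar (gpar_gder _ gb) (gpar_gder _ (gpar_gder _ fa))).
  rewrite gder_anti gmulNl scalerN !scalerA -!scaleNr; congr (_ *: _).
  by case: (a) (b) => -[] /=; ring.
rewrite !commutator_lfunE in IH *.
rewrite (hfield_gmul _ fgab (gpar_gen i)) on_gen -IH.
rewrite (hfield_gmul h gb (gpar_gen i)) (hfield_gmul h fa (gpar_gen i)).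
have linDZ (X : 'End(L)) u v w : X (u + w *: v) = X u + w *: X v.
  by rewrite linearD linearZ.
rewrite !linDZ.
rewrite (hfield_gmul h fa (gpar_hfield gb (gpar_gen i))).
rewrite (hfield_gmul h gb (gpar_hfield fa (gpar_gen i))).
rewrite (hfield_gmul _ fa (gpar_gen i)) (hfield_gmul _ gb (gpar_gen i)).
rewrite gmulDl gmulNl gmulZl gmulDr gmulNr gmulZr.
apply/ffunP => C; rewrite !gcoefE.
by case: (a) (b) => -[] /=; ring.
Qed.

End HamiltonianFields.

(** * Linear substitutions of the generators *)

Section Substitution.
Variables (F : fieldType) (n : nat).
Implicit Types (A B : {set 'I_n}) (f g : grassmann F n) (i j : 'I_n).
Implicit Types (M N : 'M[F]_n).
Local Notation L := (grassmann F n).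
Local Notation gl := 'End(L).
Implicit Types (phi psi : gl).
Local Notation x := (gen F).
Local Notation one := (gone F n).

Definition linform (c : 'I_n -> F) : L := \sum_j c j *: x j.

Lemma linform_mul c f : linform c ** f = \sum_j c j *: (x j ** f).
Proof. by rewrite gmul_suml; apply: eq_bigr => j _; rewrite gmulZl. Qed.

Lemma linform_gen_anti c j f : linform c ** (x j ** f) = - (x j ** (linform c ** f)).
Proof.
rewrite !linform_mul gmul_sumr -sumrN; apply: eq_bigr => k _.
by rewrite gen_mul_anti gmulZr scalerN.
Qed.

Lemma linform_anti c d f :
  linform c ** (linform d ** f) = - (linform d ** (linform c ** f)).
Proof.
rewrite (linform_mul d) (linform_mul d) gmul_sumr -sumrN.
by apply: eq_bigr => k _; rewrite gmulZr linform_gen_anti scalerN.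
Qed.

(** Adding one generator at a time keeps the argument valid in
    characteristic 2, where anticommutation alone would not give it. *)
Lemma linform_sq c f : linform c ** (linform c ** f) = 0.
Proof.
rewrite /linform; elim: (index_enum _) => [|j r IHr].
  by rewrite big_nil gmul0l.
rewrite big_cons; set u := \sum_(k <- r) _ in IHr *.
have ux : u ** (x j ** f) = - (x j ** (u ** f)).
  rewrite !gmul_suml gmul_sumr -sumrN; apply: eq_bigr => k _.
  by rewrite !gmulZl gmulZr gen_mul_anti scalerN.
rewrite !gmulDl !gmulDr IHr addr0 !gmulZl !gmulZr gen_mul_sq !scaler0 add0r.
by rewrite ux scalerN addrC addNr.
Qed.

(** An algebra endomorphism, described by its effect on products with a
    generator, which is what inductions on elements use. *)
Definition substitutes M phi :=
  phi one = one /\ forall i f, phi (x i ** f) = linform (M i) ** phi f.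

Lemma substitutes_gen M phi i : substitutes M phi -> phi (x i) = linform (M i).
Proof. by case=> phi1 phiM; rewrite -[x i]gmul1r phiM phi1 gmul1r. Qed.

Lemma substitutes_gmul M phi f g : substitutes M phi ->
  phi (f ** g) = phi f ** phi g.
Proof.
case=> phi1 phiM; elim/gen_ind: f => [|u f h IHf IHh|i f IHf].
- by rewrite phi1 !gmul1l.
- by rewrite gmulDl gmulZl !linearP /= IHf IHh gmulDl gmulZl.
by rewrite -gmulA !phiM IHf gmulA.
Qed.

Lemma substitutesP phi :
  linear_change phi <-> exists2 M, M \in unitmx & substitutes M phi.
Proof.
split=> [[phi1 phiM [M uM phix]]|[M uM phiP]].
  by exists M => //; split=> // i f; rewrite phiM phix.
split; first by case: phiP.
  by move=> f g; apply: substitutes_gmul phiP.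
by exists M => // i; rewrite (substitutes_gen _ phiP).
Qed.

Lemma substitutes_comp M N phi psi :
  substitutes M phi -> substitutes N psi -> substitutes (M *m N) (psi \o phi)%VF.
Proof.
move=> phiP psiP; case: (phiP) (psiP) => phi1 phiM [psi1 psiM].
split=> [|i f]; first by rewrite comp_lfunE phi1 psi1.
rewrite !comp_lfunE phiM linform_mul linear_sum /= linform_mul.
under [LHS]eq_bigr => j _ do
  rewrite linearZ /= psiM linform_mul scaler_sumr.
rewrite exchange_big; apply: eq_bigr => k _ /=.
rewrite mxE scaler_suml; apply: eq_bigr => j _.
by rewrite scalerA.
Qed.

Lemma substitutes_id : substitutes 1%:M \1%VF.
Proof.
split=> [|i f]; first by rewrite id_lfunE.
rewrite !id_lfunE linform_mul (bigD1 i) //= big1 => [|j ji].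
  by rewrite mxE eqxx scale1r addr0.
by rewrite mxE eq_sym (negPf ji) scale0r.
Qed.

Lemma substitutes_inj M phi psi : substitutes M phi -> substitutes M psi -> phi = psi.
Proof.
move=> [phi1 phiM] [psi1 psiM]; apply/lfunP.
by apply: gen_ext => [|i f] /=; [rewrite phi1 psi1 | rewrite phiM psiM => ->].
Qed.

(** The image of the monomial with index set [A] is the ordered product of the
    images of its generators; moving a further factor to its place produces the
    same sign as for the generators themselves. *)
Definition ordered_product M A (s : seq 'I_n) : L :=
  foldr (fun i g => if i \in A then linform (M i) ** g else g) one s.

Lemma eq_ordered_product M A B s : {in s, A =i B} ->
  ordered_product M A s = ordered_product M B s.
Proof.
elim: s => //= k s IHs AB; rewrite AB ?mem_head //.
by rewrite IHs // => i si; apply: AB; rewrite inE si orbT.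
Qed.

Lemma linform_ordered_product M A s i :
  path.sorted ltn (map val s) -> i \in s ->
  linform (M i) ** ordered_product M A s =
    if i \in A then 0 else
    (-1) ^+ count (fun j => (j \in A) && (j < i)%N) s *: ordered_product M (i |: A) s.
Proof.
elim: s => //= k s IHs; rewrite (path_sortedE ltn_trans) => /andP[/allP ks srt].
have ltks j : j \in s -> (k < j)%N by move=> js; apply: ks; apply: map_f.
have skN : k \notin s by apply/negP => /ltks; rewrite ltnn.
rewrite inE; have [-> _|ik /= si] := eqVneq i k.
  case: (boolP (k \in A)) => kA; first by rewrite linform_sq.
  rewrite setU11 ltnn add0n (_ : count _ _ = 0%N) ?expr0 ?scale1r; last first.
    apply/eqP; rewrite -leqn0 leqNgt -has_count; apply/hasPn => j /ltks kj.
    by rewrite negb_and -leqNgt (ltnW kj) orbT.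
  congr (_ ** _); apply: eq_ordered_product => j js; rewrite !inE.
  by case: eqP => // jk; rewrite -jk js in skN.
rewrite in_setU1 eq_sym (negPf ik) /= (ltks _ si) andbT.
case: (boolP (k \in A)) => kA; last by rewrite add0n; apply: IHs.
rewrite linform_anti (IHs srt si); case: ifP => _; first by rewrite gmul0r oppr0.
by rewrite gmulZr exprS mulN1r scaleNr.
Qed.

(** The universal property of the Grassmann algebra: generators may be sent to
    arbitrary linear forms, because these square to zero and anticommute. *)
Lemma substitutes_exists M : exists phi, substitutes M phi.
Proof.
pose P A := ordered_product M A (enum 'I_n).
have lin : linear (fun f : L => \sum_A f A *: P A).
  move=> u f g; rewrite scaler_sumr -big_split; apply: eq_bigr => A _ /=.
  by rewrite !gcoefE scalerDl scalerA.
pose phi0 := GRing.isLinear.Build F L L _ _ lin.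
pose phi1 : {linear L -> L} := HB.pack (fun f : L => \sum_A f A *: P A) phi0.
have phiE A : linfun phi1 (mono F A) = P A.
  rewrite lfunE /= (bigD1 A) //= big1 => [|B nB].
    by rewrite ffunE eqxx scale1r addr0.
  by rewrite ffunE (negPf nB) scale0r.
exists (linfun phi1); split=> [|i f].
  rewrite phiE /P; elim: (enum _) => //= k s ->.
  by rewrite inE.
rewrite (grassmannE f) gmul_sumr !linear_sum; apply: eq_bigr => A _ /=.
rewrite gmulZr !linearZ /=; congr (_ *: _); rewrite phiE /P.
rewrite linform_ordered_product ?mem_enum //; last first.
  by rewrite val_enum_ord iota_ltn_sorted.
rewrite gen_mul_mono; case: ifP => iA; first by rewrite linear0.
rewrite linearZ /= phiE; congr (_ ^+ _ *: _).
by rewrite -size_filter /before cardE /enum_mem filter_predT; congr size; apply: eq_filter => j; rewrite /= inE.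
Qed.

Lemma linear_change_inv phi : linear_change phi ->
  exists psi, [/\ linear_change psi, (phi \o psi = \1)%VF & (psi \o phi = \1)%VF].
Proof.
move=> /substitutesP[M uM phiP]; have [psi psiP] := substitutes_exists (invmx M).
exists psi; split.
- by apply/substitutesP; exists (invmx M); rewrite ?unitmx_inv.
- apply: substitutes_inj substitutes_id.
  by rewrite -(mulVmx uM); apply: substitutes_comp.
apply: substitutes_inj substitutes_id.
by rewrite -(mulmxV uM); apply: substitutes_comp.
Qed.

(** ** Substitutions preserve the grading *)

Definition homog (k : nat) f := forall A, #|A| != k -> f A = 0.

Lemma homog0 k : homog k 0. Proof. by move=> A _; rewrite gcoef0. Qed.

Lemma homogD k f g : homog k f -> homog k g -> homog k (f + g).
Proof. by move=> fk gk A nA; rewrite gcoefD fk // gk // addr0. Qed.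

Lemma homogZ k u f : homog k f -> homog k (u *: f).
Proof. by move=> fk A nA; rewrite gcoefZ fk // mulr0. Qed.

Lemma homog_sum k I r (P : pred I) (G : I -> L) :
  (forall l, P l -> homog k (G l)) -> homog k (\sum_(l <- r | P l) G l).
Proof.
by move=> Gk; apply: big_ind => //; [apply: homog0 | move=> u v; apply: homogD].
Qed.

Lemma homog_mono A : homog #|A| (mono F A).
Proof. by move=> B nB; rewrite ffunE; case: (B =P A) nB => // ->; rewrite eqxx. Qed.

Lemma homog_gen_mul k i f : homog k f -> homog k.+1 (x i ** f).
Proof.
move=> fk A nA; rewrite gen_mulE; case: ifP => // iA.
by rewrite fk ?mulr0 //; apply: contraNneq nA => <-; rewrite (cardsD1 i) iA.
Qed.

Lemma homog_gpar k f : homog k f -> gpar (odd k) f.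
Proof. by move=> fk A nA; apply: fk; apply: contraNneq nA => ->. Qed.

Lemma homogE k f : homog k f -> f = \sum_(A : {set 'I_n} | #|A| == k) f A *: mono F A.
Proof.
move=> fk; rewrite {1}(grassmannE f) (bigID (fun A : {set _} => #|A| == k)) /=.
by rewrite [X in _ + X]big1 ?addr0 // => A /fk ->; rewrite scale0r.
Qed.

Lemma substitutes_homog M phi k f : substitutes M phi -> homog k f -> homog k (phi f).
Proof.
case=> phi1 phiM /homogE ->; rewrite linear_sum; apply: homog_sum => A /eqP <-.
rewrite linearZ /=; apply: homogZ; elim/mono_min_ind: A => [|i A b0 iA IHA].
  by rewrite phi1; apply: homog_mono.
rewrite mono_min // phiM cardsU1 iA linform_mul; apply: homog_sum => j _.
by apply: homogZ; apply: homog_gen_mul.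
Qed.

(** A substitution respects the degree, hence the parity. *)
Lemma substitutes_gproj M phi b f : substitutes M phi ->
  gproj b (phi f) = phi (gproj b f).
Proof.
move=> phiP; rewrite (grassmannE f) !linear_sum; apply: eq_bigr => A _ /=.
rewrite !linearZ /=; congr (_ *: _).
have /gprojP m_odd := homog_gpar (@homog_mono A).
have /gprojP phim_odd := homog_gpar (substitutes_homog phiP (@homog_mono A)).
rewrite -phim_odd -[in RHS]m_odd !gproj_gproj m_odd phim_odd.
by case: ifP => _; rewrite ?linear0.
Qed.

Lemma substitutes_gtwist M phi f : substitutes M phi ->
  gtwist (phi f) = phi (gtwist f).
Proof.
case=> phi1 phiM; elim/gen_ind: f => [|u f g IHf IHg|i f IHf].
- by rewrite phi1 gtwist1 phi1.
- by rewrite !linearP /= IHf IHg.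
rewrite phiM gtwist_gen_mul linearN /= phiM linform_mul linear_sum /=.
rewrite -IHf linform_mul -sumrN; apply: eq_bigr => j _.
by rewrite linearZ /= gtwist_gen_mul scalerN.
Qed.

(** The chain rule, without sign because the images of the generators have
    scalar derivatives. *)
Lemma gder_substitutes M phi j f : substitutes M phi ->
  gder j (phi f) = \sum_i M i j *: phi (gder i f).
Proof.
case=> phi1 phiM; elim/gen_ind: f => [|u f g IHf IHg|k f IHf].
- rewrite phi1 gder_mono inE big1 // => i _.
  by rewrite gder_mono inE linear0 scaler0.
- rewrite !linearP /= IHf IHg scaler_sumr -big_split; apply: eq_bigr => i _ /=.
  by rewrite !linearP.
rewrite phiM linform_mul linear_sum /=.
have -> : \sum_i M i j *: phi (gder i (x k ** f)) =
    M k j *: phi f - linform (M k) ** gder j (phi f).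
  rewrite IHf gmul_sumr -sumrN (bigD1 k) //= [in RHS](bigD1 k) //= addrA.
  congr (_ + _); last apply: eq_bigr => i ik.
    by rewrite gder_gen_mul eqxx scale1r linearB /= phiM scalerBr gmulZr.
  by rewrite gder_gen_mul (negPf ik) scale0r sub0r linearN /= phiM scalerN gmulZr.
rewrite linform_mul -sumrN (bigD1 j) //= [in RHS](bigD1 j) //= addrA.
congr (_ + _); last apply: eq_bigr => i ij.
  by rewrite linearZ /= gder_gen_mul eqxx scale1r scalerBr.
by rewrite linearZ /= gder_gen_mul eq_sym (negPf ij) scale0r sub0r scalerN.
Qed.

End Substitution.

(** * Derived series and conjugation by a substitution *)

Section Conjugation.
Variables (F : fieldType) (n : nat).
Local Notation L := (grassmann F n).
Local Notation gl := 'End(L).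
Implicit Types (f : L) (X Y Z phi : gl) (s t g : {vspace gl}).
Implicit Types (gr : int -> {vspace gl}).

Lemma epart_is_linear b : linear (@epart F n b).
Proof.
move=> u X Y; rewrite /epart scaler_sumr -big_split; apply: eq_bigr => c _ /=.
by rewrite comp_lfunDr comp_lfunDl -comp_lfunZr -comp_lfunZl.
Qed.
HB.instance Definition _ b :=
  GRing.isLinear.Build F gl gl _ (@epart F n b) (epart_is_linear b).

Lemma epart_sum I r (P : pred I) (G : I -> gl) b :
  epart b (\sum_(k <- r | P k) G k) = \sum_(k <- r | P k) epart b (G k).
Proof. exact: (linear_sum (@epart F n b)). Qed.

Lemma epartZ b u X : epart b (u *: X) = u *: epart b X.
Proof. by rewrite [LHS]linearZ. Qed.

Lemma sbracket_is_linear X : linear (@sbracket F n X).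
Proof.
move=> u Y Z; rewrite /sbracket scaler_sumr -big_split; apply: eq_bigr => a _ /=.
rewrite scaler_sumr -big_split; apply: eq_bigr => b _ /=.
rewrite linearP /= comp_lfunDl comp_lfunDr -comp_lfunZl -comp_lfunZr.
by rewrite scalerDr opprD addrACA scalerBr !scalerA mulrC.
Qed.
HB.instance Definition _ X :=
  GRing.isLinear.Build F gl gl _ (@sbracket F n X) (sbracket_is_linear X).

Lemma sbracketPl u X Y Z :
  sbracket (u *: X + Y) Z = u *: sbracket X Z + sbracket Y Z.
Proof.
rewrite /sbracket scaler_sumr -big_split; apply: eq_bigr => a _ /=.
rewrite scaler_sumr -big_split; apply: eq_bigr => b _ /=.
rewrite linearP /= comp_lfunDl comp_lfunDr -comp_lfunZl -comp_lfunZr.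
by rewrite scalerDr opprD addrACA scalerBr !scalerA mulrC.
Qed.

Lemma sbracket0l Z : sbracket 0 Z = 0.
Proof.
by have := sbracketPl (-1) 0 0 Z; rewrite scaler0 addr0 scaleN1r addNr.
Qed.

Lemma sbracket_suml I r (P : pred I) (G : I -> gl) Z :
  sbracket (\sum_(k <- r | P k) G k) Z = \sum_(k <- r | P k) sbracket (G k) Z.
Proof.
apply: (big_ind2 (fun u v => sbracket u Z = v)) => [|u1 v1 u2 v2 <- <-|//].
  exact: sbracket0l.
by rewrite -[u1]scale1r sbracketPl !scale1r.
Qed.

Lemma sbracketZl u X Z : sbracket (u *: X) Z = u *: sbracket X Z.
Proof. by rewrite -[u *: X]addr0 sbracketPl sbracket0l addr0. Qed.

Lemma sbracket_sumr I r (P : pred I) (G : I -> gl) Z :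
  sbracket Z (\sum_(k <- r | P k) G k) = \sum_(k <- r | P k) sbracket Z (G k).
Proof. exact: (linear_sum (sbracket Z)). Qed.

Lemma sbracketZr u X Z : sbracket X (u *: Z) = u *: sbracket X Z.
Proof. by rewrite [LHS]linearZ. Qed.

Lemma mem_derived s X Y : X \in s -> Y \in s -> sbracket X Y \in derived s.
Proof.
move=> /coord_vbasis -> /coord_vbasis ->; rewrite sbracket_suml.
apply: memv_suml => i _; rewrite sbracketZl memvZ // sbracket_sumr.
apply: memv_suml => j _; rewrite sbracketZr memvZ //.
by apply/memv_span/allpairsP; exists ((vbasis s)`_i, (vbasis s)`_j); split=> //=;
   apply: mem_nth; rewrite size_tuple.
Qed.

Lemma derived_sub s t :
  (forall X Y, X \in s -> Y \in s -> sbracket X Y \in t) -> (derived s <= t)%VS.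
Proof.
move=> st; apply/span_subvP => Z /allpairsP[[X Y] [/= Xs Ys ->]].
by apply: st; apply: vbasis_mem.
Qed.

Lemma derivedS s t : (s <= t)%VS -> (derived s <= derived t)%VS.
Proof.
by move=> /subvP st; apply: derived_sub => X Y /st Xt /st Yt; apply: mem_derived.
Qed.

Lemma iter_derivedS k s t : (s <= t)%VS -> (iter k (@derived F n) s <= iter k (@derived F n) t)%VS.
Proof. by elim: k => //= k IHk /IHk; apply: derivedS. Qed.

(** The derived series decreases because [s] is closed under the bracket. This
    makes it a chain to which Lie's theorem applies. *)
Lemma iter_derived_decr k g s : subsuperalgebra g s ->
  (iter k.+1 (@derived F n) s <= iter k (@derived F n) s)%VS.
Proof. by case=> _ _ sbr; rewrite iterSr; apply: iter_derivedS; apply: derived_sub. Qed.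

Lemma gradedP gr s :
  graded gr s <-> s = (\sum_(k <- degrees) (s :&: gr k))%VS /\
                  \dim s = (\sum_(k <- degrees) \dim (s :&: gr k))%N.
Proof.
rewrite /graded directvE /=; split=> -[E dE]; split=> //.
  by rewrite {1}E (eqP dE).
by rewrite -E dE.
Qed.

(** ** Conjugation *)

(** The action of substitutions on fields. It preserves parity and bracket, so
    every notion of the classification is transported by it. *)
Definition conj_end phi X : gl := (phi \o X \o phi^-1)%VF.

Fact conj_is_linear phi : linear (conj_end phi).
Proof.
move=> u X Y; rewrite /conj_end comp_lfunDr -comp_lfunZr.
by rewrite comp_lfunDl -comp_lfunZl.
Qed.
HB.instance Definition _ phi :=
  GRing.isLinear.Build F gl gl _ (conj_end phi) (conj_is_linear phi).

Definition conjs phi s : {vspace gl} := (linfun (conj_end phi) @: s)%VS.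

Variable phi : gl.
Hypothesis phi_lc : linear_change phi.

Lemma linear_changeVf : (phi \o phi^-1 = \1)%VF /\ (phi^-1 \o phi = \1)%VF.
Proof.
have [psi [_ phiK psiK]] := linear_change_inv phi_lc.
have ker0 : lker phi == 0%VS.
  apply/eqP/vspaceP => f; rewrite memv_ker memv0; apply/eqP/eqP => [phif|->].
    by rewrite -[f]id_lfunE -psiK comp_lfunE phif linear0.
  by rewrite linear0.
have VK := lker0_compVf ker0; split=> //.
suff -> : (phi^-1)%VF = psi by [].
by rewrite -[LHS]comp_lfun1r -phiK comp_lfunA VK comp_lfun1l.
Qed.

Lemma linear_change_invE psi : (phi \o psi = \1)%VF -> (phi^-1)%VF = psi.
Proof.
move=> phiK; have [_ VK] := linear_changeVf.
by rewrite -[LHS]comp_lfun1r -phiK comp_lfunA VK comp_lfun1l.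
Qed.

Lemma linear_changeV : linear_change (phi^-1)%VF.
Proof.
by have [psi [psi_lc phiK _]] := linear_change_inv phi_lc; rewrite (linear_change_invE phiK).
Qed.

Lemma linear_changeK f : (phi^-1)%VF (phi f) = f.
Proof. by rewrite -comp_lfunE (proj2 linear_changeVf) id_lfunE. Qed.

Lemma linear_changeVK f : phi ((phi^-1)%VF f) = f.
Proof. by rewrite -comp_lfunE (proj1 linear_changeVf) id_lfunE. Qed.

Lemma conjE X f : conj_end phi X (phi f) = phi (X f).
Proof. by rewrite !comp_lfunE linear_changeK. Qed.

Lemma conj_comp X Y : conj_end phi (X \o Y)%VF = (conj_end phi X \o conj_end phi Y)%VF.
Proof.
apply/lfunP => f; rewrite -(linear_changeVK f) comp_lfunE !conjE.
by rewrite comp_lfunE.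
Qed.

Lemma epart_conj b X : epart b (conj_end phi X) = conj_end phi (epart b X).
Proof.
have [M _ phiP] := (substitutesP phi).1 phi_lc.
apply/lfunP => f; rewrite -(linear_changeVK f) conjE /epart !sum_lfunE linear_sum.
apply: eq_bigr => c _; rewrite /= ![in LHS]comp_lfunE ![in RHS]comp_lfunE.
rewrite !(lfunE (gproj _)) /= (substitutes_gproj _ _ phiP) linear_changeK.
by rewrite (substitutes_gproj _ _ phiP).
Qed.

Lemma sbracket_conj X Y : sbracket (conj_end phi X) (conj_end phi Y) = conj_end phi (sbracket X Y).
Proof.
rewrite /sbracket linear_sum; apply: eq_bigr => a _; rewrite linear_sum.
apply: eq_bigr => b _; rewrite linearB linearZ /= !epart_conj.
by rewrite scalerN [conj_end phi (_ *: _)]linearZ /= !conj_comp.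
Qed.

Lemma conj_inj : injective (conj_end phi).
Proof.
move=> X Y E; apply/lfunP => f.
by rewrite -[LHS]linear_changeK -[RHS]linear_changeK -!conjE E.
Qed.

Lemma mem_conjs X s : (conj_end phi X \in conjs phi s) = (X \in s).
Proof.
apply/idP/idP => [/memv_imgP[Y Ys]|Xs].
  by rewrite lfunE => /conj_inj ->.
by apply/memv_imgP; exists X => //; rewrite lfunE.
Qed.

Lemma conjs_memP s X : reflect (exists2 Y, Y \in s & X = conj_end phi Y) (X \in conjs phi s).
Proof.
by apply: (iffP memv_imgP) => -[Y Ys ->]; exists Y => //; rewrite lfunE.
Qed.

Lemma conj_surj X : exists Y, X = conj_end phi Y.
Proof.
exists ((phi^-1) \o X \o phi)%VF; apply/lfunP => f; rewrite !comp_lfunE.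
by rewrite !linear_changeVK.
Qed.

(** Equivalence of subspaces thus becomes equality with an image. *)
Lemma carriesE s t : carries phi s t <-> t = conjs phi s.
Proof.
split=> [st|-> X]; last by rewrite -/(conj_end phi X) mem_conjs.
by apply/vspaceP => X; have [Y ->] := conj_surj X; rewrite mem_conjs st.
Qed.

Lemma conjsS s t : (conjs phi s <= conjs phi t)%VS = (s <= t)%VS.
Proof.
apply/subvP/subvP => [st X Xs|st X /conjs_memP[Y /st Yt ->]].
  by rewrite -mem_conjs st // mem_conjs.
by rewrite mem_conjs.
Qed.

Lemma conjs_inj : injective (conjs phi).
Proof. by move=> s t E; apply/vspaceP => X; rewrite -mem_conjs E mem_conjs. Qed.

Lemma conjs_surj t : exists s, t = conjs phi s.
Proof.
exists (linfun (conj_end phi) @^-1: t)%VS; apply/vspaceP => X.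
have [Y ->] := conj_surj X.
by rewrite mem_conjs -memv_preim lfunE.
Qed.

Lemma dim_conjs s : \dim (conjs phi s) = \dim s.
Proof.
apply: limg_dim_eq; apply/eqP; rewrite -subv0; apply/subvP => X.
rewrite memv_cap memv_ker lfunE memv0 => /andP[_ /eqP X0].
by apply/eqP/conj_inj; rewrite /= X0 linear0.
Qed.

Lemma conjs_cap s t : conjs phi (s :&: t)%VS = (conjs phi s :&: conjs phi t)%VS.
Proof.
apply/vspaceP => X; have [Y ->] := conj_surj X.
by rewrite memv_cap !mem_conjs memv_cap.
Qed.

Lemma derived_conjs s : derived (conjs phi s) = conjs phi (derived s).
Proof.
apply/eqP; rewrite eqEsubv; apply/andP; split.
  apply: derived_sub => X Y /conjs_memP[X' X's ->] /conjs_memP[Y' Y's ->].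
  by rewrite sbracket_conj mem_conjs; apply: mem_derived.
have [t Et] := conjs_surj (derived (conjs phi s)); rewrite Et conjsS.
apply: derived_sub => X Y Xs Ys.
by rewrite -mem_conjs -Et -sbracket_conj; apply: mem_derived; rewrite mem_conjs.
Qed.

Lemma iter_derived_conjs k s :
  iter k (@derived F n) (conjs phi s) = conjs phi (iter k (@derived F n) s).
Proof. by elim: k => //= k ->; rewrite derived_conjs. Qed.

Lemma solvable_conjs s : solvable (conjs phi s) <-> solvable s.
Proof.
have conjs0 : conjs phi 0%VS = 0%VS by rewrite /conjs limg0.
split=> -[k Ek]; exists k; last by rewrite iter_derived_conjs Ek.
by apply: conjs_inj; rewrite -iter_derived_conjs Ek.
Qed.

Lemma graded_conjs gr s : (forall k, k \in degrees -> conjs phi (gr k) = gr k) ->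
  graded gr (conjs phi s) <-> graded gr s.
Proof.
move=> gr_conj.
have capE k : k \in degrees -> (conjs phi s :&: gr k)%VS = conjs phi (s :&: gr k).
  by move=> /gr_conj {1}<-; rewrite conjs_cap.
rewrite !gradedP dim_conjs.
rewrite (eq_big_seq (fun k => conjs phi (s :&: gr k)%VS)) // -limg_sum -/(conjs _ _).
rewrite (eq_big_seq (fun k => \dim (s :&: gr k)%VS)); last first.
  by move=> k /capE ->; rewrite dim_conjs.
by split=> -[E dE]; split=> //; [apply: conjs_inj | congr conjs].
Qed.

Lemma graded_solvable_conjs g gr s :
  conjs phi g = g -> (forall k, k \in degrees -> conjs phi (gr k) = gr k) ->
  graded_solvable g gr (conjs phi s) <-> graded_solvable g gr s.
Proof.
move=> g_conj gr_conj.
have sub_conj : subsuperalgebra g (conjs phi s) <-> subsuperalgebra g s.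
  rewrite /subsuperalgebra -{1}g_conj conjsS; split=> -[sg sE sB]; split=> //.
  - by move=> b X Xs; rewrite -mem_conjs -epart_conj sE ?mem_conjs.
  - by move=> X Y Xs Ys; rewrite -mem_conjs -sbracket_conj sB ?mem_conjs.
  - by move=> b _ /conjs_memP[X Xs ->]; rewrite epart_conj mem_conjs sE.
  move=> _ _ /conjs_memP[X Xs ->] /conjs_memP[Y Ys ->].
  by rewrite sbracket_conj mem_conjs sB.
have gr_s := graded_conjs s gr_conj; have so_s := solvable_conjs s.
by split=> -[/sub_conj ? /gr_s ? /so_s ?]; split.
Qed.

Lemma max_graded_solvable_conjs g gr s :
  conjs phi g = g -> (forall k, k \in degrees -> conjs phi (gr k) = gr k) ->
  max_graded_solvable g gr (conjs phi s) -> max_graded_solvable g gr s.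
Proof.
move=> g_conj gr_conj [/(graded_solvable_conjs _ g_conj gr_conj) s_gs s_max].
split=> // t t_gs st; apply: conjs_inj; apply: s_max; last by rewrite conjsS.
exact/(graded_solvable_conjs _ g_conj gr_conj).
Qed.

End Conjugation.

(** * Superalgebras with a multiplication table *)

Section FreeFamily.
Variables (F : fieldType) (V : vectType F) (J : eqType) (e : J -> V).
Implicit Types (D P Q : seq J) (c : J -> F).

Lemma big_if_notin j P c u : j \notin P ->
  \sum_(k <- P) (if k == j then u else c k) *: e k = \sum_(k <- P) c k *: e k.
Proof.
move=> jP; apply: eq_big_seq => k kP.
by case: eqP => // kj; rewrite -kj kP in jP.
Qed.

Lemma span_map_mem P x : uniq P -> x \in <<map e P>>%VS ->
  exists c, x = \sum_(j <- P) c j *: e j.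
Proof.
elim: P x => [|j P IHP] x /=.
  by rewrite span_nil memv0 => _ /eqP ->; exists (fun=> 0); rewrite big_nil.
case/andP=> jP /IHP{}IHP.
rewrite span_cons => /memv_addP[_ /vlineP[u ->] [y /IHP[c ->] ->]].
exists (fun k => if k == j then u else c k); rewrite big_cons eqxx.
by rewrite big_if_notin.
Qed.

Lemma free_map D : uniq D ->
  (forall c, \sum_(j <- D) c j *: e j = 0 -> {in D, forall j, c j = 0}) ->
  free (map e D).
Proof.
elim: D => [|j D IHD] /=; first by rewrite nil_free.
case/andP=> jD Du indep; rewrite free_cons; apply/andP; split.
  apply/negP => /(span_map_mem Du)[c Ec].
  have := indep (fun k => if k == j then -1 else c k) _ j (mem_head _ _).
  rewrite eqxx big_cons eqxx big_if_notin // -Ec scaleN1r addNr => /(_ erefl)/eqP.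
  by rewrite oppr_eq0 oner_eq0.
apply: IHD => // c sum0 k kD.
have := indep (fun k => if k == j then 0 else c k) _ k; rewrite inE kD orbT.
rewrite big_cons eqxx big_if_notin // scale0r add0r => /(_ sum0 isT).
by case: eqP => // kj; rewrite -kj kD in jD.
Qed.

(** Independence is tested by linear functionals, here coefficients of the
    values of a field on the generators. *)
Lemma free_dual D : uniq D ->
  {in D, forall j, exists delta : V -> F, linear (delta : V -> F^o) /\
     {in D, forall k, delta (e k) = (j == k)%:R}} ->
  free (map e D).
Proof.
move=> Du dual_e; apply: free_map => // c sum0 j jD.
have [delta [lin deltaE]] := dual_e j jD.
have delta0 : delta 0 = 0 by have := lin (-1) 0 0; rewrite scaler0 addr0 scaleN1r addNr.
have delta_sum s : {subset s <= D} ->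
    delta (\sum_(k <- s) c k *: e k) = \sum_(k <- s) c k * (j == k)%:R.
  elim: s => [|k s IHs] sD; first by rewrite !big_nil.
  rewrite !big_cons lin deltaE ?sD ?mem_head // IHs // => l ls.
  by rewrite sD // inE ls orbT.
have := delta_sum D (fun _ => id); rewrite sum0 delta0 (bigD1_seq j) //= eqxx mulr1.
by rewrite big1 ?addr0 // => k kj; rewrite eq_sym (negPf kj) mulr0.
Qed.

Variable D : seq J.
Hypothesis D_uniq : uniq D.
Hypothesis e_free : free (map e D).

Lemma free_coordinates : exists c : J -> V -> F,
  (forall j, linear (c j : V -> F^o)) /\
  {in D &, forall j k, c j (e k) = (j == k)%:R}.
Proof.
case: (posnP (size D)) => [/size0nil D0|D_gt0].
  by exists (fun _ _ => 0); split=> [j u x y|j]; rewrite ?D0 // scaler0 addr0.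
have szD : (0 < size (map e D))%N by rewrite size_map.
pose i j := insubd (Ordinal szD) (index j D) : 'I_(size (map e D)).
have iE j : j \in D -> i j = index j D :> nat.
  by move=> jD; rewrite val_insubd ifT // size_map index_mem.
exists (fun j x => coord (in_tuple (map e D)) (i j) x); split=> [j u x y|j k jD kD].
  by rewrite linearP.
have -> : e k = (in_tuple (map e D))`_(i k).
  by rewrite iE //= (nth_map j) ?index_mem // nth_index.
rewrite coord_free //; congr (_%:R); rewrite -val_eqE /= !iE // eq_sym.
by congr nat_of_bool; apply/eqP/eqP => [/index_inj->//|->].
Qed.

Lemma mem_span_map P (c : J -> F) : \sum_(j <- P) c j *: e j \in <<map e P>>%VS.
Proof.
by rewrite big_seq; apply: memv_suml => j jP; apply/memvZ/memv_span/map_f.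
Qed.

Lemma dim_span_map P : uniq P -> {subset P <= D} -> \dim <<map e P>> = size P.
Proof.
move=> Pu PD; rewrite -(size_map e); apply/eqP; rewrite -/(free _).
have DP : perm_eq D (P ++ [seq j <- D | j \notin P]).
  rewrite uniq_perm // ?cat_uniq ?Pu ?filter_uniq //= => [|j].
    by rewrite andbT; apply/hasPn => j; rewrite mem_filter => /andP[].
  rewrite mem_cat mem_filter; case: (boolP (j \in P)) => //= /PD.
  by move=> ->.
have := e_free; rewrite (perm_free (perm_map e DP)) map_cat.
exact: catl_free.
Qed.

(** Freeness makes coordinate subspaces behave like sets of labels; this gives
    the graded components of a subspace spanned by labels. *)
Lemma span_map_cap P Q : uniq P -> uniq Q -> {subset P <= D} -> {subset Q <= D} ->
  (<<map e P>> :&: <<map e Q>>)%VS = <<map e [seq j <- P | j \in Q]>>%VS.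
Proof.
move=> Pu Qu PD QD; have [c [c_lin cE]] := free_coordinates.
have c_sum s (a : J -> F) j : {subset s <= D} -> uniq s -> j \in D ->
    c j (\sum_(k <- s) a k *: e k) = if j \in s then a j else 0.
  move=> sD su jD.
  have c0 : c j 0 = 0 by have := c_lin j (-1) 0 0; rewrite scaler0 addr0 scaleN1r addNr.
  elim: s sD su => [|k s IHs] sD /=; first by rewrite big_nil.
  case/andP=> ks su.
  have kD : k \in D by apply: sD; rewrite mem_head.
  rewrite big_cons c_lin IHs //; last by move=> l ls; apply: sD; rewrite inE ls orbT.
  rewrite cE // inE; have [->|_] := eqVneq j k; rewrite /GRing.scale /=.
    by rewrite (negPf ks) mulr1 addr0.
  by rewrite mulr0 add0r.
apply/eqP; rewrite eqEsubv; apply/andP; split; last first.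
  apply/span_subvP => x /mapP[j]; rewrite mem_filter => /andP[jQ jP] ->.
  by rewrite memv_cap !memv_span // map_f.
apply/subvP => x; rewrite memv_cap => /andP[xP /(span_map_mem Qu)[b xb]].
have [a xa] := span_map_mem Pu xP; rewrite xa.
have -> : \sum_(j <- P) a j *: e j = \sum_(j <- P | j \in Q) a j *: e j.
  rewrite (bigID (mem Q)) /= [X in _ + X]big1_seq ?addr0 // => j /andP[jQ jP].
  have := c_sum P a j PD Pu (PD _ jP); rewrite -xa xb c_sum ?PD // jP (negPf jQ).
  by move=> <-; rewrite scale0r.
by rewrite -big_filter; apply: mem_span_map.
Qed.

(** Derivatives and products of monomials are monomials up to sign, so a
    bracket of basis fields takes this form. *)
Definition signed_sum (s : seq (bool * J)) : V :=
  \sum_(t <- s) (-1) ^+ t.1 *: e t.2.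

(** A label may occur twice with opposite signs in a bracket, which then does
    not involve it. *)
Definition survives (s : seq (bool * J)) (k : J) :=
  count_mem (false, k) s != count_mem (true, k) s.

Lemma signed_sum_span s Q :
  (forall k, survives s k -> k \in Q) -> signed_sum s \in <<map e Q>>%VS.
Proof.
move=> sQ; pose K := undup (map snd s).
have -> : signed_sum s = \sum_(k <- K)
    ((count_mem (false, k) s)%:R - (count_mem (true, k) s)%:R) *: e k.
  have -> : signed_sum s = \sum_(t <- s) \sum_(k <- K | k == t.2) (-1) ^+ t.1 *: e k.
    apply: eq_big_seq => t ts; rewrite -big_filter filter_pred1_uniq ?undup_uniq //.
      by rewrite big_seq1.
    by rewrite mem_undup map_f.
  rewrite (exchange_big_dep xpredT) //=; apply: eq_bigr => k _.
  elim: (s) => [|[b j] r IHr]; first by rewrite big_nil subrr scale0r.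
  rewrite big_cons /= !xpair_eqE /= IHr eq_sym; case: eqP => _; last first.
    by rewrite !andbF !add0n.
  by rewrite !andbT -scalerDl !natrD; congr (_ *: _); case: b => /=; ring.
apply: memv_suml => k _; case: (boolP (survives s k)) => [/sQ kQ|].
  by apply/memvZ/memv_span/map_f.
by rewrite negbK => /eqP ->; rewrite subrr scale0r mem0v.
Qed.

End FreeFamily.

Section BasedSuperalgebra.
Variables (F : fieldType) (n : nat) (J : eqType).
Local Notation gl := 'End(grassmann F n).
Variables (e : J -> gl) (D : seq J) (deg : J -> int).
Variable (br : J -> J -> seq (bool * J)).
Implicit Types P Q : seq J.

Definition closes P (P' : seq J) Q := all (fun i => all (fun j =>
  all (fun t => survives (br i j) t.2 ==> (t.2 \in Q)) (br i j)) P') P.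

Definition derived_labels P :=
  [seq k <- D | has (fun i => has (fun j => survives (br i j) k) P) P].

(** The closure test makes the span of [derived_labels P] contain the derived
    algebra of the span of [P], so that the iteration bounds the derived series
    from above. *)
Fixpoint solvable_table k P :=
  if k is k'.+1 then closes P P (derived_labels P) && solvable_table k' (derived_labels P)
  else P == [::].

Definition degree_count P k := count (fun j => deg j == k) P.

(** The last condition says that every label of [P] has one of the degrees of
    the grading, each degree being counted once. *)
Definition graded_solvable_table k P :=
  [&& uniq P, all (mem D) P, closes P P P, solvable_table k P
    & size P == sumn [seq degree_count P k | k <- degrees]].

(** Dimensions in each degree are invariant under substitutions, so this
    excludes that one subspace is contained in a conjugate of another one. *)
Definition incomparable_table (Ps : seq (seq J)) := all (fun P => all (fun Q =>
  (P == Q) || has (fun k => degree_count Q k < degree_count P k)%N degrees) Ps) Ps.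

Hypothesis D_uniq : uniq D.
Hypothesis e_free : free (map e D).
Hypothesis e_bracket : {in D &, forall i j,
  sbracket (e i) (e j) = signed_sum e (br i j)}.
Hypothesis e_parity : {in D, forall j, exists b, opar b (e j)}.
Hypothesis e_degree : {in D, forall j, deg j \in degrees}.
Variable gr : int -> {vspace gl}.
Hypothesis grE : forall k, k \in degrees ->
  gr k = <<map e [seq j <- D | deg j == k]>>%VS.

Lemma closes_sbracket P (P' : seq J) Q X Y :
  uniq P -> uniq P' -> {subset P <= D} -> {subset P' <= D} -> closes P P' Q ->
  X \in <<map e P>>%VS -> Y \in <<map e P'>>%VS -> sbracket X Y \in <<map e Q>>%VS.
Proof.
move=> Pu P'u PD P'D /allP PQ /(span_map_mem Pu)[c ->] /(span_map_mem P'u)[c' ->].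
rewrite sbracket_suml big_seq; apply: memv_suml => i' i'P.
rewrite sbracketZl memvZ // sbracket_sumr big_seq.
apply: memv_suml => j' j'P; rewrite sbracketZr memvZ //.
rewrite (e_bracket (PD _ i'P) (P'D _ j'P)); apply: signed_sum_span => k.
have /allP/(_ _ j'P)/allP brQ := PQ _ i'P.
have [kbr sk|kbr] := boolP (k \in map snd (br i' j')).
  by have /mapP[t tbr Ek] := kbr; have /implyP := brQ _ tbr; rewrite -Ek => ->.
have count0 b : count_mem (b, k) (br i' j') = 0%N.
  apply/count_memPn; apply: contra kbr => bk.
  by apply/mapP; exists (b, k).
by rewrite /survives !count0.
Qed.

Lemma solvable_tableP k P : uniq P -> {subset P <= D} -> solvable_table k P ->
  solvable <<map e P>>%VS.
Proof.
move=> Pu PD tP; exists k; apply/eqP; rewrite -subv0.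
elim: k P Pu PD tP => [|k IHk] P Pu PD /=; first by move/eqP=> -> /=; rewrite span_nil.
case/andP=> clP tP; rewrite -iterS iterSr.
apply: subv_trans (IHk (derived_labels P) _ _ tP); last first.
- by move=> j; rewrite mem_filter => /andP[].
- exact: filter_uniq.
by apply: iter_derivedS; apply: derived_sub => X Y; apply: closes_sbracket.
Qed.

Lemma cap_degree P k : uniq P -> {subset P <= D} -> k \in degrees ->
  (<<map e P>> :&: gr k)%VS = <<map e [seq j <- P | deg j == k]>>%VS.
Proof.
move=> Pu PD kd; rewrite grE // (span_map_cap (D := D)) ?filter_uniq //; last first.
  by move=> j; rewrite mem_filter => /andP[].
by congr <<map e _>>%VS; apply: eq_in_filter => j /PD jD; rewrite mem_filter jD andbT.
Qed.

Lemma dim_cap_degree P k : uniq P -> {subset P <= D} -> k \in degrees ->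
  \dim (<<map e P>> :&: gr k) = degree_count P k.
Proof.
move=> Pu PD kd; rewrite cap_degree // (dim_span_map (D := D)) ?filter_uniq //.
  by rewrite size_filter.
by move=> j; rewrite mem_filter => /andP[_ /PD].
Qed.

Lemma graded_solvable_tableP k P : graded_solvable_table k P ->
  graded_solvable <<map e D>>%VS gr <<map e P>>%VS.
Proof.
case/and5P=> Pu /allP PD clP soP /eqP szP; split; last exact: (solvable_tableP Pu PD soP).
  split; first by apply: sub_span => x /mapP[j /PD jD ->]; apply: map_f.
    move=> b X /(span_map_mem Pu)[c ->].
    rewrite epart_sum big_seq; apply: memv_suml => j jP; rewrite epartZ memvZ //.
    have [a /epart_opar ->] := e_parity (PD _ jP).
    by case: ifP; rewrite ?mem0v // memv_span ?map_f.
  by move=> X Y; apply: closes_sbracket.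
apply/gradedP; split; last first.
  rewrite (dim_span_map D_uniq) // szP sumnE big_map; apply: eq_big_seq => d dd.
  by rewrite dim_cap_degree.
apply/eqP; rewrite eqEsubv; apply/andP; split; last first.
  elim/big_ind: _ => [|U W UP WP|d _]; rewrite ?sub0v ?subv_add ?UP //.
  exact: capvSl.
apply/span_subvP => x /mapP[j jP ->].
have jd := e_degree (PD _ jP); rewrite (big_rem _ jd) /=.
apply: (subvP (addvSl _ _)); rewrite memv_cap memv_span ?map_f //= grE //.
by rewrite memv_span // map_f // mem_filter eqxx; apply: PD.
Qed.

Local Notation span P := <<map e P>>%VS.

Lemma span_models_gs k Ps : all (graded_solvable_table k) Ps ->
  forall c, c \in [seq span P | P <- Ps] -> graded_solvable (span D) gr c.
Proof. by move=> /allP tP c /mapP[P /tP PPs ->]; apply: graded_solvable_tableP PPs. Qed.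

Lemma span_models_dim k Ps : all (graded_solvable_table k) Ps -> incomparable_table Ps ->
  {in [seq span P | P <- Ps] &, forall c c',
    (forall d, d \in degrees -> \dim (c :&: gr d) <= \dim (c' :&: gr d))%N -> c = c'}.
Proof.
move=> /allP tP /allP incP c c' /mapP[P PPs ->] /mapP[Q QPs ->] dims.
have /allP/(_ Q QPs) := incP P PPs; case: eqP => [->//|_ /hasP[d dd]].
have [/and5P[Pu /allP PD _ _ _] /and5P[Qu /allP QD _ _ _]] := (tP P PPs, tP Q QPs).
by rewrite ltnNge -(dim_cap_degree Pu PD dd) -(dim_cap_degree Qu QD dd) dims.
Qed.

Lemma span_degree_count k Ps P Q d : all (graded_solvable_table k) Ps ->
  P \in Ps -> Q \in Ps -> span P = span Q -> d \in degrees ->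
  degree_count P d = degree_count Q d.
Proof.
move=> /allP tP /tP/and5P[Pu /allP PD _ _ _] /tP/and5P[Qu /allP QD _ _ _] E dd.
by rewrite -(dim_cap_degree Pu PD dd) E dim_cap_degree.
Qed.

End BasedSuperalgebra.

(** ** From a covering family to the classification of maximal elements *)

Section Classification.
Variables (F : fieldType) (n : nat).
Local Notation gl := 'End(grassmann F n).
Variables (g : {vspace gl}) (gr : int -> {vspace gl}).
Variables (admissible : gl -> Prop) (models : seq {vspace gl}).
Implicit Types (s t c : {vspace gl}) (phi : gl).

Hypothesis admissible_lc : forall phi, admissible phi -> linear_change phi.
Hypothesis conj_g : forall phi, admissible phi -> conjs phi g = g.
Hypothesis conj_gr : forall phi, admissible phi ->
  forall k, k \in degrees -> conjs phi (gr k) = gr k.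
Hypothesis models_gs : forall c, c \in models -> graded_solvable g gr c.
Hypothesis models_dim : {in models &, forall c c',
  (forall k, k \in degrees -> \dim (c :&: gr k) <= \dim (c' :&: gr k))%N -> c = c'}.
Hypothesis models_cover : forall s, graded_solvable g gr s ->
  exists phi c, [/\ admissible phi, c \in models & (conjs phi s <= c)%VS].

Lemma dim_cap_conjs phi s k : admissible phi -> k \in degrees ->
  \dim (conjs phi s :&: gr k) = \dim (s :&: gr k).
Proof.
move=> aphi kd; rewrite -{1}(conj_gr aphi kd) -(conjs_cap (admissible_lc aphi)).
by rewrite (dim_conjs (admissible_lc aphi)).
Qed.

(** A graded solvable [t] above a model is carried into a model. The dimensions
    force the latter to be the one started from, and then [t] to be no larger
    than it. *)
Lemma model_max c : c \in models -> max_graded_solvable g gr c.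
Proof.
move=> cm; split=> [|t t_gs ct]; first exact: models_gs.
have [phi [c' [aphi c'm tc']]] := models_cover t_gs.
have Ec : c = c'.
  apply: models_dim => // k kd; apply: leq_trans (dimvS (capvS ct (subvv _))) _.
  by rewrite -(dim_cap_conjs _ aphi) //; apply/dimvS/capvS.
apply/esym/eqP; rewrite eqEdim ct Ec -(dim_conjs (admissible_lc aphi)).
exact: dimvS.
Qed.

(** A maximal element is carried into a model, hence onto it: the inverse image
    of the model is graded solvable and contains the maximal element. *)
Lemma max_iff_model s : max_graded_solvable g gr s <->
  exists phi c, [/\ admissible phi, c \in models & carries phi s c].
Proof.
split=> [[s_gs s_max]|[phi [c [aphi cm]]]].
  have [phi [c [aphi cm sc]]] := models_cover s_gs.
  have lc := admissible_lc aphi; exists phi, c; split=> //; apply/carriesE => //.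
  have [t Et] := conjs_surj lc c; rewrite Et; congr conjs; apply: s_max.
    apply/(graded_solvable_conjs lc _ (conj_g aphi) (conj_gr aphi)).
    by rewrite -Et; apply: models_gs.
  by rewrite -(conjsS lc) -Et.
move=> /(carriesE (admissible_lc aphi)) Ec.
apply: (max_graded_solvable_conjs (admissible_lc aphi) (conj_g aphi) (conj_gr aphi)).
by rewrite -Ec; apply: model_max.
Qed.

Lemma models_inequivalent phi c c' : admissible phi -> c \in models -> c' \in models ->
  carries phi c c' -> c = c'.
Proof.
move=> aphi cm c'm /(carriesE (admissible_lc aphi)) Ec'; apply: models_dim => // k kd.
by rewrite Ec' dim_cap_conjs.
Qed.

End Classification.

(** * Computing with monomials *)

(** Lists of membership bits stand for sets of indices: unlike the latter they
    evaluate, so that multiplication tables can be checked by computation. *)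
Section Bits.
Variable n : nat.
Implicit Types (a b : bitseq) (i j : nat).

Definition bits (p : pred nat) : bitseq := mkseq p n.
Definition mem_bits a i := nth false a i.
Definition bitset a : {set 'I_n} := [set i : 'I_n | mem_bits a i].

Definition bits_before i a := count (fun j => mem_bits a j && (j < i)%N) (iota 0 n).
Definition bits_card a := count (mem_bits a) (iota 0 n).
Definition bits_inversions a b :=
  sumn [seq if mem_bits a i then bits_before i b else 0%N | i <- iota 0 n].
Definition bits_disjoint a b := all (fun i => ~~ (mem_bits a i && mem_bits b i)) (iota 0 n).
Definition bits_union a b := bits (fun i => mem_bits a i || mem_bits b i).
Definition bits_remove i a := bits (fun j => (j != i) && mem_bits a j).

Fixpoint all_bits k : seq bitseq :=
  if k is k'.+1 then
    map (cons false) (all_bits k') ++ map (cons true) (all_bits k')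
  else [:: [::]].

Lemma mem_all_bits k a : (a \in all_bits k) = (size a == k).
Proof.
have inj (c : bool) : injective (cons c : bitseq -> bitseq) by move=> u v [].
elim: k a => [|k IHk] [|b a] //=; rewrite mem_cat.
  by apply/negbTE/negP => /orP[] /mapP[].
rewrite eqSS -IHk; have cross (b1 : bool) (r : seq bitseq) : b1 :: a \in map (cons (~~ b1)) r = false.
  by apply/negbTE/negP => /mapP[c _ [/eqP]]; case: b1.
by case: b; rewrite (mem_map (inj _)) ?(cross true) ?(cross false) ?orbF.
Qed.

Lemma in_bitset a (i : 'I_n) : (i \in bitset a) = mem_bits a i.
Proof. by rewrite inE. Qed.

Lemma mem_bitsE p i : (i < n)%N -> mem_bits (bits p) i = p i.
Proof. exact: nth_mkseq. Qed.

Lemma bitset_inj : {in all_bits n &, injective bitset}.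
Proof.
move=> a b; rewrite !mem_all_bits => /eqP sa /eqP sb /setP E.
apply: (@eq_from_nth _ false) => [|i]; rewrite sa ?sb // => ltin.
by have := E (Ordinal ltin); rewrite !in_bitset.
Qed.

Lemma bitset_surj (A : {set 'I_n}) : exists2 a, a \in all_bits n & A = bitset a.
Proof.
exists (bits (fun i => i \in map val (enum A))).
  by rewrite mem_all_bits size_mkseq.
apply/setP => i; rewrite in_bitset mem_bitsE // mem_map ?mem_enum //.
exact: val_inj.
Qed.

Lemma count_ord (p : pred nat) : #|[set i : 'I_n | p i]| = count p (iota 0 n).
Proof.
rewrite cardE size_filter -val_enum_ord count_map /enum_mem filter_predT.
by apply: eq_count => i; rewrite /= inE.
Qed.

Lemma card_bitset a : #|bitset a| = bits_card a.
Proof. exact: count_ord. Qed.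

Lemma before_bitset (i : 'I_n) a : before i (bitset a) = bits_before i a.
Proof.
by rewrite /bits_before -count_ord; apply: eq_card => j; rewrite !inE.
Qed.

Lemma inversions_bitset a b : inversions (bitset a) (bitset b) = bits_inversions a b.
Proof.
have -> : bits_inversions a b = (\sum_(i : 'I_n | i \in bitset a) before i (bitset b))%N.
  rewrite /bits_inversions sumnE big_map -{1}[n]subn0 -/(index_iota 0 n) big_mkord.
  by rewrite [RHS]big_mkcond; apply: eq_bigr => i _; rewrite in_bitset before_bitset.
rewrite /inversions -sum1_card.
under [RHS]eq_bigr => i _ do rewrite /before -sum1_card.
rewrite pair_big_dep /=; apply: eq_bigl => p; rewrite !inE.
by [].
Qed.

Lemma disjoint_bitset a b : [disjoint bitset a & bitset b] = bits_disjoint a b.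
Proof.
rewrite -setI_eq0; apply/eqP/allP => [/setP E i|ab].
  rewrite mem_iota /= add0n => ltin.
  by have := E (Ordinal ltin); rewrite !inE => ->.
apply/setP => i; rewrite !inE; apply/negbTE/ab.
by rewrite mem_iota /= add0n.
Qed.

Lemma bitsetU a b : bitset a :|: bitset b = bitset (bits_union a b).
Proof. by apply/setP => i; rewrite !inE mem_bitsE. Qed.

Lemma bitsetD1 a (i : 'I_n) : bitset a :\ i = bitset (bits_remove i a).
Proof. by apply/setP => j; rewrite !inE mem_bitsE. Qed.

Lemma bitset1 (i : 'I_n) : [set i] = bitset (bits (pred1 (val i))).
Proof. by apply/setP => j; rewrite !inE mem_bitsE. Qed.

(** Signed lists of monomials are closed under products and derivatives, up to
    evaluation by [table_eval]. *)
Implicit Types (s t : seq (bool * bitseq)).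

Definition table_der i a : seq (bool * bitseq) :=
  if mem_bits a i then [:: (odd (bits_before i a), bits_remove i a)] else [::].

Definition table_mul1 (p q : bool * bitseq) : seq (bool * bitseq) :=
  if bits_disjoint p.2 q.2 then
    [:: (p.1 (+) q.1 (+) odd (bits_inversions p.2 q.2), bits_union p.2 q.2)]
  else [::].

Definition table_mul s t := flatten [seq table_mul1 p q | p <- s, q <- t].

Variable F : fieldType.
Local Notation L := (grassmann F n).

Definition bmono a : L := mono F (bitset a).
Definition table_eval s : L := signed_sum bmono s.

Lemma table_eval_cat s t : table_eval (s ++ t) = table_eval s + table_eval t.
Proof. exact: big_cat. Qed.

Lemma gder_bmono (i : 'I_n) a : gder i (bmono a) = table_eval (table_der i a).
Proof.
rewrite gder_mono in_bitset /table_der /table_eval /signed_sum.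
case: ifP => _; last by rewrite big_nil.
by rewrite big_seq1 /= signr_odd before_bitset bitsetD1.
Qed.

Lemma table_mul1E (p q : bool * bitseq) : ((-1) ^+ p.1 *: bmono p.2) ** ((-1) ^+ q.1 *: bmono q.2) =
  table_eval (table_mul1 p q).
Proof.
rewrite gmulZl gmulZr gmul_mono disjoint_bitset /table_mul1 /table_eval /signed_sum.
case: ifP => _; last by rewrite big_nil !scaler0.
by rewrite big_seq1 /= !signr_addb signr_odd inversions_bitset bitsetU !scalerA.
Qed.

Lemma table_mulE s t : table_eval s ** table_eval t = table_eval (table_mul s t).
Proof.
rewrite {1 2}/table_eval /signed_sum gmul_suml /table_mul.
elim: s => [|p s IHs]; first by rewrite big_nil /table_eval /signed_sum big_nil.
rewrite big_cons IHs /= flatten_cat table_eval_cat; congr (_ + _).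
rewrite gmul_sumr; elim: t {IHs} => [|q t IHt] /=.
  by rewrite big_nil /table_eval /signed_sum big_nil.
by rewrite big_cons IHt table_eval_cat table_mul1E.
Qed.

Lemma table_eval1 (c : bool) a : table_eval [:: (c, a)] = (-1) ^+ c *: bmono a.
Proof. by rewrite /table_eval /signed_sum big_seq1. Qed.

Lemma gpar_bmono a : gpar (odd (bits_card a)) (bmono a).
Proof. by rewrite -card_bitset; apply: gpar_mono. Qed.

Lemma gen_bmono (i : 'I_n) : gen F i = bmono (bits (pred1 (val i))).
Proof. by rewrite /gen bitset1. Qed.

Lemma bmono_mul a b : bits_disjoint a b && ~~ odd (bits_inversions a b) ->
  bmono a ** bmono b = bmono (bits_union a b).
Proof.
case/andP=> dab even; have := table_mul1E (false, a) (false, b).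
by rewrite /table_mul1 dab table_eval1 /= (negPf even) !expr0 !scale1r.
Qed.

Lemma gone_bmono : gone F n = bmono (bits pred0).
Proof. by congr mono; apply/setP => i; rewrite !inE mem_bitsE. Qed.

End Bits.

Section HamiltonianTable.
Variables (F : fieldType) (m : nat).
Local Notation n := (m + m)%N.
Implicit Types a b : bitseq.

Definition bdual i := if (i < m)%N then (i + m)%N else (i - m)%N.

Lemma bdualE (i : 'I_n) : dual i = bdual i :> nat.
Proof.
rewrite -(splitK i); case: (split i) => k /=; rewrite /bdual.
  by rewrite dual_lshift /= ltn_ord addnC.
by rewrite dual_rshift /= ltnNge leq_addr addKn.
Qed.

Definition table_poisson a b : seq (bool * bitseq) :=
  [seq (odd (bits_card n a) (+) t.1, t.2)
     | t <- flatten [seq table_mul n (table_der n i a) (table_der n (bdual i) b)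
                       | i <- iota 0 n]].

Lemma poisson_bmono a b :
  poisson (bmono n F a) (bmono n F b) = table_eval n F (table_poisson a b).
Proof.
rewrite poissonE (gtwist_gpar (@gpar_bmono _ _ a)) /table_eval /signed_sum.
rewrite big_map /=.
under [RHS]eq_bigr => t _ do rewrite signr_addb -scalerA.
rewrite -scaler_sumr -/(signed_sum _ _) -/(table_eval _ _ _).
under eq_bigr => i _ do
  rewrite linearZ /= gmulZl !gder_bmono bdualE table_mulE.
rewrite -scaler_sumr; congr (_ *: _).
rewrite -(big_mkord xpredT (fun i =>
  table_eval n F (table_mul n (table_der n i a) (table_der n (bdual i) b)))).
rewrite /index_iota subn0; elim: (iota 0 n) => [|i r IHr] /=.
  by rewrite big_nil /table_eval /signed_sum big_nil.
by rewrite big_cons IHr table_eval_cat.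
Qed.

End HamiltonianTable.

(** * The multiplication table of vect(0|2) *)

Section VectTable.
Variable F : fieldType.
Local Notation L := (grassmann F 2).
Local Notation J := (bitseq * 'I_2)%type.
Local Notation bm := (bmono 2 F).

(** The bits of a label stand for xi1, xi2 in this order; its second component
    is the index of the partial derivative. *)
Definition vect_field (j : J) : 'End(L) := vfield (bm j.1) j.2.
Definition vect_labels : seq J :=
  [seq (a, i) | a <- all_bits 2, i <- [:: ord0; ord_max]].
Definition vect_label_deg (j : J) : int := (bits_card 2 j.1)%:Z - 1.

Definition vect_table (j k : J) : seq (bool * J) :=
  [seq (t.1, (t.2, k.2)) | t <- table_mul 2 [:: (false, j.1)] (table_der 2 j.2 k.1)]
  ++ [seq (~~ (t.1 (+) (~~ odd (bits_card 2 j.1) && ~~ odd (bits_card 2 k.1))),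
           (t.2, j.2))
        | t <- table_mul 2 [:: (false, k.1)] (table_der 2 k.2 j.1)].

Lemma vfield_table_eval s i :
  vfield (table_eval 2 F s) i = \sum_(t <- s) (-1) ^+ t.1 *: vect_field (t.2, i).
Proof. by rewrite vfield_sum; apply: eq_bigr => t _; rewrite vfieldZ. Qed.

Lemma vect_field_bracket j k :
  sbracket (vect_field j) (vect_field k) = signed_sum vect_field (vect_table j k).
Proof.
rewrite (sbracket_vfield _ _ (@gpar_bmono _ _ j.1) (@gpar_bmono _ _ k.1)).
have single a : bm a = table_eval 2 F [:: (false, a)] by rewrite table_eval1 expr0 scale1r.
rewrite !gder_bmono [X in X ** _]single [X in - (_ *: vfield (X ** _) _)]single.
rewrite !table_mulE !vfield_table_eval /vect_table /signed_sum big_cat !big_map /=.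
congr (_ + _); rewrite scaler_sumr -sumrN; apply: eq_bigr => t _.
by rewrite scalerA -scaleNr -signr_addb signrN addbC.
Qed.

Lemma vect_labels_uniq : uniq vect_labels. Proof. by []. Qed.

Lemma mem_vect_labels a i : ((a, i) \in vect_labels) = (a \in all_bits 2).
Proof.
apply/allpairsP/idP => [[[b k] [/= b2 _ [-> _]]]//|a2].
exists (a, i); split=> //; rewrite !inE -!val_eqE /=.
by case: i => -[|[|//]].
Qed.

Lemma vect_field_free : free (map vect_field vect_labels).
Proof.
apply: free_dual => // -[a i]; rewrite mem_vect_labels => a2.
exists (fun X : 'End(L) => X (gen F i) (bitset 2 a)); split=> [u X Y|].
  by rewrite add_lfunE scale_lfunE !gcoefE.
move=> -[b k]; rewrite mem_vect_labels => b2.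
rewrite vfield_gen gcoefZ ffunE (inj_in_eq (@bitset_inj 2)) //.
by rewrite xpair_eqE -natrM mulnb andbC.
Qed.

Lemma vect_spanE (P : pred {set 'I_2}) (Q : pred bitseq) :
  (forall a, Q a = P (bitset 2 a)) ->
  <<[seq vfield (mono F A) i | A <- [seq A <- enum {set 'I_2} | P A], i <- enum 'I_2]>>%VS
  = <<map vect_field [seq j <- vect_labels | Q j.1]>>%VS.
Proof.
move=> QP; apply: eq_span => X; apply/allpairsP/mapP => [[[A i] [AP _ ->]]|[[a i]]].
  rewrite /= in AP; have [a a2 EA] := bitset_surj A; exists (a, i); last by rewrite [LHS]/= EA.
  have := AP; rewrite mem_filter => /andP[PA _].
  by rewrite mem_filter mem_vect_labels a2 andbT QP -EA.
rewrite mem_filter mem_vect_labels => /andP[/= Qa _] ->.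
have AP : bitset 2 a \in [seq A <- enum {set 'I_2} | P A].
  by rewrite mem_filter -QP Qa mem_enum.
have ie : i \in enum 'I_2 by rewrite mem_enum.
by exists (bitset 2 a, i); split; [exact: AP | exact: ie |].
Qed.

Lemma vectE : vect F 2 = <<map vect_field vect_labels>>%VS.
Proof.
have := @vect_spanE predT predT (fun=> erefl).
by rewrite filter_predT; apply.
Qed.

Lemma vect_degE k : vect_deg F 2 k =
  <<map vect_field [seq j <- vect_labels | vect_label_deg j == k]>>%VS.
Proof.
apply: (@vect_spanE (fun A => #|A|%:Z - 1 == k) (fun a => (bits_card 2 a)%:Z - 1 == k)) => a.
by rewrite card_bitset.
Qed.

Lemma vect_field_parity : {in vect_labels, forall j, exists b, opar b (vect_field j)}.
Proof.
by move=> j _; exists (~~ odd (bits_card 2 j.1)); apply/opar_vfield/gpar_bmono.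
Qed.

Lemma vect_label_degP : {in vect_labels, forall j, vect_label_deg j \in degrees}.
Proof. by apply/allP; vm_compute. Qed.

Definition vect_msV_labels : seq J :=
  [:: ([:: false; false], ord0);
      ([:: true; false], ord0); ([:: false; true], ord0); ([:: false; true], ord_max);
      ([:: true; true], ord0); ([:: true; true], ord_max)].

Definition vect_msc_labels : seq J :=
  [:: ([:: false; false], ord0); ([:: false; false], ord_max);
      ([:: true; false], ord0); ([:: false; true], ord0); ([:: false; true], ord_max);
      ([:: true; true], ord0)].

Lemma vect_msVE : vect_msV F = <<map vect_field vect_msV_labels>>%VS.
Proof.
rewrite /vect_msV gone_bmono !gen_bmono.
by rewrite bmono_mul // -!span_cat.
Qed.

Lemma vect_mscE : vect_msc F = <<map vect_field vect_msc_labels>>%VS.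
Proof.
rewrite /vect_msc gone_bmono !gen_bmono.
by rewrite bmono_mul // -!span_cat.
Qed.

Definition vect_model_labels := [:: vect_msV_labels; vect_msc_labels].

Lemma vect_model_tables :
  all (graded_solvable_table vect_labels vect_label_deg vect_table 6) vect_model_labels.
Proof.
(* The derived series of both models have reached zero after 6 steps. *)
by vm_compute. Qed.

Lemma vect_model_incomparable : incomparable_table vect_label_deg vect_model_labels.
Proof. by vm_compute. Qed.

End VectTable.

(** * The multiplication table of h'(0|4) *)

Section HamiltonianCoefficients.
Variables (F : fieldType) (m : nat).
Local Notation L := (grassmann F (m + m)).

(** A generating function is determined by its field up to a constant: its
    derivatives are the values of the field on the generators. *)
Lemma hfield_coef (A : {set 'I_(m + m)}) : A != set0 ->
  exists delta : 'End(L) -> F, linear (delta : 'End(L) -> F^o) /\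
    forall f, delta (hfield f) = f A.
Proof.
case/set0Pn=> i iA; pose u := (-1) ^+ before i (A :\ i) * (-1) ^+ #|A| : F.
exists (fun X : 'End(L) => u * X (gen F (dual i)) (A :\ i)); split=> [v X Y|f].
  by rewrite add_lfunE scale_lfunE !gcoefE mulrDr mulrCA.
rewrite hfield_gen dualK gderE setD11 setD1K // ffunE /u.
by rewrite mulrACA -expr2 sqrr_sign mul1r mulrA -expr2 sqrr_sign mul1r.
Qed.

Lemma hfield_inj_coef (f g : L) (A : {set 'I_(m + m)}) : A != set0 ->
  hfield f = hfield g -> f A = g A.
Proof. by case/hfield_coef=> delta [_ deltaE] E; rewrite -!deltaE E. Qed.

End HamiltonianCoefficients.

Section HamTable.
Variable F : fieldType.
Local Notation L := (grassmann F (2 + 2)).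
Local Notation bm := (bmono (2 + 2) F).

Definition ham_field (a : bitseq) : 'End(L) := hfield (bm a).
Definition ham_labels : seq bitseq :=
  [seq a <- all_bits 4 | (0 < bits_card 4 a < 4)%N].
Definition ham_label_deg (a : bitseq) : int := (bits_card 4 a)%:Z - 2.

(** Constants have a zero Hamiltonian field, so they are dropped. *)
Definition ham_table (a b : bitseq) : seq (bool * bitseq) :=
  [seq t <- table_poisson 2 a b | bits_card 4 t.2 != 0%N].

Lemma ham_field_bracket a b :
  sbracket (ham_field a) (ham_field b) = signed_sum ham_field (ham_table a b).
Proof.
rewrite (sbracket_hfield (@gpar_bmono _ _ a) (@gpar_bmono _ _ b)) poisson_bmono.
rewrite hfield_sum.
rewrite [RHS]big_filter.
rewrite [RHS]big_mkcond.
apply: eq_bigr => t _.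
rewrite hfieldZ; case: eqP => //= card0.
rewrite (_ : bm t.2 = gone F (2 + 2)) ?hfield_gone ?scaler0 //.
by congr mono; apply: cards0_eq; rewrite card_bitset.
Qed.

Lemma ham_labels_uniq : uniq ham_labels. Proof. by vm_compute. Qed.

Lemma mem_ham_labels a : a \in ham_labels -> a \in all_bits 4.
Proof. by rewrite mem_filter => /andP[]. Qed.

Lemma bitset_neq0 a : a \in ham_labels -> bitset (2 + 2) a != set0.
Proof. by rewrite mem_filter -cards_eq0 card_bitset -lt0n => /andP[/andP[]]. Qed.

Lemma ham_field_free : free (map ham_field ham_labels).
Proof.
apply: free_dual => [|a aD]; first exact: ham_labels_uniq.
have [delta [lin deltaE]] := hfield_coef F (bitset_neq0 aD).
exists delta; split=> // b bD; rewrite /ham_field deltaE ffunE.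
by rewrite (inj_in_eq (@bitset_inj (2 + 2))) ?mem_ham_labels.
Qed.

Lemma ham_field_span (P : pred {set 'I_(2 + 2)}) (Q : pred bitseq) (s : seq {set 'I_(2 + 2)}) :
  (forall A, A \in s = P A) -> (forall a, Q a = P (bitset (2 + 2) a)) ->
  <<[seq hfield (mono F A) | A <- s]>>%VS
  = <<map ham_field [seq a <- all_bits 4 | Q a]>>%VS.
Proof.
move=> sP QP; apply: eq_span => X; apply/mapP/mapP => [[A As ->]|[a]].
  have [a a4 EA] := bitset_surj A; exists a; last by rewrite EA.
  by rewrite mem_filter a4 andbT QP -EA -sP.
rewrite mem_filter => /andP[Qa a4] ->.
by exists (bitset (2 + 2) a); rewrite ?sP -?QP.
Qed.

Lemma hamE : ham F 2 = <<map ham_field (all_bits 4)>>%VS.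
Proof.
rewrite -[in RHS](filter_predT (all_bits 4)).
by apply: (@ham_field_span predT predT) => // A; rewrite mem_enum.
Qed.

Lemma ham_field_bracket_in (D : seq bitseq) : {in D &, forall a b,
  sbracket (ham_field a) (ham_field b) = signed_sum ham_field (ham_table a b)}.
Proof. by move=> a b _ _; apply: ham_field_bracket. Qed.

(** The terms of a bracket that produce the monomial of degree 4 cancel in
    pairs. Conversely the table exhibits each monomial of degree 1, 2 or 3 as
    a bracket, up to sign. *)
Lemma ham'E : ham' F 2 = <<map ham_field ham_labels>>%VS.
Proof.
apply/eqP; rewrite /ham' hamE eqEsubv; apply/andP; split.
  apply: derived_sub => X Y.
  apply: (closes_sbracket (ham_field_bracket_in (D := all_bits 4))) => //.
apply/span_subvP => _ /mapP[k kD ->].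
have /allP/(_ k kD)/hasP[a a4 /hasP[b b4 /hasP[c _ /eqP E]]] : all (fun k =>
    has (fun a => has (fun b => has (fun c => ham_table a b == [:: (c, k)])
      [:: false; true]) (all_bits 4)) (all_bits 4)) ham_labels.
  by vm_compute.
have := mem_derived (memv_span (map_f ham_field a4)) (memv_span (map_f ham_field b4)).
rewrite ham_field_bracket E /signed_sum big_seq1 /= => /(memvZ ((-1) ^+ c)).
by rewrite scalerA -expr2 sqrr_sign scale1r.
Qed.

Lemma ham'_degE k : k \in degrees ->
  ham'_deg F 2 k = <<map ham_field [seq a <- ham_labels | ham_label_deg a == k]>>%VS.
Proof.
move=> kd; rewrite /ham'_deg.
rewrite (@ham_field_span (fun A => #|A|%:Z - 2 == k) (fun a => ham_label_deg a == k)).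
- have -> : [seq a <- all_bits 4 | ham_label_deg a == k] =
            [seq a <- ham_labels | ham_label_deg a == k].
    rewrite -filter_predI; apply: eq_in_filter => a _ /=.
    case: eqP => //= Ek; symmetry; move: kd; rewrite -Ek /ham_label_deg.
    by case: (bits_card 4 a) => [|[|[|[|[|]]]]].
  apply/capv_idPr; rewrite ham'E; apply: sub_span => X /mapP[a].
  by rewrite mem_filter => /andP[_ aD] ->; apply: map_f.
- by move=> A; rewrite mem_filter mem_enum andbT.
by move=> a; rewrite card_bitset.
Qed.

Lemma ham_field_parity (a : bitseq) : a \in ham_labels -> exists b, opar b (ham_field a).
Proof. by move=> _; exists (odd (bits_card 4 a)); apply/opar_hfield/gpar_bmono. Qed.

Lemma ham_label_degP : {in ham_labels, forall a, ham_label_deg a \in degrees}.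
Proof. by apply/allP; vm_compute. Qed.

(** The bits of a label stand for xi1, xi2, eta1, eta2 in this order. *)
Notation b0 := false (only parsing).
Notation b1 := true (only parsing).

Definition ham_s0_labels : seq bitseq :=
  [:: [:: b1; b0; b1; b0]; [:: b1; b1; b0; b0]; [:: b1; b0; b0; b1]; [:: b0; b1; b0; b1]].

Definition ham_msV_labels : seq bitseq :=
  [:: [:: b1; b0; b0; b0]] ++ ham_s0_labels
  ++ [:: [:: b1; b0; b1; b1]; [:: b1; b1; b1; b0]; [:: b1; b1; b0; b1]; [:: b0; b1; b1; b1]].

Definition ham_msc_labels : seq bitseq :=
  [:: [:: b1; b0; b0; b0]; [:: b0; b1; b0; b0]; [:: b0; b0; b1; b0]; [:: b0; b0; b0; b1]]
  ++ ham_s0_labels ++ [:: [:: b1; b1; b0; b1]].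

Definition ham_msVtilde_labels : seq bitseq :=
  [:: [:: b1; b0; b0; b0]; [:: b0; b1; b0; b0]; [:: b0; b0; b0; b1]] ++ ham_s0_labels
  ++ [:: [:: b1; b0; b1; b1]; [:: b1; b1; b1; b0]; [:: b1; b1; b0; b1]].

Lemma ham_s0E : ham_s0 F = <<map ham_field ham_s0_labels>>%VS.
Proof.
by rewrite /ham_s0 !gen_bmono !bmono_mul.
Qed.

Lemma ham_msVE : ham_msV F = <<map ham_field ham_msV_labels>>%VS.
Proof.
rewrite /ham_msV ham_s0E !gen_bmono !bmono_mul // /ham_msV_labels !map_cat !span_cat.
by rewrite addvA.
Qed.

Lemma ham_mscE : ham_msc F = <<map ham_field ham_msc_labels>>%VS.
Proof.
rewrite /ham_msc ham_s0E !gen_bmono !bmono_mul // /ham_msc_labels !map_cat !span_cat.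
by rewrite addvA.
Qed.

Lemma ham_msVtildeE : ham_msVtilde F = <<map ham_field ham_msVtilde_labels>>%VS.
Proof.
rewrite /ham_msVtilde ham_s0E !gen_bmono !bmono_mul // /ham_msVtilde_labels.
by rewrite !map_cat !span_cat addvA.
Qed.

Definition ham_model_labels := [:: ham_msV_labels; ham_msc_labels; ham_msVtilde_labels].

Lemma ham_model_tables :
  all (graded_solvable_table ham_labels ham_label_deg ham_table 8) ham_model_labels.
Proof.
(* The derived series of the three models have reached zero after 8 steps. *)
by vm_compute. Qed.

Lemma ham_model_incomparable : incomparable_table ham_label_deg ham_model_labels.
Proof. by vm_compute. Qed.

End HamTable.

(** * Lie's theorem in dimension two *)

Section LieTheorem2.
Variable C : numClosedFieldType.
Implicit Types (x y z : 'M[C]_2) (u v w : 'rV[C]_2) (a b c : C).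
Implicit Types S : nat -> 'M[C]_2 -> Prop.

Lemma frame_unit v u : v != 0 -> ~~ (u <= v)%MS -> col_mx v u \in unitmx.
Proof.
move=> v0 uv; rewrite -row_free_unit -row_leq_rank -addsmxE.
have : (v < v + u)%MS by rewrite ltmxE addsmxSl addsmx_sub submx_refl.
by rewrite ltmxErank rank_rV v0 => /andP[].
Qed.

(** In the frame of [v] and [u] the matrix [x] is lower triangular with both
    diagonal entries equal to [a]. *)
Lemma frame_trace v u x a b : v != 0 -> ~~ (u <= v)%MS ->
  v *m x = a *: v -> u *m x = b *: v + a *: u -> \tr x = a *+ 2.
Proof.
move=> v0 uv vx ux; have P_unit := frame_unit v0 uv; set P := col_mx v u in P_unit.
have -> : x = invmx P *m (block_mx a%:M 0 b%:M a%:M *m P).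
  by rewrite mul_block_col !mul_scalar_mx mul0mx addr0 -ux -vx -mul_col_mx mulKmx.
rewrite mxtrace_mulC -mulmxA mulmxV // mulmx1 mxtrace_block !mxtrace_scalar.
by rewrite -mulr2n.
Qed.

Lemma frame_scalar v u x a : v != 0 -> ~~ (u <= v)%MS ->
  v *m x = a *: v -> u *m x = a *: u -> x = a%:M.
Proof.
move=> v0 uv vx ux; have P_unit := frame_unit v0 uv.
by rewrite -(mulKmx P_unit x) mul_col_mx vx ux -scale_col_mx -scalemxAr mulVmx // scalemx1.
Qed.

Definition stable_line (T : 'M[C]_2 -> Prop) w :=
  w != 0 /\ forall x, T x -> (w *m x <= w)%MS.

(** An eigenvector of a nonscalar member is stable under the others: these
    preserve the eigenspace, which is a line. *)
Lemma commuting_stable_line (T : 'M[C]_2 -> Prop) :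
  (forall x y, T x -> T y -> x *m y = y *m x) -> exists w, stable_line T w.
Proof.
move=> comm; have [all_scalar|not_all] :=
  classic (forall x, T x -> exists a, x = a%:M).
  exists (delta_mx 0 0); split.
    by apply/eqP => /matrixP/(_ 0 0)/eqP; rewrite !mxE !eqxx oner_eq0.
  by move=> x /all_scalar[a ->]; rewrite mul_mx_scalar scalemx_sub.
have [x Tx xns] : exists2 x, T x & ~ exists a, x = a%:M.
  by apply: NNPP => no; apply: not_all => x Tx; apply: NNPP => xa; apply: no; exists x.
have [a /eigenvalueP[v vx v0]] := eigenvalue_closed x (isT : (0 < 2)%N).
exists v; split=> // y Ty; apply: contraT => vy; case: xns; exists a.
by apply: (frame_scalar v0 vy vx); rewrite -mulmxA (comm _ _ Ty Tx) mulmxA vx scalemxAl.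
Qed.

(** The descending chain stands for the derived series. In dimension two the
    usual trace argument is short: either the line fixed by the first derived
    term is stable, or that term consists of scalars. In the latter case
    commutators are traceless scalars, hence zero, and everything commutes. *)
Lemma lie_theorem2 k S :
  (forall i x, S i.+1 x -> S i x) ->
  (forall i x y, S i x -> S i y -> S i.+1 (x *m y - y *m x)) ->
  (forall x, S k x -> x = 0) ->
  exists w, stable_line (S 0%N) w.
Proof.
elim: k S => [|k IHk] S Sdecr Sbr S0.
  by apply: commuting_stable_line => x y /S0 -> /S0 ->.
have [w [w0 wS1]] := IHk (fun i => S i.+1) (fun i => Sdecr i.+1) (fun i => Sbr i.+1) S0.
have [wS0|not_wS0] := classic (forall x, S 0%N x -> (w *m x <= w)%MS).
  by exists w; split.
have [x Sx wx] : exists2 x, S 0%N x & ~~ (w *m x <= w)%MS.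
  apply: NNPP => no; apply: not_wS0 => x Sx; apply: contraT => wx.
  by case: no; exists x.
have eig y : S 1%N y -> exists a, w *m y = a *: w by move/wS1 => /sub_rVP.
have tr_comm (y z : 'M[C]_2) : \tr (y *m z - z *m y) = 0.
  by rewrite linearB /= [X in _ - X]mxtrace_mulC subrr.
have two_neq0 a : a *+ 2 = 0 -> a = 0.
  by move/eqP; rewrite -mulr_natr mulf_eq0 Num.Theory.pnatr_eq0 orbF => /eqP.
have scalar_S1 y : S 1%N y -> exists a, y = a%:M.
  move=> Sy; have [a wy] := eig _ Sy.
  have [z Ez] : exists z, z = x *m y - y *m x by eexists.
  have Sz : S 1%N z by rewrite Ez; apply: Sbr => //; apply: Sdecr.
  have [b wz] := eig _ Sz.
  have [c wxz] := eig _ (Sbr _ _ _ Sx (Sdecr _ _ Sz)).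
  have b0 : b = 0.
    apply: two_neq0; rewrite -(tr_comm x y) -Ez.
    apply/esym/(frame_trace (b := c) w0 wx wz).
    rewrite -wxz mulmxBr !mulmxA wz -scalemxAl.
    by rewrite addrNK.
  exists a; apply: (frame_scalar w0 wx wy).
  have -> : w *m x *m y = w *m z + w *m y *m x.
    by rewrite Ez mulmxBr !mulmxA addrNK.
  by rewrite wz b0 scale0r add0r wy scalemxAl.
apply: commuting_stable_line => y z Sy Sz; apply/eqP; rewrite -subr_eq0; apply/eqP.
have [a Ea] := scalar_S1 _ (Sbr _ _ _ Sy Sz).
rewrite Ea (_ : a = 0) ?raddf0 //.
by apply: two_neq0; rewrite -(mxtrace_scalar 2 a) -Ea tr_comm.
Qed.

End LieTheorem2.

(** * Operators of degree 0 as matrices *)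

Section LinearForms.
Variables (F : fieldType) (n : nat).
Local Notation L := (grassmann F n).
Implicit Types (c : 'I_n -> F) (i j : 'I_n) (X Y : 'End(L)) (f : L).

Lemma linform_coef c j : linform c [set j] = c j.
Proof.
rewrite sum_ffunE (bigD1 j) //= big1 => [|k kj].
  by rewrite gcoefZ ffunE eqxx mulr1 addr0.
by rewrite gcoefZ ffunE (inj_eq set1_inj) eq_sym (negPf kj) mulr0.
Qed.

Lemma homog_linform f : homog 1 f -> f = linform (fun j => f [set j]).
Proof.
move=> f1; apply/ffunP => A; have [/cards1P[j ->]|nA] := boolP (#|A| == 1%N).
  by rewrite linform_coef.
rewrite f1 // sum_ffunE big1 // => k _; rewrite gcoefZ ffunE.
case: eqP => [E|_]; last by rewrite mulr0.
by rewrite E cards1 eqxx in nA.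
Qed.

Lemma substitutes_linform (M : 'M[F]_n) (phi : 'End(L)) (w : 'rV[F]_n) :
  substitutes M phi -> phi (linform (w 0)) = linform ((w *m M) 0).
Proof.
move=> phiP; rewrite /linform linear_sum /=.
under eq_bigr => i _ do rewrite linearZ /= (substitutes_gen _ phiP) scaler_sumr.
rewrite exchange_big; apply: eq_bigr => k _ /=.
by rewrite mxE scaler_suml; apply: eq_bigr => j _; rewrite scalerA.
Qed.

(** The matrix acts on rows of coefficients, hence reverses composition. *)
Definition degree0_mx X : 'M[F]_n := \matrix_(i, j) X (gen F i) [set j].

Lemma degree0_mxE X (w : 'rV[F]_n) : (forall i, homog 1 (X (gen F i))) ->
  X (linform (w 0)) = linform ((w *m degree0_mx X) 0).
Proof.
move=> X1; rewrite /linform linear_sum /=.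
under eq_bigr => i _ do rewrite linearZ /= (homog_linform (X1 i)) scaler_sumr.
rewrite exchange_big; apply: eq_bigr => k _ /=.
by rewrite mxE scaler_suml; apply: eq_bigr => j _; rewrite scalerA mxE.
Qed.

Lemma degree0_mx_comp X Y :
  (forall i, homog 1 (X (gen F i))) -> (forall i, homog 1 (Y (gen F i))) ->
  degree0_mx (X \o Y)%VF = degree0_mx Y *m degree0_mx X.
Proof.
move=> X1 Y1; apply/matrixP => i j; rewrite mxE comp_lfunE.
rewrite (homog_linform (Y1 i)).
pose w : 'rV[F]_n := \row_k Y (gen F i) [set k].
have -> : linform (fun k => Y (gen F i) [set k]) = linform (w 0).
  by apply: eq_bigr => k _; rewrite mxE.
rewrite degree0_mxE // linform_coef !mxE; apply: eq_bigr => k _.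
by rewrite !mxE.
Qed.

Lemma degree0_mxD X Y u : degree0_mx (X + u *: Y) = degree0_mx X + u *: degree0_mx Y.
Proof. by apply/matrixP => i j; rewrite !mxE add_lfunE scale_lfunE !gcoefE. Qed.

Lemma homog0_gone f : homog 0 f -> f = f set0 *: gone F n.
Proof.
move=> f0; apply/ffunP => A; rewrite gcoefZ ffunE.
by have [->|A0] := eqVneq A set0; rewrite ?mulr1 // mulr0 f0 // cards_eq0.
Qed.

Lemma graded_subv (gr : int -> {vspace 'End(L)}) (s t : {vspace 'End(L)}) :
  graded gr s ->
  (forall k X, k \in degrees -> X \in s -> X \in gr k -> X \in t) -> (s <= t)%VS.
Proof.
case=> Es _ st; rewrite Es big_seq; elim/big_ind: _ => [|U W Ut Wt|k kd].
- exact: sub0v.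
- by rewrite subv_add Ut.
by apply/subvP => X; rewrite memv_cap => /andP[Xs Xk]; apply: (st k).
Qed.

End LinearForms.

(** * Maximal graded solvable subsuperalgebras of vect(0|2) *)

Section VectGrading.
Variable F : fieldType.
Local Notation L := (grassmann F 2).
Local Notation gl := 'End(L).
Implicit Types (X Y : gl) (i j : 'I_2) (phi : gl).

(** An element of vect(0|2) of degree [d - 1] is described by its values on the
    generators, to which the conditions on coefficients refer. *)
Definition vect_homog (d : nat) X :=
  X = \sum_i vfield (X (gen F i)) i /\ forall i, homog d (X (gen F i)).

Lemma vect_homogP d X : X \in vect_deg F 2 (d%:Z - 1) -> vect_homog d X.
Proof.
rewrite vect_degE => /span_map_mem[|c ->]; first exact: filter_uniq.
rewrite big_seq; elim/big_rec: _ => [|[a i] X' jd [EX' X'd]].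
  split=> [|i]; last by rewrite zero_lfunE; apply: homog0.
  by rewrite big1 // => i _; rewrite zero_lfunE vfield0.
have ad : bits_card 2 a = d.
  by move: jd; rewrite mem_filter => /andP[/eqP /addIr[]].
have card_a : #|bitset 2 a| = d by rewrite card_bitset.
split=> [|k]; last first.
  rewrite add_lfunE scale_lfunE vfield_gen; apply: homogD => //.
  by apply: homogZ; apply: homogZ; rewrite -card_a; apply: homog_mono.
have := EX'; move: (X') => X2 {1}->.
rewrite (bigD1 i) //= [in RHS](bigD1 i) //= addrA.
congr (_ + _).
  by rewrite add_lfunE scale_lfunE vfieldD vfieldZ vfield_gen eqxx scale1r.
apply: eq_bigr => k ki; rewrite add_lfunE scale_lfunE vfield_gen (negPf ki).
by rewrite scale0r scaler0 add0r.
Qed.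

Lemma vect_homog_span d X (P : seq (bitseq * 'I_2)) : vect_homog d X ->
  (forall i, {in all_bits 2, forall a, X (gen F i) (bitset 2 a) != 0 -> (a, i) \in P}) ->
  X \in <<map (vect_field F) P>>%VS.
Proof.
case=> EX _ XP; rewrite EX; apply: memv_suml => i _; rewrite [X (gen F i)]grassmannE vfield_sum.
apply: memv_suml => A _; rewrite vfieldZ.
have [a a2 EA] := bitset_surj A.
have [XA0|XA] := eqVneq (X (gen F i) A) 0; first by rewrite XA0 scale0r mem0v.
apply/memvZ/memv_span/mapP; exists (a, i); last by rewrite EA.
by rewrite EA in XA; exact: (XP i a a2 XA).
Qed.

Lemma vect_homog_opar d X : vect_homog d X -> opar (~~ odd d) X.
Proof.
case=> EX Xd c f; rewrite EX !sum_lfunE linear_sum; apply: eq_bigr => i _.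
exact: (opar_vfield i (homog_gpar (Xd i))).
Qed.

(** The coordinate fields transform by the inverse matrix. *)
Lemma conj_vfield (M : 'M[F]_2) phi f k : linear_change phi -> M \in unitmx ->
  substitutes M phi ->
  conj_end phi (vfield f k) = \sum_j invmx M j k *: vfield (phi f) j.
Proof.
move=> phi_lc uM phiP; apply/lfunP => h; rewrite -(linear_changeVK phi_lc h).
move: (_ h) => {}h; rewrite conjE // vfieldE (substitutes_gmul _ _ phiP) sum_lfunE.
under [RHS]eq_bigr => j _ do
  rewrite scale_lfunE vfieldE -gmulZr (gder_substitutes _ _ phiP) scaler_sumr.
rewrite -gmul_sumr exchange_big /=; congr (_ ** _).
under [RHS]eq_bigr => i _ do
  (under eq_bigr => j _ do rewrite scalerA mulrC; rewrite -scaler_suml).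
have ME i : \sum_j M i j * invmx M j k = (i == k)%:R.
  by have /matrixP/(_ i k) := mulmxV uM; rewrite !mxE.
under [RHS]eq_bigr => i _ do rewrite ME.
rewrite (bigD1 k) //= big1 => [|i ik]; first by rewrite eqxx scale1r addr0.
by rewrite (negPf ik) scale0r.
Qed.

Lemma vfield_vect_deg (d : nat) f i : homog d f -> vfield f i \in vect_deg F 2 (d%:Z - 1).
Proof.
move=> /homogE ->; rewrite vfield_sum; apply: memv_suml => A /eqP dA.
rewrite vfieldZ memvZ // memv_span //; apply/allpairsP; exists (A, i).
split=> //=; last by rewrite mem_enum.
by rewrite mem_filter mem_enum dA eqxx.
Qed.

Lemma vfield_vect f i : vfield f i \in vect F 2.
Proof.
rewrite [f]grassmannE vfield_sum; apply: memv_suml => A _.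
rewrite vfieldZ memvZ // memv_span //; apply/allpairsP; exists (A, i).
by split; rewrite ?mem_enum.
Qed.

Lemma conjs_vect phi : linear_change phi -> conjs phi (vect F 2) = vect F 2.
Proof.
move=> phi_lc; have [M uM phiP] := (substitutesP phi).1 phi_lc.
apply/eqP; rewrite eqEdim (dim_conjs phi_lc) leqnn andbT.
rewrite /conjs limg_span; apply/span_subvP => _ /mapP[_ /allpairsP[[A i] [_ _ ->]] ->].
rewrite lfunE /= (conj_vfield _ _ phi_lc uM phiP).
by apply: memv_suml => j _; rewrite memvZ // vfield_vect.
Qed.

Lemma conjs_vect_deg phi : linear_change phi ->
  forall k, k \in degrees -> conjs phi (vect_deg F 2 k) = vect_deg F 2 k.
Proof.
move=> phi_lc k _; have [M uM phiP] := (substitutesP phi).1 phi_lc.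
apply/eqP; rewrite eqEdim (dim_conjs phi_lc) leqnn andbT.
rewrite /conjs limg_span; apply/span_subvP => _ /mapP[_ /allpairsP[[A i] [/= Ak _ ->]] ->].
rewrite lfunE /= (conj_vfield _ _ phi_lc uM phiP).
apply: memv_suml => j _; rewrite memvZ //.
move: Ak; rewrite mem_filter => /andP[/eqP <- _].
by apply/vfield_vect_deg/(substitutes_homog phiP)/homog_mono.
Qed.

Lemma vect_bracket_deg k l X Y : k \in degrees -> l \in degrees ->
  X \in vect_deg F 2 k -> Y \in vect_deg F 2 l -> sbracket X Y \in vect_deg F 2 (k + l).
Proof.
move=> kd ld; rewrite !vect_degE; apply: (closes_sbracket (D := vect_labels) (br := vect_table)).
- by move=> a b _ _; apply: vect_field_bracket.
- exact: filter_uniq.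
- exact: filter_uniq.
- by move=> a; rewrite mem_filter => /andP[].
- by move=> a; rewrite mem_filter => /andP[].
have /allP/(_ k kd)/allP/(_ l ld) : all (fun k => all (fun l => closes vect_table
    [seq j <- vect_labels | vect_label_deg j == k]
    [seq j <- vect_labels | vect_label_deg j == l]
    [seq j <- vect_labels | vect_label_deg j == k + l]) degrees) degrees.
  by vm_compute.
by [].
Qed.

End VectGrading.

Section VectClassification.
Variable C : numClosedFieldType.
Local Notation L := (grassmann C 2).
Local Notation gl := 'End(L).
Local Notation x1 := (gen C (ord0 : 'I_2)).
Local Notation x2 := (gen C (ord_max : 'I_2)).
Local Notation gs := (graded_solvable (vect C 2) (@vect_deg C 2)).
Implicit Types (X Y : gl) (s : {vspace gl}).

Lemma vect_deg0P X : X \in vect_deg C 2 0 -> vect_homog 1 X.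
Proof. exact: (@vect_homogP _ 1%N). Qed.

Lemma vect_stable_line s : gs s ->
  exists w, stable_line (fun x => exists2 X, X \in s & X \in vect_deg C 2 0 /\ x = degree0_mx X) w.
Proof.
case=> s_sub _ [k sk].
pose S i x := exists2 X, X \in iter i (@derived C 2) s &
  X \in vect_deg C 2 0 /\ x = degree0_mx X.
apply: (@lie_theorem2 C k S) => [i x [X Xi XP]|i x y|x [X Xk [_ ->]]].
- by exists X => //; apply: (subvP (iter_derived_decr i s_sub)).
- move=> [X Xi [X0 ->]] [Y Yi [Y0 ->]]; exists (sbracket Y X).
    exact: mem_derived.
  split; first exact: (vect_bracket_deg (k := 0) (l := 0)).
  have [[_ X1] [_ Y1]] := (vect_deg0P X0, vect_deg0P Y0).
  rewrite (sbracket_opar (vect_homog_opar (vect_deg0P Y0)) (vect_homog_opar (vect_deg0P X0))).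
  by rewrite -scaleNr degree0_mxD !degree0_mx_comp // expr0 scaleN1r.
move: Xk; rewrite sk memv0 => /eqP ->.
by apply/matrixP => i j; rewrite !mxE zero_lfunE gcoef0.
Qed.

(** The line is completed to a basis in which it comes last. *)
Lemma vect_normalize (w : 'rV[C]_2) : w != 0 ->
  exists2 phi, linear_change phi & phi (linform (w 0)) = x2.
Proof.
move=> w0; have [u u0 wu] : exists2 u : 'rV[C]_2, u != 0 & ~~ (w <= u)%MS.
  have delta_neq0 i : delta_mx 0 i != 0 :> 'rV[C]_2.
    by apply/eqP => /matrixP/(_ 0 i)/eqP; rewrite !mxE !eqxx oner_eq0.
  have [w_max|w_max] := eqVneq (w 0 ord_max) 0; last first.
    exists (delta_mx 0 ord0) => //; apply: contraNN w_max => /sub_rVP[a ->].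
    by rewrite !mxE mulr0.
  exists (delta_mx 0 ord_max) => //; apply: contraNN w0 => /sub_rVP[a Ew].
  apply/eqP/rowP => i; rewrite mxE; have [->//|/negPf ni] := eqVneq i ord_max.
  by rewrite Ew !mxE ni andbF mulr0.
have uP := frame_unit u0 wu; set P := col_mx u w in uP.
have [phi phiP] := substitutes_exists (invmx P).
exists phi; first by apply/substitutesP; exists (invmx P); rewrite ?unitmx_inv.
rewrite (substitutes_linform _ phiP).
have : P *m invmx P = 1%:M by apply: mulmxV.
rewrite mul_col_mx => /(congr1 dsubmx); rewrite col_mxKd => ->.
rewrite /linform (bigD1 ord_max) //= big1 => [|j jm].
  by rewrite !mxE addr0 scale1r.
rewrite !mxE (_ : (rshift 1 0 == j) = false) ?scale0r //.
by apply: contraNF jm => /eqP <-; apply/eqP/val_inj.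
Qed.

Definition vect_models : seq {vspace gl} :=
  [seq <<map (vect_field C) P>>%VS | P <- vect_model_labels].

Let vect_gr k (_ : k \in degrees) := vect_degE C k.

Lemma vect_models_gs c : c \in vect_models -> gs c.
Proof.
rewrite vectE; apply: (span_models_gs vect_labels_uniq (vect_field_free C)
  (fun a b _ _ => vect_field_bracket C a b) (@vect_field_parity C) vect_label_degP vect_gr).
exact: vect_model_tables.
Qed.

Lemma vect_models_dim : {in vect_models &, forall c c',
  (forall k, k \in degrees ->
     \dim (c :&: vect_deg C 2 k) <= \dim (c' :&: vect_deg C 2 k))%N -> c = c'}.
Proof.
apply: (span_models_dim vect_labels_uniq (vect_field_free C) vect_gr).
  exact: vect_model_tables.
exact: vect_model_incomparable.
Qed.

(** In coordinates where the stable line is spanned by the last generator, the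
    degree 0 part is triangular. Its brackets with the degree -1 and 1 parts
    then force one of the two latter to preserve that line as well. *)
Lemma vect_cover s : gs s ->
  exists phi c, [/\ linear_change phi, c \in vect_models & (conjs phi s <= c)%VS].
Proof.
move=> s_gs; have [[_ _ s_br] s_gr _] := s_gs.
have [w [w0 w_stable]] := vect_stable_line s_gs.
have [phi phi_lc phiw] := vect_normalize w0.
have degP (d : nat) X : (d%:Z - 1) \in degrees -> X \in vect_deg C 2 (d%:Z - 1) ->
    vect_homog d (conj_end phi X).
  move=> dd Xd; apply: vect_homogP; rewrite -(conjs_vect_deg phi_lc dd).
  by rewrite mem_conjs.
have s0_tri X : X \in s -> X \in vect_deg C 2 0 -> conj_end phi X x2 [set ord0] = 0.
  move=> Xs X0; have /sub_rVP[a wa] : (w *m degree0_mx X <= w)%MS.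
    by apply: w_stable; exists X.
  rewrite -phiw conjE // degree0_mxE; last by case: (vect_deg0P X0).
  rewrite wa; have -> : linform ((a *: w) 0) = a *: linform (w 0) :> L.
    by rewrite /linform scaler_sumr; apply: eq_bigr => j _; rewrite mxE scalerA.
  by rewrite linearZ /= phiw gcoefZ ffunE (inj_eq set1_inj) mulr0.
have key X Y : X \in s -> X \in vect_deg C 2 (-1) -> Y \in s -> Y \in vect_deg C 2 1 ->
    conj_end phi X x2 set0 * conj_end phi Y x2 [set: 'I_2] = 0.
  (* The product is minus the coefficient of xi1 in [X, Y] xi2, which vanishes
     by triangularity: X sends xi1 xi2 to X(xi1) xi2 - X(xi2) xi1, and Y
     annihilates the constant X(xi2). *)
  move=> Xs X1 Ys Y1.
  have := s0_tri _ (s_br _ _ Xs Ys) (vect_bracket_deg (k := -1) (l := 1) isT isT X1 Y1).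
  have X'P := degP 0%N X isT X1; have Y'P := degP 2%N Y isT Y1.
  rewrite -(sbracket_conj phi_lc); move: X'P Y'P.
  move: (conj_end phi X) (conj_end phi Y) => {X Y Xs X1 Ys Y1} X Y XP YP.
  rewrite (sbracket_opar (vect_homog_opar XP) (vect_homog_opar YP)) commutator_lfunE.
  have [[EX X0] [EY _]] := (XP, YP).
  have -> : Y (X x2) = 0.
    rewrite (homog0_gone (X0 ord_max)) linearZ /= EY sum_lfunE big1 ?scaler0 // => i _.
    by rewrite vfieldE gder_mono inE gmul0r.
  rewrite scaler0 subr0 {1}EX sum_lfunE big_ord_recl big_ord1.
  rewrite !vfieldE (homog0_gone (X0 _)) (homog0_gone (X0 (lift _ _))) !gmulZl !gmul1l.
  have -> : lift ord0 ord0 = ord_max :> 'I_2 by apply: val_inj.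
  rewrite !gcoefE !gderE !inE eqxx mulr0 add0r /= => /eqP.
  rewrite !mulf_eq0 signr_eq0 /= => XY0.
  have -> : [set: 'I_2] = [set ord_max; ord0].
    by apply/setP => i; rewrite !inE -!val_eqE /=; case: i => -[|[|]].
  by case/orP: XY0 => /eqP ->; rewrite ?mulr0 ?mul0r.
have sub_model (P : seq (bitseq * 'I_2)) :
    (forall (d : nat) X i, (d%:Z - 1) \in degrees -> X \in s ->
       X \in vect_deg C 2 (d%:Z - 1) ->
       {in all_bits 2, forall a, bits_card 2 a = d ->
          conj_end phi X (gen C i) (bitset 2 a) != 0 -> (a, i) \in P}) ->
    (conjs phi s <= <<map (vect_field C) P>>)%VS.
  move=> sP; have [t Et] := conjs_surj phi_lc <<map (vect_field C) P>>%VS.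
  rewrite Et (conjsS phi_lc); apply: (graded_subv s_gr) => k X kd Xs Xk.
  rewrite -(mem_conjs phi_lc) -Et.
  have [d Ed] : exists d : nat, k = d%:Z - 1.
    by move: kd; rewrite !inE => /or3P[] /eqP ->; [exists 0%N | exists 1%N | exists 2%N].
  rewrite Ed in kd Xk; have XP := degP d X kd Xk.
  apply: (vect_homog_span XP) => i a a2 Xa; apply: (sP d X i kd Xs Xk a a2) => //.
  apply/eqP; apply: contraNT Xa => ad; case: XP => _ /(_ i) ->//.
  by rewrite card_bitset.
have ord2 (i : 'I_2) : i = ord0 \/ i = ord_max.
  by case: i => -[|[|//]] h; [left | right]; apply: val_inj.
have set10 : bitset 2 [:: true; false] = [set ord0].
  by apply/setP => i; rewrite !inE; case: (ord2 i) => ->.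
have set00 : bitset 2 [:: false; false] = set0.
  by apply/setP => i; rewrite !inE; case: (ord2 i) => ->.
have set11 : bitset 2 [:: true; true] = setT.
  by apply/setP => i; rewrite !inE; case: (ord2 i) => ->.
have [[X Xs [X1 Xn0]]|no_X] := classic (exists2 X, X \in s &
    X \in vect_deg C 2 (-1) /\ conj_end phi X x2 set0 != 0).
  exists phi, <<map (vect_field C) vect_msc_labels>>%VS.
  split=> //; first by rewrite !inE eqxx orbT.
  apply: sub_model => d Y i _ Ys Yd a; rewrite !inE => a2 ad.
  case/or4P: a2 ad Yd => /eqP -> <- Yd; case: (ord2 i) => -> //.
    by rewrite set10 s0_tri ?eqxx.
  by have /eqP := key X Y Xs X1 Ys Yd; rewrite mulf_eq0 (negPf Xn0) set11 /= => ->.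
exists phi, <<map (vect_field C) vect_msV_labels>>%VS.
split=> //; first by rewrite !inE eqxx.
apply: sub_model => d Y i _ Ys Yd a; rewrite !inE => a2 ad.
case/or4P: a2 ad Yd => /eqP -> <- Yd; case: (ord2 i) => -> //.
  by rewrite set00 => Yn0; case: no_X; exists Y.
by rewrite set10 s0_tri ?eqxx.
Qed.

Theorem vect_classification :
  (forall s, max_graded_solvable (vect C 2) (@vect_deg C 2) s <->
     lin_equiv s (vect_msV C) \/ lin_equiv s (vect_msc C))
  /\ ~ lin_equiv (vect_msV C) (vect_msc C).
Proof.
have lc_id (phi : gl) : linear_change phi -> linear_change phi by [].
have conj_g phi : linear_change phi -> conjs phi (vect C 2) = vect C 2.
  exact: conjs_vect.
have conj_gr phi : linear_change phi ->
  forall k, k \in degrees -> conjs phi (vect_deg C 2 k) = vect_deg C 2 k.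
  exact: conjs_vect_deg.
rewrite vect_msVE vect_mscE; split=> [s|[phi phi_lc carry]].
  apply: iff_trans
    (max_iff_model lc_id conj_g conj_gr vect_models_gs vect_models_dim vect_cover s) _.
  split=> [[phi [c [phi_lc]]]|].
    by rewrite !inE => /orP[] /eqP -> carry; [left | right]; exists phi.
  by case=> -[phi phi_lc carry]; exists phi; eexists; split; try exact: carry;
     rewrite // !inE eqxx ?orbT.
have E := models_inequivalent lc_id conj_gr vect_models_dim phi_lc _ _ carry.
have {}E : <<map (vect_field C) vect_msV_labels>>%VS = <<map (vect_field C) vect_msc_labels>>%VS.
  by apply: E; rewrite !inE eqxx ?orbT.
by have := span_degree_count vect_labels_uniq (vect_field_free C) vect_gr
  (P := vect_msV_labels) (Q := vect_msc_labels) vect_model_tables isT isT E (d := 1) isT.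
Qed.

End VectClassification.

(** * Linear canonical changes of the indeterminates *)

Section CanonicalChanges.
Variables (F : fieldType) (m : nat).
Local Notation L := (grassmann F (m + m)).
Local Notation gl := 'End(L).
Implicit Types (f g : L) (phi psi : gl) (M : 'M[F]_(m + m)) (s : {vspace gl}).

Definition canonical_change phi : Prop :=
  linear_change phi /\ forall f g, phi (poisson f g) = poisson (phi f) (phi g).

(** By the chain rule it is enough that the substitution preserves the values
    of the bracket on the generators, that is, a symmetric bilinear form. *)
Lemma substitutes_poisson M phi f g : substitutes M phi ->
  (forall i j, \sum_k M i k * M j (dual k) = (j == dual i)%:R) ->
  phi (poisson f g) = poisson (phi f) (phi g).
Proof.
move=> phiP M_orth; rewrite !poissonE linear_sum /= (substitutes_gtwist _ phiP).
under [RHS]eq_bigr => k _ do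
  rewrite !(gder_substitutes _ _ phiP) gmul_suml.
under [RHS]eq_bigr => k _ do
  (under eq_bigr => i _ do (rewrite gmul_sumr;
     under eq_bigr => j _ do rewrite gmulZl gmulZr -(substitutes_gmul _ _ phiP) scalerA)).
rewrite exchange_big; apply: eq_bigr => i _ /=.
rewrite exchange_big (bigD1 (dual i)) //= [X in _ + X]big1 => [|j ji].
  by rewrite -scaler_suml M_orth eqxx scale1r addr0.
by rewrite -scaler_suml M_orth (negPf ji) scale0r.
Qed.

Lemma orthogonal_unitmx M :
  (forall i j, \sum_k M i k * M j (dual k) = (j == dual i)%:R) -> M \in unitmx.
Proof.
move=> M_orth; have : M *m (\matrix_(k, j) M (dual j) (dual k)) = 1%:M.
  apply/matrixP => i j; rewrite !mxE.
  under eq_bigr => k _ do rewrite mxE.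
  by rewrite M_orth (inj_eq (inv_inj (@dualK m))) eq_sym.
by case/mulmx1_unit.
Qed.

Lemma conj_hfield phi f : canonical_change phi -> conj_end phi (hfield f) = hfield (phi f).
Proof.
case=> phi_lc phi_poisson; apply/lfunP => g; rewrite -(linear_changeVK phi_lc g).
by rewrite conjE // !hfieldE phi_poisson.
Qed.

Lemma canonical_id : canonical_change \1%VF.
Proof.
split; last by move=> f g; rewrite !id_lfunE.
by apply/substitutesP; exists 1%:M; rewrite ?unitmx1 //; apply: substitutes_id.
Qed.

Lemma canonical_comp phi psi : canonical_change phi -> canonical_change psi ->
  canonical_change (psi \o phi)%VF.
Proof.
move=> [/substitutesP[M uM phiP] phi_br] [/substitutesP[N uN psiP] psi_br].
split; last by move=> f g; rewrite !comp_lfunE phi_br psi_br.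
apply/substitutesP; exists (M *m N); first by rewrite unitmx_mul uM.
exact: substitutes_comp.
Qed.

Lemma conjs_id s : conjs \1%VF s = s.
Proof.
have id_lc := canonical_id.1; apply/vspaceP => X.
have E : conj_end \1%VF X = X.
  by apply/lfunP => f; have := conjE id_lc X f; rewrite !id_lfunE => ->.
by rewrite -{1}E mem_conjs.
Qed.

Lemma conjs_comp phi psi s : linear_change phi -> linear_change psi ->
  linear_change (psi \o phi)%VF -> conjs (psi \o phi)%VF s = conjs psi (conjs phi s).
Proof.
move=> phi_lc psi_lc comp_lc; apply/vspaceP => X.
have [Y ->] := conj_surj comp_lc X; rewrite mem_conjs //.
have -> : conj_end (psi \o phi)%VF Y = conj_end psi (conj_end phi Y).
  apply/lfunP => f; rewrite -(linear_changeVK comp_lc f); move: (_ f) => {}f.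
  rewrite (conjE comp_lc) [(psi \o phi)%VF f]comp_lfunE (conjE psi_lc) (conjE phi_lc).
  by rewrite comp_lfunE.
by rewrite !mem_conjs.
Qed.

(** The classification is carried out on generating functions, on which
    canonical changes act by substitution. *)
Definition section_of s d f := homog d f /\ hfield f \in s.

Lemma section_conjs phi s d f : canonical_change phi ->
  section_of (conjs phi s) d (phi f) <-> section_of s d f.
Proof.
move=> phi_can; have phi_lc := phi_can.1.
rewrite /section_of -(conj_hfield f phi_can) mem_conjs //.
have [M _ phiP] := (substitutesP phi).1 phi_lc.
have [N _ psiP] := (substitutesP _).1 (linear_changeV phi_lc).
split=> -[fd fs]; split=> //; last exact: (substitutes_homog phiP).
by rewrite -[f](linear_changeK phi_lc); apply: (substitutes_homog psiP).
Qed.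

Lemma section_conjs_ex phi s d f : canonical_change phi ->
  section_of (conjs phi s) d f -> exists2 g, f = phi g & section_of s d g.
Proof.
move=> phi_can; have phi_lc := phi_can.1.
rewrite -{1}(linear_changeVK phi_lc f) section_conjs // => fs.
by exists ((phi^-1)%VF f); rewrite ?linear_changeVK.
Qed.

End CanonicalChanges.

Section Coordinates4.
Variable F : fieldType.
Local Notation L := (grassmann F (2 + 2)).
Implicit Types (f g : L) (i j : 'I_(2 + 2)).

Definition xi1 : 'I_(2 + 2) := ixi ord0.
Definition xi2 : 'I_(2 + 2) := ixi ord_max.
Definition eta1 : 'I_(2 + 2) := ieta ord0.
Definition eta2 : 'I_(2 + 2) := ieta ord_max.

Lemma ord4 i : [\/ i = xi1, i = xi2, i = eta1 | i = eta2].
Proof.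
by case: i => -[|[|[|[|//]]]] h; [constructor 1 | constructor 2 | constructor 3
  | constructor 4]; apply: val_inj.
Qed.

Lemma dual_xi1 : dual xi1 = eta1. Proof. exact: dual_lshift. Qed.
Lemma dual_xi2 : dual xi2 = eta2. Proof. exact: dual_lshift. Qed.
Lemma dual_eta1 : dual eta1 = xi1. Proof. exact: dual_rshift. Qed.
Lemma dual_eta2 : dual eta2 = xi2. Proof. exact: dual_rshift. Qed.
Definition dual4 := (dual_xi1, dual_xi2, dual_eta1, dual_eta2).

Lemma sum4 (V : nmodType) (G : 'I_(2 + 2) -> V) :
  \sum_i G i = G xi1 + G xi2 + G eta1 + G eta2.
Proof.
rewrite !big_ord_recl big_ord0 addr0 !addrA.
by congr (G _ + G _ + G _ + G _); apply: val_inj.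
Qed.

Definition coef f a := f (bitset (2 + 2) a).

Lemma set1_bits i : [set i] = bitset (2 + 2) (bits 4 (pred1 (val i))).
Proof. exact: bitset1. Qed.

Lemma gder_coef i f a : coef (gder i f) a =
  if mem_bits a i then 0 else
  (-1) ^+ bits_before 4 i a * coef f (bits 4 (fun j : nat => (j == i :> nat) || mem_bits a j)).
Proof.
rewrite /coef gderE in_bitset before_bitset; case: ifP => // _; congr (_ * f _).
by apply/setP => j; rewrite !inE mem_bitsE.
Qed.

End Coordinates4.

(** * Degree 0: so(4) as a sum of two copies of sl(2) *)

Section SpinMatrices.
Variable F : fieldType.
Hypothesis two_neq0 : (2 : F) != 0.
Local Notation L := (grassmann F (2 + 2)).
Local Notation o := false (only parsing).
Local Notation i := true (only parsing).
Implicit Types (f g h : L) (m : 'M[F]_2).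

Local Notation q01 f := (coef f [:: i; i; o; o]).
Local Notation q02 f := (coef f [:: i; o; i; o]).
Local Notation q03 f := (coef f [:: i; o; o; i]).
Local Notation q12 f := (coef f [:: o; i; i; o]).
Local Notation q13 f := (coef f [:: o; i; o; i]).
Local Notation q23 f := (coef f [:: o; o; i; i]).

(** The action of a quadratic generating function on xi1, xi2, eta1, eta2. *)
Definition so4_rows f : seq (seq F) :=
  [:: [:: - q02 f; - q12 f;     0;   q23 f];
      [:: - q03 f; - q13 f; - q23 f;     0];
      [::     0;     q01 f;   q02 f; q03 f];
      [:: - q01 f;     0;     q12 f; q13 f]].

Lemma hfield_mx f : homog 2 f ->
  degree0_mx (hfield f) = \matrix_(a, b) nth 0 (nth [::] (so4_rows f) a) b.
Proof.
move=> f2; apply/matrixP => a b; rewrite !mxE hfield_gen.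
rewrite (gtwist_gpar (homog_gpar f2)) expr0 scale1r set1_bits -/(coef _ _).
by case: (ord4 a) => ->; case: (ord4 b) => ->; rewrite dual4 gder_coef /= ?expr0 ?expr1 ?mul1r ?mulN1r.
Qed.

Definition mx2 (a b c d : F) : 'M[F]_2 :=
  \matrix_(k, l) if k == 0 then (if l == 0 then a else b) else (if l == 0 then c else d).

Lemma sum2 (V : nmodType) (G : 'I_2 -> V) : \sum_k G k = G 0 + G 1.
Proof.
by rewrite big_ord_recl big_ord1; congr (G _ + G _); apply: val_inj.
Qed.

Lemma mx2P m m' : m 0 0 = m' 0 0 -> m 0 1 = m' 0 1 -> m 1 0 = m' 1 0 ->
  m 1 1 = m' 1 1 -> m = m'.
Proof.
move=> E00 E01 E10 E11; apply/matrixP => k l.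
have ord2 (k0 : 'I_2) : k0 = 0 \/ k0 = 1.
  by case: k0 => -[|[|//]] ltk; [left | right]; apply: val_inj.
by case: (ord2 k) => ->; case: (ord2 l) => ->.
Qed.

Definition mx2E := (mxE, sum2, eqxx, oner_eq0).

(** The generators are arranged in a matrix so that the quadratic form of the
    Poisson bracket, xi1 eta1 + xi2 eta2 in coordinates, is the determinant. *)
Definition spin m : 'rV[F]_(2 + 2) :=
  \row_k nth 0 [:: m 0 0; m 0 1; m 1 1; - m 1 0] k.

(** These are the projections of so(4) to its two ideals sl(2), acting on
    matrices by multiplication on the left and on the right. *)
Definition spin_left f : 'M[F]_2 :=
  mx2 (- (q02 f + q13 f) / 2) (q01 f) (- q23 f) ((q02 f + q13 f) / 2).
Definition spin_right f : 'M[F]_2 :=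
  mx2 (- (q02 f - q13 f) / 2) (- q12 f) (- q03 f) ((q02 f - q13 f) / 2).

Lemma spin_action f m : homog 2 f ->
  spin m *m degree0_mx (hfield f) = spin (spin_left f *m m + m *m spin_right f).
Proof.
move=> f2; rewrite (hfield_mx f2); apply/rowP => k; rewrite mxE sum4 !mxE.
by case: (ord4 k) => ->; rewrite /= !mx2E /=; field.
Qed.

(** Multiplications on the right compose in the opposite order. *)
Lemma spin_bracket f g h : homog 2 f -> homog 2 g -> homog 2 h ->
  degree0_mx (hfield h) = degree0_mx (hfield g) *m degree0_mx (hfield f)
                          - degree0_mx (hfield f) *m degree0_mx (hfield g) ->
  spin_left h = spin_left f *m spin_left g - spin_left g *m spin_left f /\
  spin_right h = spin_right g *m spin_right f - spin_right f *m spin_right g.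
Proof.
move=> f2 g2 h2 /matrixP E.
have entry a b := E a b.
have := (entry xi1 xi1, entry xi1 xi2, entry xi1 eta2, entry xi2 xi1, entry xi2 xi2,
         entry eta1 xi2).
rewrite !hfield_mx // !(mxE, sum4) /=.
rewrite !(mul0r, mulr0, addr0, add0r, oppr0, sub0r, subr0).
case=> -[[[[h02 h12] h23] h03] h13] h01.
have {}h02 := canRL opprK h02; have {}h12 := canRL opprK h12.
have {}h03 := canRL opprK h03; have {}h13 := canRL opprK h13.
by split; apply: mx2P; rewrite !mx2E /= ?h02 ?h12 ?h23 ?h03 ?h13 ?h01; field.
Qed.

Lemma spin_form m m' :
  \sum_k spin m 0 k * spin m' 0 (dual k) =
  m 0 0 * m' 1 1 + m 1 1 * m' 0 0 - m 0 1 * m' 1 0 - m 1 0 * m' 0 1.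
Proof. by rewrite sum4 !dual4 !mxE /=; ring. Qed.

Definition spin_basis (k : 'I_(2 + 2)) : 'M[F]_2 :=
  nth 0 [:: mx2 1 0 0 0; mx2 0 1 0 0; mx2 0 0 0 1; mx2 0 0 (-1) 0] k.

Implicit Types A B : 'M[F]_2.

Definition spin_mx A B : 'M[F]_(2 + 2) :=
  \matrix_(k, l) spin (A *m spin_basis k *m B) 0 l.

Lemma spin_mxE A B m : spin m *m spin_mx A B = spin (A *m m *m B).
Proof.
apply/rowP => l; rewrite mxE sum4 !mxE /=.
by case: (ord4 l) => ->; rewrite /= !mx2E /=; ring.
Qed.

Definition mx2_det A := A 0 0 * A 1 1 - A 0 1 * A 1 0.

(** The form is the polarised determinant, hence multiplicative. *)
Lemma spin_form_mul A B m m' :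
  \sum_k spin (A *m m *m B) 0 k * spin (A *m m' *m B) 0 (dual k) =
  mx2_det A * mx2_det B * \sum_k spin m 0 k * spin m' 0 (dual k).
Proof. by rewrite !spin_form /mx2_det !mx2E /=; ring. Qed.

Lemma spin_mx_orthogonal A B : mx2_det A = 1 -> mx2_det B = 1 ->
  forall k l, \sum_j spin_mx A B k j * spin_mx A B l (dual j) = (l == dual k)%:R.
Proof.
move=> detA detB k l.
have rowE k' l' : spin_mx A B k' l' = spin (A *m spin_basis k' *m B) 0 l' by rewrite mxE.
under eq_bigr => j _ do rewrite !rowE.
rewrite spin_form_mul detA detB !mul1r spin_form.
case: (ord4 k) => ->; case: (ord4 l) => ->;
  by rewrite !dual4 !mxE -val_eqE /= !(mulr0, mul0r, mulr1, mulrN1, subr0, addr0, add0r, oppr0, opprK).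
Qed.

(** A nonzero vector is the first basis vector after a unimodular change: its
    Bezout coefficients make up the first row, and the second row annihilates
    it. *)
Lemma mx2_complete (u : 'rV[F]_2) : u != 0 ->
  exists2 A, mx2_det A = 1 & A *m u^T = delta_mx 0 0.
Proof.
move=> u0; have [s [t st]] : exists s t, s * u 0 0 + t * u 0 1 = 1.
  have [u00|u00] := eqVneq (u 0 0) 0; last by exists (u 0 0)^-1, 0; rewrite mul0r addr0 mulVf.
  have u01 : u 0 1 != 0.
    apply: contraNneq u0 => u01; apply/eqP/rowP => k; rewrite mxE.
    by case: k => -[|[|//]] ltk; [rewrite -[RHS]u00 | rewrite -[RHS]u01];
       congr (u _ _); apply: val_inj.
  by exists 0, (u 0 1)^-1; rewrite mul0r add0r mulVf.
exists (mx2 s t (- u 0 1) (u 0 0)); first by rewrite /mx2_det !mxE /= -[RHS]st; ring.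
apply/colP => k; rewrite !mx2E /=.
by case: k => -[|[|//]] ltk; rewrite -!val_eqE /= ?st //; ring.
Qed.

Definition spin_linform m : L := linform (spin m 0).

(** Rank one matrices are the isotropic vectors; they form one orbit up to
    canonical changes. *)
Lemma isotropic_normalize (u r : 'rV[F]_2) : u != 0 -> r != 0 ->
  exists2 phi, canonical_change phi & phi (spin_linform (u^T *m r)) = gen F xi1.
Proof.
move=> u0 r0; have [A detA Au] := mx2_complete u0; have [B detB Br] := mx2_complete r0.
have detBT : mx2_det B^T = 1.
  by rewrite -detB /mx2_det !mxE; ring.
have orth := spin_mx_orthogonal detA detBT.
have [phi phiP] := substitutes_exists (spin_mx A B^T).
exists phi.
  split; last by move=> f g; apply: (substitutes_poisson _ _ phiP orth).
  by apply/substitutesP; exists (spin_mx A B^T) => //; apply: orthogonal_unitmx orth.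
rewrite (substitutes_linform _ phiP) spin_mxE mulmxA Au -mulmxA.
have -> : r *m B^T = delta_mx 0 0 by apply: trmx_inj; rewrite trmx_mul trmxK Br trmx_delta.
rewrite mul_delta_mx /linform sum4 !mxE /= !oppr0 !scale0r !addr0.
by rewrite scale1r.
Qed.

End SpinMatrices.

(** * Maximal graded solvable subsuperalgebras of h'(0|4) *)

Section HamGrading.
Variable F : fieldType.
Local Notation L := (grassmann F (2 + 2)).
Local Notation gl := 'End(L).
Local Notation labels := (map (@ham_field F)).
Implicit Types (f g : L) (X Y : gl) (phi : gl) (P : seq bitseq).

Lemma hfield_coef_inj f g a : a \in ham_labels -> hfield f = hfield g -> coef f a = coef g a.
Proof. by move=> /bitset_neq0 a0; apply: hfield_inj_coef. Qed.

Lemma hfield_labels f P : {in all_bits 4, forall a, coef f a != 0 -> a \in P} ->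
  hfield f \in <<labels P>>%VS.
Proof.
move=> fP; rewrite [f]grassmannE hfield_sum; apply: memv_suml => A _; rewrite hfieldZ.
have [a a4 EA] := bitset_surj A; rewrite EA.
have [fa0|fa] := eqVneq (f (bitset (2 + 2) a)) 0; first by rewrite fa0 scale0r mem0v.
by apply/memvZ/memv_span/mapP; exists a => //; apply: fP.
Qed.

Lemma homog_coef (d : nat) f a : homog d f -> coef f a != 0 -> bits_card 4 a = d.
Proof.
move=> fd; apply: contraNeq => ad; apply/eqP/fd.
by rewrite card_bitset.
Qed.

Lemma degreesP k : k \in degrees -> exists2 d : nat, (0 < d < 4)%N & k = d%:Z - 2.
Proof.
by rewrite !inE => /or3P[] /eqP ->; [exists 1%N | exists 2%N | exists 3%N].
Qed.

Lemma degree_in_degrees (d : nat) : (0 < d < 4)%N -> d%:Z - 2 \in degrees.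
Proof. by case: d => [|[|[|[|]]]]. Qed.

Lemma hfield_ham'_deg (d : nat) f : (0 < d < 4)%N -> homog d f ->
  hfield f \in ham'_deg F 2 (d%:Z - 2).
Proof.
move=> d4 fd; rewrite ham'_degE ?degree_in_degrees //; apply: hfield_labels => a a4 fa.
have ad := homog_coef fd fa.
by rewrite !mem_filter a4 /ham_label_deg ad eqxx d4.
Qed.

Lemma ham'_deg_hfield (d : nat) X : (0 < d < 4)%N -> X \in ham'_deg F 2 (d%:Z - 2) ->
  exists2 f, homog d f & X = hfield f.
Proof.
move=> d4; rewrite ham'_degE ?degree_in_degrees // => /span_map_mem[|c ->].
  by rewrite !filter_uniq.
set r := filter _ _; exists (\sum_(a <- r) c a *: bmono (2 + 2) F a); last first.
  by rewrite hfield_sum; apply: eq_bigr => a _; rewrite hfieldZ.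
rewrite big_seq; apply: homog_sum => a; rewrite mem_filter => /andP[/eqP /addIr[ad] _].
by apply: homogZ; rewrite -ad -card_bitset; apply: homog_mono.
Qed.

Lemma ham_bracket_deg k l X Y : k \in degrees -> l \in degrees -> k + l \in degrees ->
  X \in ham'_deg F 2 k -> Y \in ham'_deg F 2 l -> sbracket X Y \in ham'_deg F 2 (k + l).
Proof.
move=> kd ld kld; rewrite !ham'_degE //.
apply: (closes_sbracket (D := ham_labels) (br := ham_table)).
- by move=> a b _ _; apply: ham_field_bracket.
- exact: filter_uniq.
- exact: filter_uniq.
- by move=> a; rewrite mem_filter => /andP[].
- by move=> a; rewrite mem_filter => /andP[].
have /allP/(_ k kd)/allP/(_ l ld) : all (fun k => all (fun l => closes ham_table
    [seq j <- ham_labels | ham_label_deg j == k]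
    [seq j <- ham_labels | ham_label_deg j == l]
    [seq j <- ham_labels | ham_label_deg j == k + l]) degrees) degrees.
  by vm_compute.
by [].
Qed.

Lemma conjs_ham'_deg phi : canonical_change phi ->
  forall k, k \in degrees -> conjs phi (ham'_deg F 2 k) = ham'_deg F 2 k.
Proof.
move=> phi_can k kd; have phi_lc := phi_can.1.
have [M _ phiP] := (substitutesP phi).1 phi_lc.
apply/eqP; rewrite eqEdim (dim_conjs phi_lc) leqnn andbT.
apply/subvP => _ /conjs_memP[X Xk ->]; have [d d4 Ek] := degreesP kd.
rewrite Ek in Xk *; have [f fd ->] := ham'_deg_hfield d4 Xk.
rewrite conj_hfield //; apply: hfield_ham'_deg => //.
exact: (substitutes_homog phiP).
Qed.

Lemma ham'_sum : ham' F 2 = (\sum_(k <- degrees) ham'_deg F 2 k)%VS.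
Proof.
pose part k := [seq a <- ham_labels | ham_label_deg a == k].
have spanE (ks : seq int) :
    (\sum_(k <- ks) <<labels (part k)>>)%VS = <<labels (flatten (map part ks))>>%VS.
  elim: ks => [|k ks IHks]; first by rewrite big_nil span_nil.
  by rewrite big_cons IHks map_cat span_cat.
apply: (etrans (ham'E F)); rewrite (eq_big_seq _ (@ham'_degE F)) spanE.
apply: eq_span => X; apply: eq_mem_map => a; apply/idP/flatten_mapP => [aD|[k _]].
  by exists (ham_label_deg a); rewrite ?ham_label_degP // mem_filter eqxx.
by rewrite mem_filter => /andP[].
Qed.

Lemma conjs_ham' phi : canonical_change phi -> conjs phi (ham' F 2) = ham' F 2.
Proof.
move=> phi_can; rewrite ham'_sum /conjs limg_sum.
by apply: eq_big_seq => k kd; apply: conjs_ham'_deg.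
Qed.

(** The target [t] is either [s] itself or its derived algebra. The Poisson
    bracket is replaced by a homogeneous function with the same field, the two
    differing at most by a constant. *)
Lemma section_bracket (d e : nat) (s t : {vspace gl}) f g :
  (0 < d < 4)%N -> (0 < e < 4)%N -> (2 < d + e < 6)%N ->
  (forall X Y, X \in s -> Y \in s -> sbracket X Y \in t) ->
  section_of s d f -> section_of s e g ->
  exists2 h, section_of t (d + e - 2) h & hfield h = hfield (poisson f g).
Proof.
move=> d4 e4 de st [fd fs] [ge gs].
have fgE := sbracket_hfield (homog_gpar fd) (homog_gpar ge).
have [||h hde hE] := @ham'_deg_hfield (d + e - 2) (hfield (poisson f g)).
- by move: de; lia.
- have -> : (d + e - 2)%N%:Z - 2 = (d%:Z - 2) + (e%:Z - 2) by move: de; lia.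
  rewrite -fgE; apply: ham_bracket_deg; rewrite ?degree_in_degrees ?hfield_ham'_deg //.
  have -> : (d%:Z - 2) + (e%:Z - 2) = (d + e - 2)%N%:Z - 2 by move: de; lia.
  by apply: degree_in_degrees; move: de; lia.
by exists h; rewrite -?hE //; split; rewrite // -hE -fgE; apply: st.
Qed.

End HamGrading.

(* The coefficient formulas leave index sets as closed terms, which must be
   evaluated before hypotheses on coefficients can match them. *)
Ltac eval_bits := repeat match goal with
  | |- context [bits 4 ?p] => progress (let v := eval vm_compute in (bits 4 p) in
      change (bits 4 p) with v)
  | |- context [bits_remove 4 ?k ?a] => progress (
      let v := eval vm_compute in (bits_remove 4 k a) in change (bits_remove 4 k a) with v)
  end.

Section HamClassification.
Variable C : numClosedFieldType.
Local Notation L := (grassmann C (2 + 2)).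
Local Notation gl := 'End(L).
Local Notation x := (gen C).
Local Notation labels := (map (@ham_field C)).
Local Notation gs := (graded_solvable (ham' C 2) (@ham'_deg C 2)).
Local Notation o := false (only parsing).
Local Notation i := true (only parsing).
Implicit Types (f g h t : L) (X Y : gl) (s : {vspace gl}) (phi : gl).

Lemma two_neq0 : (2 : C) != 0.
Proof. by rewrite Num.Theory.pnatr_eq0. Qed.

Lemma coefD f g a : coef (f + g) a = coef f a + coef g a.
Proof. exact: gcoefD. Qed.
Lemma coefN f a : coef (- f) a = - coef f a.
Proof. exact: gcoefN. Qed.
Lemma coefZ u f a : coef (u *: f) a = u * coef f a.
Proof. exact: gcoefZ. Qed.
Definition coefE := (coefD, coefN, coefZ).

Lemma homog_hfield_gen f k : homog 2 f -> homog 1 (hfield f (x k)).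
Proof.
move=> f2; rewrite hfield_gen (gtwist_gpar (homog_gpar f2)) expr0 scale1r => A A1.
rewrite gderE; case: ifP => // kA; rewrite f2 ?mulr0 // cardsU1 kA.
by rewrite eqSS.
Qed.

Lemma section_derived s f g : section_of s 2 f -> section_of s 2 g ->
  exists2 h, section_of (derived s) 2 h &
    spin_left h = spin_left g *m spin_left f - spin_left f *m spin_left g /\
    spin_right h = spin_right f *m spin_right g - spin_right g *m spin_right f.
Proof.
move=> fs gs; have [f2 g2] := (fs.1, gs.1).
have [h hs hE] := @section_bracket C 2 2 s (derived s) g f isT isT isT
  (fun X Y => @mem_derived _ _ s X Y) gs fs.
exists h => //; apply: (spin_bracket two_neq0 g2 f2 hs.1).
rewrite hE -(sbracket_hfield (homog_gpar g2) (homog_gpar f2)).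
rewrite (sbracket_opar (opar_hfield (homog_gpar g2)) (opar_hfield (homog_gpar f2))).
have Df k := homog_hfield_gen k f2; have Dg k := homog_hfield_gen k g2.
by rewrite -scaleNr degree0_mxD !degree0_mx_comp // expr0 scaleN1r.
Qed.

(** Lie's theorem for each of the two sl(2) factors: the product of the two
    eigenvectors is a rank one matrix, that is, an isotropic vector. *)
Lemma ham_isotropic_line s : gs s -> exists (u r : 'rV[C]_2), [/\ u != 0, r != 0 &
  forall f, section_of s 2 f -> exists a,
    hfield f (spin_linform (u^T *m r)) = a *: spin_linform (u^T *m r)].
Proof.
case=> s_sub _ [k sk]; pose D j := iter j (@derived C (2 + 2)) s.
pose Sl j m := exists2 f, section_of (D j) 2 f & m = (spin_left f)^T.
pose Sr j m := exists2 f, section_of (D j) 2 f & m = spin_right f.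
have decr j f : section_of (D j.+1) 2 f -> section_of (D j) 2 f.
  by case=> f2 fj; split=> //; apply: (subvP (iter_derived_decr j s_sub)).
have zero f : section_of (D k) 2 f -> {in ham_labels, forall a, coef f a = 0}.
  case=> f2; rewrite /D sk memv0 => /eqP f0 a aD.
  by rewrite (@hfield_coef_inj _ f 0 a aD) ?f0 ?hfield0 // /coef gcoef0.
(* Lines are stable under an action on rows, so the left factor is transposed. *)
have [u [u0 uP]] : exists u, stable_line (Sl 0%N) u.
  apply: (@lie_theorem2 C k Sl) => [j m [f /decr fj ->]|j m m'|m [f /zero f0 ->]].
  - by exists f.
  - move=> [f fj ->] [g gj ->]; have [h hj [hl _]] := section_derived fj gj.
    by exists h; rewrite // hl linearB /= !trmx_mul.
  by apply: mx2P; rewrite !mxE /= !f0 // !(addr0, oppr0, mul0r).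
have [r [r0 rP]] : exists r, stable_line (Sr 0%N) r.
  apply: (@lie_theorem2 C k Sr) => [j m [f /decr fj ->]|j m m'|m [f /zero f0 ->]].
  - by exists f.
  - by move=> [f fj ->] [g gj ->]; have [h hj [_ hr]] := section_derived fj gj; exists h.
  by apply: mx2P; rewrite !mxE /= !f0 // !(addr0, oppr0, mul0r).
exists u, r; split=> // f fs; have f2 := fs.1.
have /sub_rVP[a ua] : (u *m (spin_left f)^T <= u)%MS by apply: uP; exists f.
have /sub_rVP[b rb] : (r *m spin_right f <= r)%MS by apply: rP; exists f.
exists (a + b); rewrite /spin_linform degree0_mxE; last by move=> j; apply: homog_hfield_gen.
rewrite (spin_action two_neq0) // mulmxA -[X in spin (_ + X)]mulmxA rb.
rewrite -[spin_left f]trmxK -trmx_mul ua linearZ -scalemxAl -scalemxAr -scalerDl.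
rewrite /linform scaler_sumr.
apply: eq_bigr => j _; rewrite scalerA; congr (_ *: _); rewrite !mxE.
by case: (ord4 j) => ->; rewrite /= ?mulrN.
Qed.

(** The two coefficients, of xi2 eta1 and eta1 eta2, are those through which
    the degree 0 part could move the line of [x xi1]. *)
Definition fixes_xi1 s := forall f, section_of s 2 f ->
  coef f [:: o; i; i; o] = 0 /\ coef f [:: o; o; i; i] = 0.

Lemma normalize_line s (u r : 'rV[C]_2) : u != 0 -> r != 0 ->
  (forall f, section_of s 2 f -> exists a,
    hfield f (spin_linform (u^T *m r)) = a *: spin_linform (u^T *m r)) ->
  exists phi, [/\ canonical_change phi, phi (spin_linform (u^T *m r)) = x xi1
    & fixes_xi1 (conjs phi s)].
Proof.
move=> u0 r0 stable; have [phi phi_can phiv] := isotropic_normalize u0 r0.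
exists phi; split=> // f /(section_conjs_ex phi_can)[g ->{f} gs].
have [a va] := stable g gs.
have phig2 : homog 2 (phi g) by have [] := (section_conjs s 2 g phi_can).2 gs.
have E : hfield (phi g) (x xi1) = a *: x xi1.
  by rewrite -conj_hfield // -phiv conjE ?va ?linearZ //; apply: phi_can.1.
have mxE0 b : b != xi1 -> degree0_mx (hfield (phi g)) xi1 b = 0.
  by move=> b1; rewrite mxE E gcoefZ ffunE (inj_eq set1_inj) (negPf b1) mulr0.
have := (mxE0 xi2 isT, mxE0 eta2 isT).
by rewrite (hfield_mx phig2) !mxE /= => -[/eqP]; rewrite oppr_eq0 => /eqP.
Qed.

Lemma gder_linform f k : homog 1 f -> gder k f = f [set k] *: gone C (2 + 2).
Proof.
move=> f1; have df0 : homog 0 (gder k f).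
  move=> A A0; rewrite gderE; case: ifP => // kA; rewrite f1 ?mulr0 //.
  by rewrite cardsU1 kA eqSS.
rewrite (homog0_gone df0) gderE inE setU0.
by rewrite /before (_ : [set _ in _ | _] = set0) ?cards0 ?mul1r //; apply/setP => j; rewrite !inE.
Qed.

Lemma poisson_linform f g : homog 1 f ->
  poisson f g = - \sum_k f [set k] *: gder (dual k) g.
Proof.
move=> f1; rewrite poissonE (gtwist_gpar (homog_gpar f1)) expr1 scaleN1r -sumrN.
by apply: eq_bigr => k _; rewrite linearN /= gmulNl gder_linform // gmulZl gmul1l.
Qed.

Lemma homog_gen k : homog 1 (x k : L).
Proof. by have := @homog_mono C (2 + 2) [set k]; rewrite cards1. Qed.

Lemma gen_set1 k l : (x k : L) [set l] = (l == k)%:R.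
Proof. by rewrite ffunE (inj_eq set1_inj). Qed.

Lemma linform_set1 f k : f [set k] = coef f (bits 4 (pred1 (val k))).
Proof. by rewrite set1_bits. Qed.

Lemma poisson_linform_coef f g a : homog 1 f ->
  coef (poisson f g) a =
    - (coef f [:: i; o; o; o] * coef (gder eta1 g) a
       + coef f [:: o; i; o; o] * coef (gder eta2 g) a
       + coef f [:: o; o; i; o] * coef (gder xi1 g) a
       + coef f [:: o; o; o; i] * coef (gder xi2 g) a).
Proof.
move=> f1; rewrite poisson_linform // coefN sum4 !coefD !coefZ !dual4 !linform_set1.
by [].
Qed.

(** Brackets of the degree -1 and 1 parts lie in the degree 0 part, which is
    triangular once the line of [x xi1] is fixed. *)
Lemma fixes_xi1_relations s f t : gs s -> fixes_xi1 s ->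
  section_of s 1 f -> section_of s 3 t ->
  coef f [:: o; o; i; o] * coef t [:: i; i; i; o]
    + coef f [:: o; i; o; o] * coef t [:: o; i; i; i] = 0 /\
  coef f [:: o; o; i; o] * coef t [:: i; o; i; i]
    + coef f [:: o; o; o; i] * coef t [:: o; i; i; i] = 0.
Proof.
move=> [[_ _ s_br] _ _] s_fix fs ts.
have [h hs hE] := @section_bracket C 1 3 s s f t isT isT isT s_br fs ts.
have [h12 h23] := s_fix h hs.
rewrite (hfield_coef_inj _ hE) // (poisson_linform_coef _ _ fs.1) in h12.
rewrite (hfield_coef_inj _ hE) // (poisson_linform_coef _ _ fs.1) in h23.
move: h12 h23; rewrite !gder_coef /= !(mulr0, expr0, expr2, mul1r, mulrNN, add0r, addr0).
move=> /eqP; rewrite oppr_eq0 => /eqP h12 /eqP; rewrite oppr_eq0 => /eqP h23.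
by split; [rewrite addrC; exact: h12 | exact: h23].
Qed.

(** A subspace is contained in a coordinate model as soon as its generating
    functions avoid the monomials that the model lacks. *)
Lemma sub_model s P : gs s ->
  {in [seq a <- ham_labels | a \notin P], forall a f,
     section_of s (bits_card 4 a) f -> coef f a = 0} ->
  (s <= <<labels P>>)%VS.
Proof.
move=> [_ s_gr _] sP; apply: (graded_subv s_gr) => k X kd Xs Xk.
have [d d4 Ek] := degreesP kd; rewrite Ek in Xk.
have [f fd EX] := ham'_deg_hfield d4 Xk; rewrite EX; apply: hfield_labels => a a4 fa.
have ad := homog_coef fd fa; apply: contraNT fa => aP; apply/eqP.
apply: (sP a _ f); last by rewrite ad; split; rewrite -?EX.
by rewrite !mem_filter aP a4 ad d4.
Qed.

Lemma msVtilde_cover s : gs s -> fixes_xi1 s ->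
  (forall f, section_of s 1 f -> coef f [:: o; o; i; o] = 0) ->
  (forall t, section_of s 3 t -> coef t [:: o; i; i; i] = 0) ->
  (s <= <<labels ham_msVtilde_labels>>)%VS.
Proof.
move=> s_gs s_fix s1 s3; apply: sub_model => // a.
have -> : [seq a <- ham_labels | a \notin ham_msVtilde_labels] =
  [:: [:: o; o; i; o]; [:: o; o; i; i]; [:: o; i; i; o]; [:: o; i; i; i]] by vm_compute.
rewrite !inE => /or4P[] /eqP -> f; [exact: s1 | | | exact: s3].
  by move=> /s_fix[].
by move=> /s_fix[].
Qed.

Lemma gen_mul_coef k f a : coef (x k ** f) a =
  if mem_bits a k then (-1) ^+ bits_before 4 k a * coef f (bits_remove 4 k a) else 0.
Proof. by rewrite /coef gen_mulE in_bitset before_bitset bitsetD1. Qed.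

Lemma homog4_eq0 f : homog 4 f -> coef f [:: i; i; i; i] = 0 -> f = 0.
Proof.
move=> f4 f0; apply/ffunP => A; rewrite gcoef0.
have [A4|/f4//] := eqVneq #|A| 4; rewrite -[RHS]f0 /coef; congr (f _).
have -> : A = setT by apply/eqP; rewrite eqEcard subsetT cardsT card_ord A4.
by apply/setP => k; rewrite !inE; case: (ord4 k) => ->.
Qed.

(** Here [f0] is not orthogonal to [x xi1], and [t0] is not annihilated by
    multiplication with it. These two obstructions together make the isotropic
    vector [x xi2 - rho *: x xi1], for a suitable [rho], orthogonal to the whole
    degree -1 part and annihilate the whole degree 1 part. Its line is stable
    as well, so it can be moved to that of [x xi1], and then neither obstruction
    remains. *)
Lemma second_line s f0 t0 : gs s -> fixes_xi1 s ->
  section_of s 1 f0 -> coef f0 [:: o; o; i; o] != 0 ->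
  section_of s 3 t0 -> coef t0 [:: o; i; i; i] != 0 ->
  exists2 phi, canonical_change phi & (conjs phi s <= <<labels ham_msVtilde_labels>>)%VS.
Proof.
move=> s_gs s_fix f0s f0_neq0 t0s t0_neq0; have [[_ _ s_br] _ _] := s_gs.
pose rho := coef f0 [:: o; o; o; i] / coef f0 [:: o; o; i; o].
have rhoE : coef f0 [:: o; o; o; i] = rho * coef f0 [:: o; o; i; o] by rewrite divfK.
have t_rho t : section_of s 3 t -> coef t [:: i; o; i; i] = - rho * coef t [:: o; i; i; i].
  move=> ts; apply: (mulfI f0_neq0); apply/eqP; rewrite -subr_eq0; apply/eqP.
  by have [_ <-] := fixes_xi1_relations s_gs s_fix f0s ts; rewrite rhoE; ring.
have f_rho f : section_of s 1 f -> coef f [:: o; o; o; i] = rho * coef f [:: o; o; i; o].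
  move=> fs; apply: (mulIf t0_neq0); apply/eqP; rewrite -subr_eq0; apply/eqP.
  by have [_ <-] := fixes_xi1_relations s_gs s_fix fs t0s; rewrite (t_rho t0 t0s); ring.
(* The bracket of [f0] with a quadratic function is again in the degree -1 part
   and satisfies the relation [f_rho]; this is the stability of the line. *)
have q_rho f : section_of s 2 f ->
    coef f [:: i; o; o; i] = rho * (coef f [:: i; o; i; o] - coef f [:: o; i; o; i]).
  move=> fs; have [f12 f23] := s_fix f fs.
  have [h hs hE] := @section_bracket C 1 2 s s f0 f isT isT isT s_br f0s fs.
  have := f_rho h hs.
  rewrite !(hfield_coef_inj _ hE) // !(poisson_linform_coef _ _ f0s.1) !gder_coef /=.
  eval_bits; rewrite f12 f23 rhoE.
  rewrite !(mulr0, expr0, expr1, mul1r, add0r, addr0) => E.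
  apply: (mulfI f0_neq0); apply/eqP; rewrite -subr_eq0; apply/eqP.
  move/eqP: E; rewrite -subr_eq0 => /eqP/(congr1 -%R); rewrite oppr0 => <-.
  by ring.
have u0 : delta_mx 0 0 != 0 :> 'rV[C]_2.
  by apply/eqP => /matrixP/(_ 0 0)/eqP; rewrite !mxE oner_eq0.
(* The matrix of [x xi2 - rho *: x xi1] is the product of these two vectors. *)
pose r : 'rV[C]_2 := \row_k if k == 0 then - rho else 1.
have r0 : r != 0 by apply/eqP => /matrixP/(_ 0 1)/eqP; rewrite !mxE oner_eq0.
have wE : (delta_mx 0 0 : 'rV[C]_2)^T *m r = mx2 (- rho) 1 0 0.
  by apply: mx2P; rewrite !mxE big_ord1 !mxE /= ?mul1r ?mul0r.
have [|phi [phi_can phiw phi_fix]] := @normalize_line s (delta_mx 0 0) r u0 r0.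
  move=> f fs; have [f12 f23] := s_fix f fs; exists (- coef f [:: o; i; o; i]).
  rewrite wE /spin_linform degree0_mxE; last by move=> j; apply: homog_hfield_gen fs.1.
  rewrite (hfield_mx fs.1) /linform scaler_sumr; apply: eq_bigr => j _.
  rewrite scalerA; congr (_ *: _); rewrite !mxE sum4 !mxE /=.
  by case: (ord4 j) => ->; rewrite /= ?f12 ?f23 ?(q_rho f fs); ring.
have {phiw} phiw : phi (x xi2 - rho *: x xi1) = x xi1.
  rewrite -[RHS]phiw wE /spin_linform /linform sum4 !mxE /= !oppr0 !scale0r !addr0.
  by rewrite scale1r scaleNr addrC.
exists phi => //; have [phi_lc phi_poisson] := phi_can.
have [M _ phiP] := (substitutesP phi).1 phi_lc.
apply: msVtilde_cover => // [|f|t].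
- exact/(graded_solvable_conjs phi_lc s (conjs_ham' phi_can) (conjs_ham'_deg phi_can)).
- move=> /(section_conjs_ex phi_can)[g -> gs1].
  have poisson0 : poisson (x xi2 - rho *: x xi1) g = 0.
    rewrite poisson_linform; last first.
      by rewrite -scaleNr; apply: homogD; last apply: homogZ; apply: homog_gen.
    rewrite sum4 !(gcoefD, gcoefN, gcoefZ) !gen_set1 !dual4 !(gder_linform _ gs1.1).
    rewrite !linform_set1; eval_bits; rewrite (f_rho g gs1) -!val_eqE /= !scalerA -!scalerDl.
    by apply/eqP; rewrite oppr_eq0; apply/eqP; rewrite (_ : _ + _ = 0) ?scale0r //; ring.
  have := phi_poisson (x xi2 - rho *: x xi1) g; rewrite poisson0 linear0 phiw.
  rewrite (poisson_linform _ (@homog_gen xi1)) sum4 !gen_set1 !dual4.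
  rewrite (gder_linform _ (substitutes_homog phiP gs1.1)) -!val_eqE /= !scale0r !addr0 scale1r.
  move/ffunP/(_ set0)/eqP.
  rewrite !gcoefE [_ set0]ffunE eqxx mulr1 eq_sym oppr_eq0 linform_set1 => /eqP.
  by eval_bits.
(* The coefficient of xi2 eta1 eta2 is tested by multiplication with xi1. *)
move=> /(section_conjs_ex phi_can)[g -> gs3].
have mul_homog k : homog 4 (x k ** g) by apply: homog_gen_mul gs3.1.
have mul0 : (x xi2 - rho *: x xi1) ** g = 0.
  apply: homog4_eq0; rewrite gmulDl gmulNl gmulZl.
    by apply: homogD; rewrite // -scaleNr; apply: homogZ.
  rewrite !coefE !gen_mul_coef /=; eval_bits; rewrite (t_rho g gs3) /=.
  by rewrite expr0 expr1; ring.
have := substitutes_gmul (x xi2 - rho *: x xi1) g phiP; rewrite mul0 linear0 phiw.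
move=> /ffunP/(_ (bitset (2 + 2) [:: i; i; i; i])); rewrite gcoef0 -/(coef _ _).
by rewrite gen_mul_coef /=; eval_bits; rewrite expr0 mul1r.
Qed.

Definition ham_models : seq {vspace gl} := [seq <<labels P>>%VS | P <- ham_model_labels].

Lemma mem_ham_models P : P \in ham_model_labels -> <<labels P>>%VS \in ham_models.
Proof. exact: map_f. Qed.

Lemma mem_model_labels P : P \in ham_model_labels ->
  [\/ P = ham_msV_labels, P = ham_msc_labels | P = ham_msVtilde_labels].
Proof. by rewrite !inE => /or3P[] /eqP ->; [constructor 1 | constructor 2 | constructor 3]. Qed.

(** By [fixes_xi1_relations], one nonzero coefficient of eta1 in degree -1 kills
    the unwanted coefficients in degree 1 as soon as that of xi2 eta1 eta2
    vanishes there, and conversely. *)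
Lemma ham_cover_fixed s : gs s -> fixes_xi1 s ->
  exists phi c, [/\ canonical_change phi, c \in ham_models & (conjs phi s <= c)%VS].
Proof.
move=> s_gs s_fix; have rel := fixes_xi1_relations s_gs s_fix.
have [[f0 f0s f0_neq0]|no_f0] :=
    classic (exists2 f, section_of s 1 f & coef f [:: o; o; i; o] != 0);
  have [[t0 t0s t0_neq0]|no_t0] :=
    classic (exists2 t, section_of s 3 t & coef t [:: o; i; i; i] != 0).
- have [phi phi_can sub] := second_line s_gs s_fix f0s f0_neq0 t0s t0_neq0.
  by exists phi, <<labels ham_msVtilde_labels>>%VS; split; rewrite ?mem_ham_models.
- have t3 t : section_of s 3 t -> coef t [:: o; i; i; i] = 0.
    by move=> ts; apply/eqP; apply: contra_notT no_t0 => t_neq0; exists t.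
  exists \1%VF, <<labels ham_msc_labels>>%VS; rewrite conjs_id.
  split; [exact: canonical_id | exact: mem_ham_models |].
  apply: sub_model => // a; rewrite (_ : filter _ _ = [:: [:: o; o; i; i];
    [:: o; i; i; o]; [:: o; i; i; i]; [:: i; o; i; i]; [:: i; i; i; o]]); last by vm_compute.
  have drop b (u : C) : coef f0 [:: o; o; i; o] * b + u * 0 = 0 -> b = 0.
    by rewrite mulr0 addr0 => /eqP; rewrite mulf_eq0 (negPf f0_neq0) => /eqP.
  rewrite !inE => /or4P[/eqP-> f /s_fix[]//|/eqP-> f /s_fix[]//|/eqP-> f /t3//|].
  case/orP=> /eqP -> t ts; have [r1 r2] := rel f0 t f0s ts; rewrite (t3 t ts) in r1 r2.
    exact: drop r2.
  exact: drop r1.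
- have f2 f : section_of s 1 f -> coef f [:: o; o; i; o] = 0.
    by move=> fs; apply/eqP; apply: contra_notT no_f0 => f_neq0; exists f.
  exists \1%VF, <<labels ham_msV_labels>>%VS; rewrite conjs_id.
  split; [exact: canonical_id | exact: mem_ham_models |].
  apply: sub_model => // a; rewrite (_ : filter _ _ = [:: [:: o; o; o; i];
    [:: o; o; i; o]; [:: o; o; i; i]; [:: o; i; o; o]; [:: o; i; i; o]]); last by vm_compute.
  have drop b (u : C) : 0 * u + b * coef t0 [:: o; i; i; i] = 0 -> b = 0.
    by rewrite mul0r add0r => /eqP; rewrite mulf_eq0 (negPf t0_neq0) orbF => /eqP.
  have f13 f : section_of s 1 f -> coef f [:: o; i; o; o] = 0 /\ coef f [:: o; o; o; i] = 0.
    move=> fs; have [r1 r2] := rel f t0 fs t0s; rewrite (f2 f fs) in r1 r2.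
    by split; [apply: drop r1 | apply: drop r2].
  rewrite !inE => /or4P[/eqP-> f /f13[]//|/eqP-> f /f2//|/eqP-> f /s_fix[]//|].
  by case/orP=> /eqP -> f; [move=> /f13[] | move=> /s_fix[]].
exists \1%VF, <<labels ham_msVtilde_labels>>%VS; rewrite conjs_id.
split; [exact: canonical_id | exact: mem_ham_models |].
apply: msVtilde_cover => // [f fs|t ts]; apply/eqP.
  by apply: contra_notT no_f0 => f_neq0; exists f.
by apply: contra_notT no_t0 => t_neq0; exists t.
Qed.

Lemma ham_cover s : gs s ->
  exists phi c, [/\ canonical_change phi, c \in ham_models & (conjs phi s <= c)%VS].
Proof.
move=> s_gs; have [u [r [u0 r0 stable]]] := ham_isotropic_line s_gs.
have [phi [phi_can _ phi_fix]] := normalize_line u0 r0 stable.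
have phi_lc := phi_can.1.
have phis_gs : gs (conjs phi s).
  exact/(graded_solvable_conjs phi_lc s (conjs_ham' phi_can) (conjs_ham'_deg phi_can)).
have [psi [c [psi_can cm sub]]] := ham_cover_fixed phis_gs phi_fix.
have comp_can := canonical_comp phi_can psi_can.
exists (psi \o phi)%VF, c; split=> //.
by rewrite (conjs_comp _ phi_lc psi_can.1 comp_can.1).
Qed.

Lemma ham_models_gs c : c \in ham_models -> gs c.
Proof.
have models_gs := span_models_gs ham_labels_uniq (ham_field_free C)
  (ham_field_bracket_in C (D := ham_labels)) (@ham_field_parity C) ham_label_degP
  (@ham'_degE C) ham_model_tables.
by rewrite /graded_solvable (ham'E C); apply: models_gs.
Qed.

Lemma ham_models_dim : {in ham_models &, forall c c',
  (forall k, k \in degrees ->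
     \dim (c :&: ham'_deg C 2 k) <= \dim (c' :&: ham'_deg C 2 k))%N -> c = c'}.
Proof.
apply: (span_models_dim ham_labels_uniq (ham_field_free C) (@ham'_degE C)).
  exact: ham_model_tables.
exact: ham_model_incomparable.
Qed.

Theorem ham_classification :
  (forall s, max_graded_solvable (ham' C 2) (@ham'_deg C 2) s <->
     [\/ poisson_equiv s (ham_msV C), poisson_equiv s (ham_msc C)
       | poisson_equiv s (ham_msVtilde C)])
  /\ [/\ ~ poisson_equiv (ham_msV C) (ham_msc C),
         ~ poisson_equiv (ham_msV C) (ham_msVtilde C)
       & ~ poisson_equiv (ham_msc C) (ham_msVtilde C)].
Proof.
have can_lc phi (phi_can : canonical_change phi) : linear_change phi := phi_can.1.
rewrite ham_msVE ham_mscE ham_msVtildeE; split=> [s|].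
  apply: iff_trans (max_iff_model can_lc (@conjs_ham' C) (@conjs_ham'_deg C)
    ham_models_gs ham_models_dim ham_cover s) _.
  split=> [[phi [c [[phi_lc phi_poisson]]]]|].
    case/mapP=> P Pm -> carry.
    have [EP|EP|EP] := mem_model_labels Pm; rewrite EP in carry.
    - by constructor 1; exists phi.
    - by constructor 2; exists phi.
    by constructor 3; exists phi.
  by case=> -[phi [phi_lc phi_poisson carry]]; exists phi; eexists;
     split; try exact: carry; rewrite // mem_ham_models.
have count_eq P Q : P \in ham_model_labels -> Q \in ham_model_labels ->
    poisson_equiv <<labels P>>%VS <<labels Q>>%VS ->
    degree_count ham_label_deg P 1 = degree_count ham_label_deg Q 1.
  move=> Pm Qm [phi [phi_lc phi_poisson carry]].
  apply: (span_degree_count ham_labels_uniq (ham_field_free C) (@ham'_degE C)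
    ham_model_tables Pm Qm) => //.
  have phi_can : canonical_change phi by [].
  exact: (models_inequivalent can_lc (@conjs_ham'_deg C) ham_models_dim phi_can
    (mem_ham_models Pm) (mem_ham_models Qm) carry).
split=> equiv.
- by have := count_eq ham_msV_labels ham_msc_labels isT isT equiv.
- by have := count_eq ham_msV_labels ham_msVtilde_labels isT isT equiv.
by have := count_eq ham_msc_labels ham_msVtilde_labels isT isT equiv.
Qed.

End HamClassification.

Theorem proposition6p1 (R : realType) :
  ((forall s : {vspace 'End(grassmann R[i] 2)},
      max_graded_solvable (vect R[i] 2) (@vect_deg R[i] 2) s <->
      lin_equiv s (vect_msV R[i]) \/ lin_equiv s (vect_msc R[i]))
   /\ ~ lin_equiv (vect_msV R[i]) (vect_msc R[i]))
  /\
  ((forall s : {vspace 'End(grassmann R[i] (2 + 2))},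
      max_graded_solvable (ham' R[i] 2) (@ham'_deg R[i] 2) s <->
      [\/ poisson_equiv s (ham_msV R[i]),
          poisson_equiv s (ham_msc R[i])
        | poisson_equiv s (ham_msVtilde R[i])])
   /\ [/\ ~ poisson_equiv (ham_msV R[i]) (ham_msc R[i]),
          ~ poisson_equiv (ham_msV R[i]) (ham_msVtilde R[i])
        & ~ poisson_equiv (ham_msc R[i]) (ham_msVtilde R[i])]).
Proof.
split; [exact: (@vect_classification R[i]) | exact: (@ham_classification R[i])].
Qed.
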